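(* Let $K$ be one of: (a) an algebraically closed field with the identity involution; (b) an algebraically closed field with a nonidentity involution; (c) a real closed field, or the algebra of quaternions over a real closed field (with some involution); (d) a finite field; in all cases of characteristic $\neq2$, with center $P$. Let $\mathcal C$ be a linear category over $P$ with involution. Then every selfadjoint representation of $\mathcal C$ over $K$ is congruent to an orthogonal sum, uniquely determined up to permutation of summands, of representations of the following forms, where $A\in\operatorname{ind}_1(\mathcal C)$ and $B\in\operatorname{ind}_0(\mathcal C)$: (a) $A^+$, $B$; (b) $A^+$, $B$, $B^{-1}$ (with $-1=-1_B\in\operatorname{Aut}(B)$); (c) $A^+$, $B^t$, where $t=1$ if $T(B)$ is an algebraically closed field with the identity involution or the algebra of quaternions with nonstandard involution, and $t=\pm1$ otherwise; (d) $A^+$, $B^t$, where $t=1$ if the involution on the field $T(B)$ is nonidentity, and $t$ is $1$ or a fixed nonsquare in $T(B)$ if the involution on $T(B)$ is the identity, and for each $B$ the orthogonal sum has at most one summand $B^t$ with $t\ne1$.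
   Context: $K$ has an involution $a\mapsto\bar a$ (bijection with $\bar{\bar a}=a$, $\overline{a+b}=\bar a+\bar b$, $\overline{ab}=\bar b\bar a$). Vector spaces are finite-dimensional right $K$-spaces. A linear category $\mathcal C$ over $P$ has $P$-vector-space Hom sets and bilinear composition; an involution on $\mathcal C$ assigns objects $u\mapsto u^*$ and morphisms $(\alpha:u\to v)\mapsto(\alpha^*:v^*\to u^* )$ with $u^{**}=u\neq u^*$, $\alpha^{**}=\alpha$, $(\alpha\beta)^*=\beta^*\alpha^*$, $(\alpha a)^*=\alpha^*\bar a$ ($a\in P$). A representation $A$ is a functor to finite-dimensional $K$-spaces with $\sum_u\dim A_u<\infty$ and $A_{\alpha a+\beta b}=A_\alpha a+A_\beta b$; morphisms $f:A\to B$ are families $f_u:A_u\to B_u$ with $f_vA_\alpha=B_\alpha f_u$. $V^*$ is the space of semilinear forms $\varphi:V\to K$ ($\varphi(xa)=\bar a\varphi(x)$), $A^*\varphi=\varphi A$, $V^{**}=V$. Adjoint representation: $A^\circ_u=(A_{u^*})^*$, $A^\circ_\alpha=(A_{\alpha^*})^*$; $f^\circ_u=(f_{u^*})^*$. Selfadjoint: $A=A^\circ$. Congruence: isomorphism $f$ of selfadjoint representations with $f^\circ=f^{-1}$. Fix a partition of objects into $S_0$ and $S_0^*$. Orthogonal sum $A\perp B$ of selfadjoint representations: $A\oplus B$ with $A_v^*\oplus B_v^*$ identified with $(A_v\oplus B_v)^*$ via $(\varphi+\psi)(a+b)=\varphi(a)+\psi(b)$, $v\in S_0$. $A^+$: the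 selfadjoint representation obtained from $A\oplus A^\circ$ by identifying $(A\oplus A^\circ)_{v^*}=A_{v^*}\oplus A_v^*$ with $(A_v\oplus A_{v^*}^* )^*$ (interchanging the summands), $v\in S_0$. For selfadjoint $A$ and automorphism $f=f^\circ$: $\tilde f_v=f_v$, $\tilde f_{v^*}=1$ ($v\in S_0$); $A^f_v=A_v$, $A^f_\alpha=\tilde f_v^{-1}A_\alpha\tilde f_u$ for $\alpha:u\to v$. $\operatorname{ind}(\mathcal C)$: a complete set of pairwise nonisomorphic indecomposable representations. $\operatorname{ind}_0(\mathcal C)$: its members isomorphic to selfadjoint representations, each replaced by a selfadjoint one. $\operatorname{ind}_1(\mathcal C)$: members isomorphic to their adjoint but not to a selfadjoint representation, plus one member of each pair $\{A,B\}$ with $A\not\cong A^\circ$, $A\cong B^\circ$. For $B\in\operatorname{ind}_0(\mathcal C)$, $T(B)=\operatorname{End}(B)/R$, $R$ the ideal of noninvertible endomorphisms; $T(B)$ is a skew field with involution $(f+R)^\circ=f^\circ+R$. For $0\ne a=a^\circ\in T(B)$ a fixed automorphism $f_a=f_a^\circ\in a$ is chosen and $B^a:=B^{f_a}$; $B^t$ means $B^a$ for the element $a=t$ of $T(B)$ (for $t=\pm1$ one may take $f_t=\pm1_B$). The standard involution on quaternions is $a+bi+cj+dk\mapsto a-bi-cj-dk$. *)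

(* Defs.v *)
From HB Require Import structures.
From mathcomp Require Import all_boot all_order all_algebra.
From Stdlib Require List Permutation.
Set Implicit Arguments.
Unset Strict Implicit.
Unset Printing Implicit Defensive.
Import GRing.Theory.
Local Open Scope ring_scope.

Definition is_involution (K : unitRingType) (bar : K -> K) : Prop :=
  involutive bar /\ (forall a b, bar (a + b) = bar a + bar b)
  /\ (forall a b, bar (a * b) = bar b * bar a).

(* Setting: skew field K with involution bar, its center P (a field, given    *)
(* with an embedding emb onto the center), and the involution barP induced on *)
(* P (emb (barP a) = bar (emb a)).                                            *)
Record ctx := Ctx {
  cK : unitRingType;
  cP : fieldType;
  cemb : cP -> cK;
  cbar : cK -> cK;
  cbarP : cP -> cP }.

Arguments Ctx : clear implicits.
Arguments cemb : clear implicits.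
Arguments cbar : clear implicits.
Arguments cbarP : clear implicits.

Record lincat (P : fieldType) := LinCat {
  obj : Type;
  hom : obj -> obj -> lmodType P;
  comp : forall u v w, hom v w -> hom u v -> hom u w;
  idm : forall u, hom u u;
  ostar : obj -> obj;
  hstar : forall u v, hom u v -> hom (ostar v) (ostar u) }.
Arguments obj {P} C : rename.
Arguments hom {P} C : rename.
Arguments comp {P C u v w} : rename.
Arguments idm {P C} u : rename.
Arguments ostar {P C} u : rename.
Arguments hstar {P C u v} : rename.

Definition hcast (P : fieldType) (C : lincat P) (u u' v v' : obj C)
  (e1 : u = u') (e2 : v = v') (f : hom C u v) : hom C u' v' :=
  match e1 in _ = a return hom C a v' with
  | erefl => match e2 in _ = b return hom C u b with erefl => f end
  end.

Definition is_lincat_inv (P : fieldType) (barP : P -> P) (C : lincat P) : Prop :=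
  (forall u v w x (f : hom C w x) (g : hom C v w) (h : hom C u v),
      comp f (comp g h) = comp (comp f g) h)
  /\ (forall u v (f : hom C u v), comp (idm v) f = f /\ comp f (idm u) = f)
  /\ (forall u v w (a : P) (f f' : hom C v w) (g : hom C u v),
        comp (a *: f + f') g = a *: comp f g + comp f' g)
  /\ (forall u v w (a : P) (f : hom C v w) (g g' : hom C u v),
        comp f (a *: g + g') = a *: comp f g + comp f g')
  /\ (forall u : obj C, ostar u <> u)
  /\ (exists ss : (forall u : obj C, ostar (ostar u) = u),
        forall u v (f : hom C u v), hstar (hstar f) = hcast (esym (ss u)) (esym (ss v)) f)
  /\ (forall u v w (f : hom C v w) (g : hom C u v),
        hstar (comp f g) = comp (hstar g) (hstar f))
  /\ (forall u v (a : P) (f f' : hom C u v),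
        hstar (a *: f + f') = barP a *: hstar f + hstar f').

Definition is_partition (P : fieldType) (C : lincat P) (s0 : obj C -> bool) : Prop :=
  forall u, s0 (ostar u) = ~~ s0 u.

Section Reps.
Variable X : ctx.
Local Notation K := (cK X).
Local Notation P := (cP X).
Local Notation emb := (cemb X).
Local Notation bar := (cbar X).
Variable C : lincat P.

(* Finite-dimensional right K-spaces are modelled by column spaces K^n;      *)
(* K-linear maps K^n -> K^m are m x n matrices acting on the left.           *)
Record rdata := RData {
  rdim : obj C -> nat;
  rmat : forall u v, hom C u v -> 'M[K]_(rdim v, rdim u) }.
Arguments RData : clear implicits.
Arguments rmat r {u v}.

(* The dual V^* of K^n (semilinear forms phi(x) = sum_i bar(x_i) w_i) is again *)
(* K^n, and the dual of a map with matrix M has matrix bar(M)^T.             *)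
Definition conjT m n (M : 'M[K]_(m, n)) : 'M[K]_(n, m) := (map_mx bar M)^T.

Definition is_rep (A : rdata) : Prop :=
  (forall u v w (f : hom C v w) (g : hom C u v),
      rmat A (comp f g) = rmat A f *m rmat A g)
  /\ (forall u, rmat A (idm u) = 1%:M)
  /\ (forall u v (a : P) (f f' : hom C u v),
        rmat A (a *: f + f') = emb a *: rmat A f + rmat A f')
  /\ (exists s : seq (obj C), forall u, ~ List.In u s -> rdim A u = 0%N).

Definition is_morph (A B : rdata) (f : forall u, 'M[K]_(rdim B u, rdim A u)) : Prop :=
  forall u v (a : hom C u v), f v *m rmat A a = rmat B a *m f u.

Definition iso_via (A B : rdata) (f : forall u, 'M[K]_(rdim B u, rdim A u))
  (g : forall u, 'M[K]_(rdim A u, rdim B u)) : Prop :=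
  is_morph f /\ (forall u, g u *m f u = 1%:M /\ f u *m g u = 1%:M).

Definition iso (A B : rdata) : Prop := exists f g, @iso_via A B f g.

Definition dsum (A B : rdata) : rdata :=
  RData (fun u => rdim A u + rdim B u)%N
        (fun u v a => block_mx (rmat A a) 0 0 (rmat B a)).

Definition rzero : rdata := RData (fun _ => 0%N) (fun u v a => 0).

Definition is_zero (A : rdata) : Prop := forall u, rdim A u = 0%N.

Definition indecomposable (A : rdata) : Prop :=
  is_rep A /\ ~ is_zero A /\
  forall A1 A2, is_rep A1 -> is_rep A2 -> iso A (dsum A1 A2) -> is_zero A1 \/ is_zero A2.

Definition adj (A : rdata) : rdata :=
  RData (fun u => rdim A (ostar u)) (fun u v a => conjT (rmat A (hstar a))).

(* selfadjoint: A = A° (with A_{u*} = (A_u)^* identified through coordinates) *)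
Definition is_sa (A : rdata) : Prop :=
  is_rep A /\
  exists e : (forall u, rdim A (ostar u) = rdim A u),
    forall u v (a : hom C u v),
      rmat A (hstar a) = castmx (esym (e u), esym (e v)) (conjT (rmat A a)).

Definition congruent (A B : rdata) : Prop :=
  exists (eA : forall u, rdim A (ostar u) = rdim A u)
         (eB : forall u, rdim B (ostar u) = rdim B u) f g,
    @iso_via A B f g /\
    forall u, castmx (eA u, eB u) (conjT (f (ostar u))) = g u.

Definition osum (l : seq rdata) : rdata := foldr dsum rzero l.

(* A^+ : at u in S0 the space is A_u (+) A°_u, at u in S0^* it is            *)
(* A°_u (+) A_u, so that A^+_{u*} = (A^+_u)^* coordinatewise.                *)
Definition plus_blk (bw bu : bool) m1 m2 n1 n2 (M : 'M[K]_(m1, n1)) (N : 'M[K]_(m2, n2)) :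
  'M[K]_(if bw then m1 + m2 else m2 + m1, if bu then n1 + n2 else n2 + n1)%N :=
  match bw as b1, bu as b2
  return 'M[K]_(if b1 then m1 + m2 else m2 + m1, if b2 then n1 + n2 else n2 + n1)%N with
  | true, true => block_mx M 0 0 N
  | true, false => block_mx 0 M N 0
  | false, true => block_mx 0 N M 0
  | false, false => block_mx N 0 0 M
  end.

Definition rplus (s0 : obj C -> bool) (A : rdata) : rdata :=
  RData (fun u => if s0 u then rdim A u + rdim A (ostar u) else rdim A (ostar u) + rdim A u)%N
        (fun u v a => plus_blk (s0 v) (s0 u) (rmat A a) (rmat (adj A) a)).

(* A^f for an automorphism f = f° of A with inverse g:                       *)
(* A^f_alpha = ftilde_v^{-1} A_alpha ftilde_u, ftilde = f on S0, 1 on S0^*.  *)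
Definition rtwist (s0 : obj C -> bool) (A : rdata) (f g : forall u, 'M[K]_(rdim A u)) : rdata :=
  RData (rdim A)
        (fun u v a => (if s0 v then g v else 1%:M) *m rmat A a *m (if s0 u then f u else 1%:M)).

Definition is_endo (A : rdata) (f : forall u, 'M[K]_(rdim A u)) := @is_morph A A f.
Arguments is_endo : clear implicits.

Definition eadj (A : rdata) (e : forall u, rdim A (ostar u) = rdim A u)
  (f : forall u, 'M[K]_(rdim A u)) : forall u, 'M[K]_(rdim A u) :=
  fun u => castmx (e u, e u) (conjT (f (ostar u))).

(* f is a noninvertible endomorphism, i.e. f lies in R *)
Definition noninv (A : rdata) (f : forall u, 'M[K]_(rdim A u)) : Prop :=
  ~ exists g, is_endo A g /\ forall u, g u *m f u = 1%:M /\ f u *m g u = 1%:M.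

(* f + R = h + R in T(A) *)
Definition modR (A : rdata) (f h : forall u, 'M[K]_(rdim A u)) : Prop :=
  noninv (fun u => f u - h u).

Definition epow (A : rdata) (x : forall u, 'M[K]_(rdim A u)) (n : nat) :
  forall u, 'M[K]_(rdim A u) := fun u => iter n (mulmx (x u)) 1%:M.

Definition TB_inv_id (A : rdata) : Prop :=
  exists e, forall f, is_endo A f -> modR (@eadj A e f) f.

Definition TB_acf_id (A : rdata) : Prop :=
  TB_inv_id A
  /\ (forall f h, is_endo A f -> is_endo A h ->
        modR (fun u => f u *m h u) (fun u => h u *m f u))
  /\ (forall (n : nat) (c : nat -> forall u, 'M[K]_(rdim A u)),
        (forall i, is_endo A (c i)) ->
        exists x, is_endo A x /\
          modR (fun u => epow x n.+1 u + \sum_(i < n.+1) c i u *m epow x i u) (fun u => 0)).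

Definition quat_comb (A : rdata) (i j : forall u, 'M[K]_(rdim A u)) (a b c d : P) :
  forall u, 'M[K]_(rdim A u) :=
  fun u => emb a *: 1%:M + emb b *: i u + emb c *: j u + emb d *: (i u *m j u).

Definition TB_quat_nonstd (A : rdata) : Prop :=
  exists e i j,
    is_endo A i /\ is_endo A j
    /\ modR (fun u => i u *m i u) (fun u => - 1%:M)
    /\ modR (fun u => j u *m j u) (fun u => - 1%:M)
    /\ modR (fun u => i u *m j u) (fun u => - (j u *m i u))
    /\ (forall f, is_endo A f -> exists a b c d, modR f (quat_comb i j a b c d))
    /\ (forall a b c d, modR (quat_comb i j a b c d) (fun u => 0) ->
          [/\ a = 0, b = 0, c = 0 & d = 0])
    /\ ~ (modR (@eadj A e i) (fun u => - i u) /\ modR (@eadj A e j) (fun u => - j u)).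

Definition TB_nonsquare (A : rdata) (f : forall u, 'M[K]_(rdim A u)) : Prop :=
  ~ exists s, is_endo A s /\ modR (fun u => s u *m s u) f.

Definition sa_auto (A : rdata) (f g : forall u, 'M[K]_(rdim A u)) : Prop :=
  is_endo A f /\ (forall u, g u *m f u = 1%:M /\ f u *m g u = 1%:M)
  /\ exists e, @eadj A e f = f.

Definition in_ind0 (I : Type) (ind : I -> rdata) (i : I) : Prop :=
  exists B, is_sa B /\ iso (ind i) B.

Definition ind_setup (I : Type) (ind : I -> rdata) (I1 : I -> Prop) (B0 : I -> rdata) : Prop :=
  (forall i, indecomposable (ind i))
  /\ (forall i j, iso (ind i) (ind j) -> i = j)
  /\ (forall A, indecomposable A -> exists i, iso A (ind i))
  /\ (forall i, I1 i -> ~ in_ind0 ind i)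
  /\ (forall i, ~ in_ind0 ind i -> iso (ind i) (adj (ind i)) -> I1 i)
  /\ (forall i j, ~ iso (ind i) (adj (ind i)) -> iso (ind j) (adj (ind i)) ->
        (I1 i <-> ~ I1 j))
  /\ (forall i, in_ind0 ind i -> is_sa (B0 i) /\ iso (ind i) (B0 i)).

(* inl i        : the summand A^+ with A = ind i in ind_1                    *)
(* inr (i,false): the summand B = B^1 with B = B0 i in ind_0                 *)
(* inr (i,true) : the summand tw i = B^t for the case-specific t <> 1        *)
Definition realize (s0 : obj C -> bool) (I : Type) (ind B0 tw : I -> rdata)
  (l : I + I * bool) : rdata :=
  match l with
  | inl i => rplus s0 (ind i)
  | inr (i, k) => if k then tw i else B0 i
  end.

Definition lab_ok (I : Type) (ind : I -> rdata) (I1 : I -> Prop)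
  (cond : I -> bool -> Prop) (l : I + I * bool) : Prop :=
  match l with
  | inl i => I1 i
  | inr (i, k) => in_ind0 ind i /\ cond i k
  end.

Definition classifies (s0 : obj C -> bool) (I : Type) (ind B0 tw : I -> rdata)
  (ok : seq (I + I * bool) -> Prop) (A : rdata) : Prop :=
  (exists ls, ok ls /\ congruent A (osum (map (realize s0 ind B0 tw) ls)))
  /\ (forall ls ls', ok ls -> ok ls' ->
        congruent A (osum (map (realize s0 ind B0 tw) ls)) ->
        congruent A (osum (map (realize s0 ind B0 tw) ls')) ->
        Permutation.Permutation ls ls').

End Reps.
Arguments rdata : clear implicits.

Definition at_most_one_twist (I : Type) (ls : seq (I + I * bool)) : Prop :=
  ~ exists l1 l2 l3 i, ls = l1 ++ inr (i, true) :: l2 ++ inr (i, true) :: l3.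

Definition setup (X : ctx) (C : lincat (cP X)) (s0 : obj C -> bool) (I : Type)
  (ind : I -> rdata X C) (I1 : I -> Prop) (B0 : I -> rdata X C) : Prop :=
  is_lincat_inv (cbarP X) C /\ is_partition s0 /\ ind_setup ind I1 B0.

(* Main.v *)
(** By Fitting's lemma the endomorphism ring of an indecomposable B is local
    with nilpotent noninvertible elements, and sqrt(1 + r) exists for nilpotent
    r; hence two forms on B that agree modulo the radical are congruent.

    Existence. Let M be an indecomposable direct summand of a selfadjoint S, with
    inclusion x and projection p. If M carries a form, one of x, p°, x + p°
    pulls the form of S back to a nondegenerate form on M, and a twist B^f splits
    off. If it carries none, (x, p°) : M^+ -> S is an isometry up to a nilpotent,
    which a square root removes, and M^+ splits off.

    Uniqueness. The reflection 1 - z c z° with z = x - y exchanges two isometric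
    embeddings x, y of an indecomposable, so common summands B^t cancel. If B is
    a summand of S, and another decomposition contains no B, the Gram matrix of B
    modulo the radical writes 1 as a sum of terms z° t^-1 z over T(B), which is
    excluded in each case. The summands A^+ are left to the Krull-Schmidt
    theorem.

    What remains is to classify the forms of rank one over T(B). (a), (b): T(B)
    is K, by an eigenvalue argument. (c): the elements of T(B) are quadratic over
    P, and T(B) is found as in the theorem of Frobenius. (d): T(B) is a finite
    field, where the pigeonhole principle makes every element a sum of two
    squares. *)

(* The obstacle is strictness: a selfadjoint representation satisfies A = A° on the nose, whereas
   splitting off a summand only yields a representation with a form A -> A°. The partition into S0
   and its dual half closes the gap, because a base change at the vertices of one half turns a form
   into an equality. This is isolated as the axiom [strict] of an abstract category with duality, in
   which the form of a selfadjoint object is its identity map and an isometric embedding is a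
   solution of x° x = 1. Existence and uniqueness are argued there, without matrices, for all four
   cases at once. The cases differ only in the arithmetic of T(B): every nonzero symmetric element
   must be congruent to 1 or t; 1 must not be a sum of the terms z° t^-1 z that the allowed
   multiplicity of B^t permits; and, when B^t may occur only once, the sum of two copies of the form
   t must represent 1. *)
From HB Require Import structures.
From mathcomp Require Import all_field perm all_boot all_order all_algebra.
From mathcomp Require Import complex boolp zify ring lra.
From Stdlib Require List Permutation.
Import Permutation.
Require Import Defs.
Import Order.TTheory GRing.Theory Num.Theory.
Set Implicit Arguments.
Unset Strict Implicit.
Unset Printing Implicit Defensive.
Local Open Scope ring_scope.

(** * Nilpotent elements *)

Section Nilpotent.
Variable R : pzRingType.
Implicit Types r s x y z : R.

Definition nilp x := exists n, x ^+ n = 0.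

(** The intended instance is x ↦ f^-1 x° f, the adjoint with respect to a form f. *)
Definition antimorph (sg : R -> R) :=
  [/\ forall x y, sg (x + y) = sg x + sg y, forall x y, sg (x * y) = sg y * sg x & sg 1 = 1].

(** A finite geometric series. Being a polynomial in [r], the inverse commutes with everything that
    commutes with [r]; as the ring is not commutative, this clause is carried along. *)
Lemma nilp_1B r : nilp r ->
  exists y, [/\ y * (1 - r) = 1, (1 - r) * y = 1 & forall z, GRing.comm z r -> GRing.comm z y].
Proof.
case=> n rn0; exists (\sum_(i < n) r ^+ i).
have h : (1 - r) * (\sum_(i < n) r ^+ i) = 1.
  by rewrite -opprB mulNr -subrX1 rn0 sub0r opprK.
have cz z : GRing.comm z r -> GRing.comm z (\sum_(i < n) r ^+ i).
  by move=> zr; apply: commr_sum => i _; apply: commrX.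
split => //; rewrite -(cz (1 - r)) //.
by apply/commr_sym; apply: commrB; [apply: commr1|].
Qed.

Variable h : R.
Hypothesis hh : h + h = 1.

Lemma half_comm z : GRing.comm z h.
Proof.
have e : h * z + h * z = z by rewrite -mulrDl hh mul1r.
have e' : z * h + z * h = z by rewrite -mulrDr hh mulr1.
rewrite /GRing.comm -[in RHS]e' mulrDr -{1}e mulrDl.
by rewrite !mulrA.
Qed.

Lemma double_inj x y : x + x = y + y -> x = y.
Proof.
by move=> e; rewrite -[x]mulr1 -[y]mulr1 -hh !mulrDr -!mulrDl e.
Qed.

(** Completing the square: with u = 1 + h r one has u^2 = 1 + r + (h r)^2, so 1 + r = u^2 (1 - w^2)
    for w = h r u^-1, and the order of nilpotency of w^2 is about half that of r. The last clause
    makes the root selfadjoint with respect to a given form; the clause on commuting elements is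
    what carries the induction. *)
Lemma sqrt_1D n r : r ^+ n = 0 ->
  exists s, [/\ s * s = 1 + r, forall z, GRing.comm z r -> GRing.comm z s &
    forall sg, antimorph sg -> sg r = r -> sg s = s].
Proof.
elim/ltn_ind: n r => n IH r rn0.
have [n1|n1] := leqP n 1.
  have r0 : r = 0 by rewrite -[r]expr1 -(subnKC n1) exprD rn0 mul0r.
  exists 1; split; [by rewrite r0 mulr1 addr0| move=> z _; exact: commr1 | by move=> sg []].
have hr : nilp (- (h * r)).
  exists n; rewrite -mulNr exprMn_comm ?rn0 ?mulr0 //.
  by apply/commr_sym/commrN/half_comm.
have [y [yu uy ycom]] := nilp_1B hr; rewrite opprK in yu uy.
pose u := 1 + h * r.
have cu z : GRing.comm z r -> GRing.comm z u.
  by move=> zr; apply: commrD; [exact: commr1|apply: commrM => //; exact: half_comm].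
have cy z : GRing.comm z r -> GRing.comm z y.
  by move=> zr; apply: ycom; apply: commrN; apply: commrM => //; exact: half_comm.
pose w := h * r * y; pose r' := - (w * w).
have cw z : GRing.comm z r -> GRing.comm z w.
  by move=> zr; apply: commrM; [apply: commrM => //; exact: half_comm|exact: cy].
have ru' : r' ^+ uphalf n = 0.
  have c1 : GRing.comm h (r * y) by apply/commr_sym/half_comm.
  have c2 : GRing.comm r y by apply: cy.
  rewrite /r' exprNn -expr2 -exprM /w -mulrA exprMn_comm // (exprMn_comm _ c2).
  have -> : r ^+ (2 * uphalf n) = 0.
    have le : (n <= 2 * uphalf n)%N by rewrite mul2n -[X in (X <= _)%N]odd_double_half uphalf_half doubleD leq_add2r; case: odd.
    by rewrite -(subnKC le) exprD rn0 mul0r.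
  by rewrite mul0r !mulr0.
have ltn : (uphalf n < n)%N by rewrite uphalf_half; have := odd_double_half n; rewrite -addnn; case: n {IH rn0 hr ru'} n1 => [|[|n]] // _; case: odd; move: (n.+2./2) => k /=; lia.
have [s' [s's' cs' sgs']] := IH _ ltn _ ru'.
exists (u * s'); split.
- have us : GRing.comm s' u.
    by apply/commr_sym/cs'/commrN/commrM; apply/cw/commr_sym/cu.
  have uw : u * w = h * r.
    have c : GRing.comm u (h * r) by apply: commrM; [exact: half_comm|apply/commr_sym/cu].
    by rewrite /w mulrA c -mulrA uy mulr1.
  have cuw : GRing.comm w u by apply: cu; apply/commr_sym/cw.
  rewrite mulrA -[u * s' * u]mulrA us mulrA -mulrA s's' mulrDr mulr1 mulrN.
  have -> : u * u * (w * w) = h * r * (h * r).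
    by rewrite -[u * u * _]mulrA (mulrA u w) -cuw -mulrA mulrA uw.
  suff -> : u * u = 1 + r + h * r * (h * r) by rewrite addrK.
  rewrite {1}/u mulrDl mul1r /u mulrDr mulr1 !addrA.
  by rewrite -(addrA 1 (h * r)) -mulrDl hh mul1r.
- move=> z zr; apply: commrM; first exact: cu.
  by apply: cs'; apply/commrN/commrM; apply: cw.
move=> sg [sD sM s1] sr.
have sh : sg h = h by apply: double_inj; rewrite -sD hh s1.
have shr : sg (h * r) = h * r by rewrite sM sh sr half_comm.
have su : sg u = u by rewrite sD s1 shr.
have sy : sg y = y by rewrite -[LHS]mulr1 -[X in _ * X]uy -/u mulrA -[X in _ * X * _]su -sM uy s1 mul1r.
have sw : sg w = w by rewrite /w sM sy shr; apply/commr_sym/cy/commr_sym/commrM => //; exact: half_comm.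
have sN x : sg (- x) = - sg x.
  have s0 : sg 0 = 0 by apply: (addrI (sg 0)); rewrite -sD !addr0.
  by apply: (addrI (sg x)); rewrite -sD !subrr.
rewrite sM su (sgs' sg) //; last by rewrite /r' sN sM sw.
by apply/commr_sym/cs'/commrN/commrM; apply/cw/commr_sym/cu.
Qed.
End Nilpotent.

(** * Additive categories with duality *)

(* An additive category with duality in which A' being dual to A is a relation,
   so that strict selfadjointness A = A° is [dual A A]; [rlt] stands for the
   comparison of dimensions. *)
Record hcat := HCat {
  rep : Type;
  Hom : rep -> rep -> zmodType;
  cmp : forall A B D, Hom B D -> Hom A B -> Hom A D;
  id_ : forall A, Hom A A;
  cmpA : forall A B D E (f : Hom D E) (g : Hom B D) (h : Hom A B),
    cmp f (cmp g h) = cmp (cmp f g) h;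
  cmp1m : forall A B (f : Hom A B), cmp (id_ B) f = f;
  cmpm1 : forall A B (f : Hom A B), cmp f (id_ A) = f;
  cmpDl : forall A B D (f g : Hom B D) (h : Hom A B), cmp (f + g) h = cmp f h + cmp g h;
  cmpDr : forall A B D (f : Hom B D) (g h : Hom A B), cmp f (g + h) = cmp f g + cmp f h;
  half : forall A, exists h, h + h = id_ A;
  rlt : rep -> rep -> Prop;
  rlt_wf : well_founded rlt;
  rlt_trans : forall A B D, rlt A B -> rlt B D -> rlt A D;
  rlt_iso : forall A B D (f : Hom A B) (g : Hom B A),
    cmp g f = id_ A -> cmp f g = id_ B -> rlt B D -> rlt A D;
  factor : forall A (f : Hom A A),
    (exists g, cmp g f = id_ A /\ cmp f g = id_ A) \/
    (exists A' (l : Hom A' A) (r : Hom A A'), rlt A' A /\ f = cmp l r);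
  dual : rep -> rep -> Prop;
  dualC : forall A A', dual A A' -> dual A' A;
  dual_ex : forall A, exists A', dual A A';
  ad : forall A A' B B', dual A A' -> dual B B' -> Hom A B -> Hom B' A';
  adD : forall A A' B B' (a : dual A A') (b : dual B B') (f g : Hom A B),
    ad a b (f + g) = ad a b f + ad a b g;
  adM : forall A A' B B' D D' (a : dual A A') (b : dual B B') (d : dual D D')
    (f : Hom B D) (g : Hom A B), ad a d (cmp f g) = cmp (ad a b g) (ad b d f);
  ad1 : forall A A' (a : dual A A'), ad a a (id_ A) = id_ A';
  adK : forall A A' B B' (a : dual A A') (b : dual B B') (a' : dual A' A) (b' : dual B' B)
    (f : Hom A B), ad b' a' (ad a b f) = f;
  strict : forall N N' (d : dual N N') (h : Hom N N') (k : Hom N' N),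
    cmp k h = id_ N -> cmp h k = id_ N' -> ad d (dualC d) h = h ->
    exists S (s : dual S S) (g : Hom S N) (g' : Hom N S),
      [/\ cmp g' g = id_ S, cmp g g' = id_ N & cmp (cmp (ad s d g) h) g = id_ S] }.

Arguments Hom {_} A B.
Arguments cmp {_ A B D} f g.
Arguments id_ {_} A.
Arguments rlt {_} A B.
Arguments dual {_} A B.
Arguments ad {_ A A' B B'} a b f.

Notation "f ∘ g" := (cmp f g) (at level 40, left associativity) : ring_scope.

(** * Fitting's lemma and the splitting of idempotents *)

Section Basic.
Variable H : hcat.
Implicit Types A B D M N : rep H.

Lemma cmp0m A B D (g : Hom A B) : (0 : Hom B D) ∘ g = 0.
Proof. by apply: (addrI (0 ∘ g)); rewrite -cmpDl !addr0. Qed.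
Lemma cmpm0 A B D (f : Hom B D) : f ∘ (0 : Hom A B) = 0.
Proof. by apply: (addrI (f ∘ 0)); rewrite -cmpDr !addr0. Qed.
Lemma cmpNl A B D (f : Hom B D) (g : Hom A B) : (- f) ∘ g = - (f ∘ g).
Proof. by apply: (addrI (f ∘ g)); rewrite -cmpDl !subrr cmp0m. Qed.
Lemma cmpNr A B D (f : Hom B D) (g : Hom A B) : f ∘ (- g) = - (f ∘ g).
Proof. by apply: (addrI (f ∘ g)); rewrite -cmpDr !subrr cmpm0. Qed.
Lemma cmpBl A B D (f f' : Hom B D) (g : Hom A B) : (f - f') ∘ g = f ∘ g - f' ∘ g.
Proof. by rewrite cmpDl cmpNl. Qed.
Lemma cmpBr A B D (f : Hom B D) (g g' : Hom A B) : f ∘ (g - g') = f ∘ g - f ∘ g'.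
Proof. by rewrite cmpDr cmpNr. Qed.
Lemma cmpK A B D E (f : Hom B D) (g : Hom A B) k : f ∘ g = k ->
  forall h : Hom D E, h ∘ f ∘ g = h ∘ k.
Proof. by move=> <- h; rewrite cmpA. Qed.

Lemma ad0 A A' B B' (a : dual A A') (b : dual B B') : ad a b 0 = 0.
Proof. by apply: (addrI (ad a b 0)); rewrite -adD !addr0. Qed.
Lemma adN A A' B B' (a : dual A A') (b : dual B B') f : ad a b (- f) = - ad a b f.
Proof. by apply: (addrI (ad a b f)); rewrite -adD !subrr ad0. Qed.
Lemma adB A A' B B' (a : dual A A') (b : dual B B') f g :
  ad a b (f - g) = ad a b f - ad a b g.
Proof. by rewrite adD adN. Qed.

Definition isiso A B (f : Hom A B) := exists g, g ∘ f = id_ A /\ f ∘ g = id_ B.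
Definition isoc A B := exists f : Hom A B, isiso f.

Lemma isoc_refl A : isoc A A.
Proof. by exists (id_ A), (id_ A); rewrite cmp1m. Qed.
Lemma isoc_sym A B : isoc A B -> isoc B A.
Proof. by case=> f [g [gf fg]]; exists g, f. Qed.
Lemma isoc_trans A B D : isoc A B -> isoc B D -> isoc A D.
Proof.
case=> f [f' [f'f ff']] [g [g' [g'g gg']]]; exists (g ∘ f), (f' ∘ g').
by rewrite !cmpA (cmpK g'g) (cmpK ff') !cmpm1.
Qed.

Definition indec A := id_ A <> 0 /\ forall e : Hom A A, e ∘ e = e -> e = 0 \/ e = id_ A.

Definition End A : Type := Hom A A.
HB.instance Definition _ A := GRing.Zmodule.copy (End A) (Hom A A).
HB.instance Definition _ A := GRing.Zmodule_isPzRing.Build (End A)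
  (fun f g h => cmpA f g h) (@cmp1m H A A) (@cmpm1 H A A)
  (fun f g h => cmpDl f g h) (fun f g h => cmpDr f g h).

Definition toEnd A (f : Hom A A) : End A := f.

Lemma toEndM A (f g : Hom A A) : toEnd (f ∘ g) = toEnd f * toEnd g. Proof. by []. Qed.
Lemma toEndD A (f g : Hom A A) : toEnd (f + g) = toEnd f + toEnd g. Proof. by []. Qed.

Lemma expLR A B (l : Hom B A) (r : Hom A B) k :
  toEnd (l ∘ r) ^+ k.+1 = toEnd (l ∘ (toEnd (r ∘ l) ^+ k) ∘ r).
Proof.
elim: k => [|k IH]; first by rewrite expr1 expr0 cmpm1.
by rewrite exprS IH [in RHS]exprS -toEndM -[toEnd (r ∘ l) * _]/(_ ∘ _) !cmpA.
Qed.

(* If f = l r factors through a smaller object, a solution g' for r l gives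
   the solution l g'^2 r for f. *)
Lemma fitting A (f : End A) : exists n (g : End A), f * g = g * f /\ f ^+ n = f ^+ n.+1 * g.
Proof.
move: f; elim/(well_founded_ind (@rlt_wf H)): A => A IH f.
case: (factor f) => [[g [gf fg]]|[B [l [r [ltB ->]]]]].
  by exists 0%N, g; rewrite expr0 expr1; split; [exact: etrans fg (esym gf)|exact: esym fg].
have [n [g [cg fn]]] := IH B ltB (toEnd (r ∘ l)).
exists n.+1, (toEnd (l ∘ (g ∘ g) ∘ r)).
set x := toEnd (r ∘ l) in cg fn.
have c2 : x * (g * g) = g * g * x by rewrite mulrA cg -mulrA cg mulrA.
split.
  transitivity (toEnd (l ∘ (x * (g * g)) ∘ r)); last rewrite c2.
    by change ((l ∘ r) ∘ (l ∘ (g ∘ g) ∘ r) = l ∘ ((r ∘ l) ∘ (g ∘ g)) ∘ r); rewrite !cmpA.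
  by change (l ∘ ((g ∘ g) ∘ (r ∘ l)) ∘ r = (l ∘ (g ∘ g) ∘ r) ∘ (l ∘ r)); rewrite !cmpA.
change (toEnd (l ∘ r) ^+ n.+1 = toEnd (l ∘ r) ^+ n.+2 * toEnd (l ∘ (g ∘ g) ∘ r)).
rewrite (expLR l r n) (expLR l r n.+1) -/x.
transitivity (toEnd (l ∘ (x ^+ n.+1 * (x * (g * g))) ∘ r)).
  congr (toEnd (l ∘ _ ∘ r)).
  by rewrite c2 !mulrA -fn -mulrA -cg mulrA -exprSr -fn.
change (l ∘ (x ^+ n.+1 ∘ ((r ∘ l) ∘ (g ∘ g))) ∘ r
  = (l ∘ (x ^+ n.+1) ∘ r) ∘ (l ∘ (g ∘ g) ∘ r)); by rewrite !cmpA.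
Qed.

(** If e = l r through a smaller B, then r l need not be idempotent, but (r l)^3 = (r l)^2 makes (r
    l)^2 idempotent on B. Splitting it there and composing with l and r splits e; if it is the
    identity, B itself is the image of e. *)
Lemma idem_split A (e : Hom A A) : e ∘ e = e ->
  e = id_ A \/ exists N (i : Hom N A) (p : Hom A N), [/\ rlt N A, p ∘ i = id_ N & i ∘ p = e].
Proof.
move: e; elim/(well_founded_ind (@rlt_wf H)): A => A IH e ee.
case: (factor e) => [[g [ge eg]]|[B [l [r [ltB def]]]]].
  by left; rewrite -[LHS]cmpm1 -eg cmpA ee.
right; pose e' := r ∘ l ∘ r ∘ l.
have ee4 : l ∘ r ∘ l ∘ r = l ∘ r by move: ee; rewrite def cmpA.
have e3 : r ∘ l ∘ r ∘ l ∘ r ∘ l = r ∘ l ∘ r ∘ l.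
  by rewrite -!cmpA; congr (r ∘ _); rewrite !cmpA ee4.
have e'e' : e' ∘ e' = e' by rewrite /e' !cmpA e3 e3.
have e'3 : e' ∘ r ∘ l = e' by rewrite /e' e3.
have l4 : l ∘ e' ∘ r = e by rewrite /e' !cmpA ee4 ee4 def.
have [e1|[N [i [p [ltN pi ip]]]]] := IH B ltB e' e'e'.
  exists B, l, r; split=> //.
  by rewrite -[LHS]cmp1m -e1 !cmpA e'3.
exists N, (l ∘ i), (p ∘ r); split; first exact: rlt_trans ltN ltB.
  have pE : p = p ∘ e' by rewrite -ip cmpA pi cmp1m.
  have -> : p ∘ r ∘ (l ∘ i) = p ∘ (r ∘ l) ∘ i by rewrite !cmpA.
  by rewrite {1}pE -(cmpA p e') (cmpA e' r) e'3 -pE pi.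
by rewrite cmpA (cmpK ip) l4.
Qed.
End Basic.

(** * Local endomorphism rings of indecomposable objects *)

Section Local.
Variable H : hcat.
Implicit Types A B D M N : rep H.

Lemma isiso_id A : isiso (id_ A).
Proof. by exists (id_ A); rewrite cmp1m. Qed.
Lemma isiso_comp A B D (f : Hom B D) (g : Hom A B) : isiso f -> isiso g -> isiso (f ∘ g).
Proof.
case=> f' [f'f ff'] [g' [g'g gg']]; exists (g' ∘ f').
by rewrite !cmpA (cmpK f'f) (cmpK gg') !cmpm1.
Qed.
Lemma isisoN A B (f : Hom A B) : isiso f -> isiso (- f).
Proof. by case=> g [gf fg]; exists (- g); rewrite !cmpNl !cmpNr !opprK. Qed.

Lemma nilp_linv A (f g : Hom A A) : g ∘ f = id_ A -> nilp (toEnd f) -> id_ A = 0.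
Proof.
move=> gf [n]; elim: n => [|n IH]; first by rewrite expr0.
rewrite exprS => fn; apply: IH; rewrite -[LHS]cmp1m -gf -cmpA.
by rewrite -[f ∘ _]/(toEnd f * _) fn; exact: cmpm0.
Qed.

Variables (M : rep H) (iM : indec M).

(** From f^n = f^(n+1) g with g commuting with f one gets f^n = f^(2n) g^n, so e = f^n g^n is
    idempotent and f^n e = f^n. Indecomposability leaves e = 0, where f^n = 0, or e = 1, where f is
    invertible. *)
Lemma indec_nilp_or_iso (f : Hom M M) : nilp (toEnd f) \/ isiso f.
Proof.
have [n [g [cg fn]]] := fitting (toEnd f); set F := toEnd f in cg fn *.
have cFg i j : F ^+ i * g ^+ j = g ^+ j * F ^+ i by apply: commrX; apply/commr_sym/commrX.
have fnS k : F ^+ (n + k) = F ^+ (n + k.+1) * g.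
  by rewrite addnC exprD {1}fn mulrA -exprD addnC addSnnS.
have fnk k : F ^+ n = F ^+ (n + k) * g ^+ k.
  elim: k => [|k IH]; first by rewrite addn0 expr0 mulr1.
  by rewrite exprS mulrA -fnS.
case: (iM) => id0 idem; pose e := F ^+ n * g ^+ n.
have ee : e * e = e.
  by rewrite /e mulrA -(mulrA (F ^+ n)) -cFg mulrA -exprD -fnk.
have fe : F ^+ n * e = F ^+ n by rewrite /e mulrA -exprD -fnk.
case: (idem _ ee) => e1.
  by left; exists n; rewrite -fe -[e]/(e : Hom M M) e1; exact: mulr0.
right; have {}e1 : F ^+ n * g ^+ n = 1 by exact: e1.
(* For n = 0 the equation e = 1 carries no information, and the inverse is read off from 1 = f g. *)
case: n fn fnS fnk e ee fe e1 => [|n] fn _ _ _ _ _ e1.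
  exists g; rewrite expr0 expr1 in fn.
  by split; [exact: etrans (esym cg) (esym fn)|exact: esym fn].
have c1 : F * (F ^+ n * g ^+ n.+1) = 1 by rewrite mulrA -exprS.
exists (F ^+ n * g ^+ n.+1); split; last exact: c1.
change (F ^+ n * g ^+ n.+1 * F = 1); rewrite -[RHS]e1.
by rewrite -mulrA -{2}[F]expr1 -(cFg 1%N) expr1 !mulrA -exprSr.
Qed.

Lemma indec_nz : id_ M <> 0. Proof. by case: iM. Qed.

Lemma linv_iso (f g : Hom M M) : g ∘ f = id_ M -> isiso f.
Proof.
by move=> gf; case: (indec_nilp_or_iso f) => // /(nilp_linv gf)/indec_nz.
Qed.

Lemma rinv_iso (f g : Hom M M) : g ∘ f = id_ M -> isiso g.
Proof.
move=> gf; have [f' [f'f ff']] := linv_iso gf; exists f; split=> //.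
by rewrite -[f ∘ g]cmpm1 -ff' !cmpA (cmpK gf) cmpm1.
Qed.

Lemma nonunit_nilp (f : Hom M M) : ~ isiso f -> nilp (toEnd f).
Proof. by case: (indec_nilp_or_iso f). Qed.

Lemma isiso_compl (f g : Hom M M) : isiso (f ∘ g) -> isiso f.
Proof.
case=> h [h1 h2]; apply: (@rinv_iso (g ∘ h)).
by rewrite cmpA.
Qed.
Lemma isiso_compr (f g : Hom M M) : isiso (f ∘ g) -> isiso g.
Proof.
case=> h [h1 h2]; apply: (@linv_iso _ (h ∘ f)).
by rewrite -cmpA.
Qed.

Lemma nonunit_1B (f : Hom M M) : ~ isiso f -> isiso (id_ M - f).
Proof.
move=> /nonunit_nilp /nilp_1B [y [y1 y2 _]]; exists y; split; [exact: y1|exact: y2].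
Qed.

Lemma isiso_add (f g : Hom M M) : isiso (f + g) -> isiso f \/ isiso g.
Proof.
case=> h [h1 h2]; have [?|nf] := pselect (isiso f); [by left|right].
have : ~ isiso (h ∘ f) by move/isiso_compr.
move/nonunit_1B; rewrite -h1 cmpDr addrAC subrr add0r; exact: isiso_compr.
Qed.

Lemma nonunit_add (f g : Hom M M) : ~ isiso f -> ~ isiso g -> ~ isiso (f + g).
Proof. by move=> nf ng /isiso_add []. Qed.
Lemma nonunitN (f : Hom M M) : ~ isiso f -> ~ isiso (- f).
Proof. by move=> nf /isisoN; rewrite opprK. Qed.
Lemma nonunit0 : ~ isiso (0 : Hom M M).
Proof. by case=> g []; rewrite cmpm0 => e; case: indec_nz. Qed.

(** With h inverse to g f, the map f h g is idempotent on N. It is not 0, since M is not, hence it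
    is 1 and f has the inverse h g. *)
Lemma isiso_factor N (iN : indec N) (f : Hom M N) (g : Hom N M) : isiso (g ∘ f) -> isiso f.
Proof.
case=> h [h1 h2]; pose e := f ∘ h ∘ g.
have ee : e ∘ e = e by rewrite /e !cmpA -(cmpA (f ∘ h)) (cmpK h1) cmpm1.
have [e0|e1] := (iN).2 _ ee.
  have : g ∘ e ∘ f ∘ h = id_ M by rewrite /e !cmpA h2 cmp1m.
  by rewrite e0 cmpm0 !cmp0m => /esym/indec_nz.
exists (h ∘ g); split; first by rewrite -cmpA.
by rewrite cmpA.
Qed.

End Local.

(** * Selfadjoint objects and orthogonal complements *)

Section Summands.
Variable H : hcat.
Implicit Types A B D M N : rep H.

Lemma indec_summand A : id_ A <> 0 ->
  exists M (i : Hom M A) (p : Hom A M), indec M /\ p ∘ i = id_ M.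
Proof.
elim/(well_founded_ind (@rlt_wf H)): A => A IH A0.
have [iA|niA] := pselect (indec A).
  by exists A, (id_ A), (id_ A); rewrite cmp1m.
have [e [ee e0 e1]] : exists e : Hom A A, [/\ e ∘ e = e, e <> 0 & e <> id_ A].
  apply: contrapT => ne; apply: niA; split=> // e ee.
  have [?|e0] := pselect (e = 0); [by left|right].
  by apply: contrapT => e1; apply: ne; exists e.
have [//|[N [i [p [ltN pi ip]]]]] := idem_split ee.
have N0 : id_ N <> 0 by move=> N0; apply: e0; rewrite -ip -[p]cmp1m N0 cmp0m cmpm0.
have [M [j [q [iM qj]]]] := IH _ ltN N0.
by exists M, (i ∘ j), (q ∘ p); rewrite !cmpA (cmpK pi) cmpm1.
Qed.

Lemma indec_iso A B : isoc A B -> indec A -> indec B.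
Proof.
case=> f [g [gf fg]] [A0 idem]; split.
  by move=> B0; apply: A0; rewrite -gf -[g]cmpm1 B0 cmpm0 cmp0m.
move=> e ee; have : g ∘ e ∘ f ∘ (g ∘ e ∘ f) = g ∘ e ∘ f.
  by rewrite !cmpA (cmpK fg) cmpm1 (cmpK ee).
have eE : e = f ∘ (g ∘ e ∘ f) ∘ g by rewrite !cmpA fg cmp1m (cmpK fg) cmpm1.
move/idem => [h|h]; [left|right]; rewrite eE h ?cmpm0 ?cmp0m //.
by rewrite cmpm1.
Qed.

Lemma indec_dual A A' : dual A A' -> indec A -> indec A'.
Proof.
move=> d [A0 idem]; have d' := dualC d; split.
  by move=> A0'; apply: A0; rewrite -(ad1 d') A0' ad0.
move=> e ee; have := idem (ad d' d' e); rewrite -(adM d' d' d') ee => /(_ erefl) [h|h].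
  by left; rewrite -(adK d' d' d d e) h ad0.
by right; rewrite -(adK d' d' d d e) h ad1.
Qed.

(** The object equals its adjoint, so its form is the identity map, and a morphism x into S pulls
    this form back to x^† ∘ x. *)
Record sob := Sob { sr :> rep H; sd : dual sr sr }.
Implicit Types S T U : sob.

Definition sadj S T (x : Hom S T) : Hom T S := ad (sd S) (sd T) x.
Local Notation "x ^†" := (sadj x) (at level 2, format "x ^†").

Lemma adjM S T U (f : Hom T U) (g : Hom S T) : (f ∘ g)^† = g^† ∘ f^†.
Proof. exact: adM. Qed.
Lemma adjD S T (f g : Hom S T) : (f + g)^† = f^† + g^†. Proof. exact: adD. Qed.
Lemma adjN S T (f : Hom S T) : (- f)^† = - f^†. Proof. exact: adN. Qed.
Lemma adjB S T (f g : Hom S T) : (f - g)^† = f^† - g^†. Proof. exact: adB. Qed.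
Lemma adj0 S T : (0 : Hom S T)^† = 0. Proof. exact: ad0. Qed.
Lemma adjK S T (f : Hom S T) : f^†^† = f. Proof. exact: adK. Qed.
Lemma adj1 S : (id_ S)^† = id_ S. Proof. exact: ad1. Qed.

Lemma isiso_adj S T (f : Hom S T) : isiso f -> isiso f^†.
Proof. by case=> g [gf fg]; exists g^†; rewrite -!adjM gf fg !adj1. Qed.

Definition isom S T (x : Hom S T) := x^† ∘ x = id_ S.
Definition congr_ S T := exists f : Hom S T, f^† ∘ f = id_ S /\ f ∘ f^† = id_ T.
Definition isSum S T U := exists (i : Hom T S) (j : Hom U S),
  [/\ isom i, isom j, i^† ∘ j = 0 & i ∘ i^† + j ∘ j^† = id_ S].

Lemma congr_refl S : congr_ S S.
Proof. by exists (id_ S); rewrite adj1 cmp1m. Qed.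
Lemma congr_sym S T : congr_ S T -> congr_ T S.
Proof. by case=> f [a b]; exists f^†; rewrite adjK. Qed.

Lemma isom_comp S T U (x : Hom T U) (y : Hom S T) : isom x -> isom y -> isom (x ∘ y).
Proof. by rewrite /isom => hx hy; rewrite adjM !cmpA (cmpK hx) cmpm1. Qed.

Lemma orthC S T U (i : Hom T S) (j : Hom U S) : i^† ∘ j = 0 -> j^† ∘ i = 0.
Proof. by move=> h; rewrite -(adjK i) -adjM h adj0. Qed.

(** The idempotent 1 - x x^† splits over an object N that carries the form i° i but need not equal
    its dual; [strict] replaces it by a selfadjoint U. The size clause drives the recursion by which
    summands are split off. *)
Lemma complement S T (x : Hom T S) : isom x ->
  exists U (j : Hom U S), [/\ isom j, x^† ∘ j = 0, x ∘ x^† + j ∘ j^† = id_ S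
    & id_ T <> 0 -> rlt U S].
Proof.
move=> hx; rewrite /isom in hx.
pose e := id_ S - x ∘ x^†.
have xe : x^† ∘ e = 0 by rewrite /e cmpBr cmpm1 cmpA hx cmp1m subrr.
have ee : e ∘ e = e by rewrite {1}/e cmpBl cmp1m -cmpA xe cmpm0 subr0.
have ae : e^† = e by rewrite /e adjB adj1 adjM adjK.
have [e1|[N [i [p [ltN pi ip]]]]] := idem_split ee.
  have x0 : x^† = 0 by rewrite -[LHS]cmpm1 -e1 xe.
  exists S, (id_ S); rewrite /isom x0 cmpm0 cmp0m add0r adj1 cmp1m; split=> //.
  by case; rewrite -hx x0 cmp0m.
have [N' d] := dual_ex N; set d' := dualC d; set s := sd S.
pose ai := ad d s i; pose ap := ad s d p.
have pe : p ∘ e = p by rewrite -ip cmpA pi cmp1m.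
have ei : e ∘ i = i by rewrite -ip -cmpA pi cmpm1.
have apai : ap ∘ ai = e by rewrite /ap /ai -adM ip.
have kh : p ∘ ap ∘ (ai ∘ i) = id_ N by rewrite cmpA (cmpK apai) pe pi.
have hk : ai ∘ i ∘ (p ∘ ap) = id_ N'.
  by rewrite cmpA (cmpK ip) -[X in _ ∘ X ∘ _]ae /ai /ap /sadj -!adM ei pi ad1.
have hs : ad d d' (ai ∘ i) = ai ∘ i by rewrite (adM d s) /ai adK.
have [U [g [g' [g'g gg' hg]]]] : exists (U : sob) (g : Hom U N) (g' : Hom N U),
    [/\ g' ∘ g = id_ U, g ∘ g' = id_ N & ad (sd U) d g ∘ (ai ∘ i) ∘ g = id_ U].
  by have [U [su [g [g' h]]]] := strict kh hk hs; exists (Sob su), g, g'.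
pose j : Hom U S := i ∘ g.
have aj : j^† = ad (sd U) d g ∘ ai by rewrite /sadj /j (adM _ d).
have jj : j ∘ j^† = e.
  rewrite aj /j !cmpA; have -> : i ∘ g ∘ ad (sd U) d g = i ∘ p ∘ ap.
    rewrite -!cmpA; congr (i ∘ _); rewrite -[g ∘ ad (sd U) d g]cmpm1 -hk !cmpA.
    rewrite -(cmpm1 (g ∘ ad (sd U) d g ∘ ai ∘ i)) -gg' !cmpA.
    have -> : g ∘ ad (sd U) d g ∘ ai ∘ i ∘ g = g ∘ (ad (sd U) d g ∘ (ai ∘ i) ∘ g) by rewrite !cmpA.
    by rewrite hg cmpm1 gg' cmp1m.
  by rewrite ip -cmpA apai ee.
have jI : j^† ∘ j = id_ U by rewrite aj /j -[RHS]hg !cmpA.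
clearbody j; exists U, j; split=> //.
- by rewrite -[RHS](cmp0m _ j) -xe -jj !cmpA -(cmpA _ _ j) jI cmpm1.
- by rewrite jj /e addrC subrK.
- by move=> _; apply: rlt_iso ltN; [exact: g'g|exact: gg'].
Qed.

End Summands.
Notation "x ^†" := (sadj x) (at level 2, format "x ^†").

(** * Lifting, embedding and cancelling forms *)

Section Forms.
Variable H : hcat.
Implicit Types (A B D M N : rep H) (S T U Q : sob H).

(** The root s of f^-1 f' is fixed by x ↦ f^-1 x^† f, because f^-1 f' is. This says s^† f = f s,
    whence s^† f s = f s^2 = f'. *)
Lemma sqrt_form S (f fi f' : Hom S S) : f^† = f -> f'^† = f' ->
  fi ∘ f = id_ S -> f ∘ fi = id_ S -> nilp (toEnd (fi ∘ f' - id_ S)) ->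
  exists s : Hom S S, isiso s /\ s^† ∘ f ∘ s = f'.
Proof.
move=> af af' fif ffi nr; have [n rn] := nr; have [h hh] := half (sr S).
have [s [ss _ sgs]] := @sqrt_1D (End S) h hh n _ rn.
have s2 : s ∘ s = fi ∘ f'.
  by apply: etrans ss _; rewrite -[RHS](subrK (id_ S)) addrC.
have afi : fi^† = fi.
  by rewrite -[LHS]cmp1m -fif -cmpA -{1}af -adjM fif adj1 cmpm1.
have sg : fi ∘ s^† ∘ f = s.
  apply: (sgs (fun x => fi ∘ sadj (x : Hom S S) ∘ f)).
    split=> [x y|x y|]; first by rewrite -[x + y]/((x : Hom S S) + y) adjD cmpDr cmpDl.
      change (fi ∘ (x ∘ y)^† ∘ f = (fi ∘ y^† ∘ f) ∘ (fi ∘ x^† ∘ f)).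
      by rewrite adjM !cmpA (cmpK ffi) cmpm1.
    change (fi ∘ (id_ S)^† ∘ f = id_ S); by rewrite adj1 cmpm1.
  change (fi ∘ (fi ∘ f' - id_ S)^† ∘ f = fi ∘ f' - id_ S).
  by rewrite adjB adj1 adjM af' afi cmpBr cmpBl cmpm1 fif !cmpA (cmpK fif) cmpm1.
have sf : s^† ∘ f = f ∘ s by rewrite -[in RHS]sg !cmpA ffi cmp1m.
exists s; split; last by rewrite sf -cmpA s2 cmpA ffi cmp1m.
have [y [y1 y2 _]] : exists y : End S, [/\ y * (toEnd (fi ∘ f')) = 1, toEnd (fi ∘ f') * y = 1 & True].
  have nr' : nilp (- toEnd (fi ∘ f' - id_ S)) by exists n; rewrite exprNn rn mulr0.
  have [y [y1 y2 _]] := nilp_1B nr'.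
  have e : 1 - - toEnd (fi ∘ f' - id_ S) = toEnd (fi ∘ f').
    by rewrite opprK toEndD addrC; exact: subrK.
  by exists y; rewrite -e.
exists (s ∘ y).
have ssy : s ∘ (s ∘ y) = id_ S by rewrite cmpA s2.
have yss : y ∘ s ∘ s = id_ S by rewrite -cmpA s2.
have sy : s ∘ y = y ∘ s by rewrite -[LHS]cmp1m -yss -!cmpA ssy cmpm1.
by split=> //; rewrite sy yss.
Qed.

(** The hyperbolic object on M: [i1] and [i2] embed M and its dual as totally isotropic summands,
    which the form pairs with each other. *)
Definition isPlus M Q := exists M' (d : dual M M') (i1 : Hom M Q) (i2 : Hom M' Q),
  [/\ ad d (sd Q) i1 ∘ i1 = 0, ad (dualC d) (sd Q) i2 ∘ i2 = 0,
      ad (dualC d) (sd Q) i2 ∘ i1 = id_ M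
    & i1 ∘ ad (dualC d) (sd Q) i2 + i2 ∘ ad d (sd Q) i1 = id_ Q].

(** A symmetric isomorphism is a form, and [strict] would make M isomorphic to a selfadjoint
    object. *)
Lemma no_form M N' (d : dual M N') (iM : indec M) (nM : forall S, ~ isoc M S) (n : Hom M N') :
  ad d (dualC d) n = n -> ~ isiso n.
Proof.
move=> an [k [kn nk]]; have [S0 [s [g [g' [g'g gg' _]]]]] := strict kn nk an.
by apply: (nM (Sob s)); exists g', g.
Qed.

(** The defect F^† F - 1 is made of n = x° x and m = p p°. As M carries no form, n is not
    invertible, so m n is a nonunit of a local ring, hence nilpotent. The square of the defect is
    block diagonal with blocks m n and n m. *)
Lemma plus_embed M (iM : indec M) (nM : forall S, ~ isoc M S) S (x : Hom M S) (p : Hom S M) Q :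
  p ∘ x = id_ M -> isPlus M Q -> exists y : Hom Q S, isom y.
Proof.
move=> px [M' [d [i1 [i2 [e11 e22 e21 e1]]]]]; set d' := dualC d in e22 e21 e1.
set a1 := ad d (sd Q) i1 in e11 e1; set a2 := ad d' (sd Q) i2 in e22 e21 e1.
have e12 : a1 ∘ i2 = id_ M'.
  have <- : ad d d (id_ M) = id_ M' by exact: ad1.
  by rewrite -e21 (adM d (sd Q) d) adK.
pose ax := ad d (sd S) x; pose ap := ad (sd S) d p.
have xp : ax ∘ ap = id_ M' by rewrite /ax /ap -(adM d (sd S) d) px ad1.
pose n := ax ∘ x; pose m := p ∘ ap.
have an : ad d d' n = n by rewrite /n (adM d (sd S) d') adK.
have am : ad d' d m = m by rewrite /m (adM d' (sd S) d) adK.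
have nmn : ~ isiso (m ∘ n).
  move=> i; have : isiso n by apply: (isiso_factor iM (indec_dual d iM) i).
  exact: no_form an.
pose F := x ∘ a2 + ap ∘ a1.
have aF : F^† = i2 ∘ ax + i1 ∘ p.
  by rewrite /F adjD /sadj (adM _ d) (adM _ d') /a2 /a1 !adK.
have FF : F^† ∘ F - id_ Q = i2 ∘ n ∘ a2 + i1 ∘ m ∘ a1.
  rewrite -e1 aF /F !cmpDl !cmpDr !cmpA (cmpK xp) (cmpK px) !cmpm1.
  by rewrite [X in _ + X - _]addrC addrACA [X in _ + X - _]addrC addrK.
have [k mnk] := nonunit_nilp iM nmn.
have nr : nilp (toEnd (F^† ∘ F - id_ Q)).
  rewrite FF; set r := _ + _.
  have rr : r ∘ r = i2 ∘ (n ∘ m) ∘ a1 + i1 ∘ (m ∘ n) ∘ a2.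
    rewrite /r !cmpDl !cmpDr !cmpA (cmpK e22) (cmpK e21) (cmpK e11) (cmpK e12).
    by rewrite !cmpm0 !cmp0m !cmpm1 add0r addr0 addrC.
  have rk j : toEnd (r ∘ r) ^+ j.+1 = i2 ∘ (toEnd (n ∘ m) ^+ j.+1) ∘ a1 + i1 ∘ (toEnd (m ∘ n) ^+ j.+1) ∘ a2.
    elim: j => [|j IH]; first by rewrite !expr1 /toEnd rr.
    rewrite exprS IH [toEnd (n ∘ m) ^+ j.+2]exprS [toEnd (m ∘ n) ^+ j.+2]exprS rr.
    set u := toEnd (n ∘ m) ^+ _; set v := toEnd (m ∘ n) ^+ _.
    change ((i2 ∘ (n ∘ m) ∘ a1 + i1 ∘ (m ∘ n) ∘ a2) ∘ (i2 ∘ u ∘ a1 + i1 ∘ v ∘ a2) =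
      i2 ∘ (n ∘ m ∘ u) ∘ a1 + i1 ∘ (m ∘ n ∘ v) ∘ a2).
    rewrite !cmpDl !cmpDr !cmpA (cmpK e22) (cmpK e21) (cmpK e11) (cmpK e12).
    by rewrite !cmpm0 !cmp0m !cmpm1 add0r addr0.
  (* The factor 2 passes to the square, with blocks m n and n m. The power k kills m n, and (n
     m)^(k+1) = n (m n)^k m requires one more. *)
  exists (2 * k.+1)%N; rewrite exprM expr2.
  have -> : toEnd r * toEnd r = toEnd (r ∘ r) by [].
  rewrite rk; have -> : toEnd (m ∘ n) ^+ k.+1 = 0 by rewrite exprS mnk mulr0.
  have -> : toEnd (n ∘ m) ^+ k.+1 = 0.
    rewrite expLR mnk; change (n ∘ 0 ∘ m = 0); by rewrite cmpm0 cmp0m.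
  change (i2 ∘ 0 ∘ a1 + i1 ∘ 0 ∘ a2 = 0); by rewrite !cmpm0 !cmp0m addr0.
have [s [[t [ts st]] sF]] : exists s : Hom Q Q, isiso s /\ s^† ∘ id_ Q ∘ s = F^† ∘ F.
  by apply: (@sqrt_form _ _ (id_ Q)); rewrite ?adj1 ?cmp1m ?adjM ?adjK.
exists (F ∘ t); rewrite /isom adjM !cmpA -(cmpA t^†) -sF cmpm1 !cmpA -adjM st adj1.
by rewrite cmp1m.
Qed.

(** T is S equipped with the form f: for v = w^-1 the equation reads v f v^† = 1, so v^† : T -> S
    pulls f back to the identity. For representations w is the map that is f on S0 and 1
    elsewhere. *)
Definition isTwist S (f : Hom S S) T := exists w : Hom T S, isiso w /\ w ∘ w^† = f.

Lemma twist_embed (S T U : sob H) (x : Hom S U) (g f : Hom S S) :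
  isTwist f T -> g^† ∘ (x^† ∘ x) ∘ g = f -> exists y : Hom T U, isom y.
Proof.
case=> w [[v [vw wv]] <-] e; exists (x ∘ g ∘ v^†); rewrite /isom.
have -> : (x ∘ g ∘ v^†)^† ∘ (x ∘ g ∘ v^†) = v ∘ (g^† ∘ (x^† ∘ x) ∘ g) ∘ v^†.
  by rewrite !adjM adjK !cmpA.
by rewrite e !cmpA vw cmp1m -adjM vw adj1.
Qed.

Lemma two_iso A : isiso (id_ A + id_ A).
Proof.
by have [h hh] := half A; exists h; rewrite cmpDr cmpDl cmpm1 cmp1m hh.
Qed.

(** Because p x = 1, the value at x + p^† is x^† x + p p^† + 2. The ring is local and 2 is a unit,
    so the three values are not all nonunits. *)
Lemma unit_norm (B S : sob H) (iB : indec B) (x : Hom B S) (p : Hom S B) :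
  p ∘ x = id_ B -> exists y : Hom B S, isiso (y^† ∘ y).
Proof.
move=> px; have [?|n1] := pselect (isiso (x^† ∘ x)); first by exists x.
have [?|n2] := pselect (isiso (p^†^† ∘ p^†)); first by exists p^†.
exists (x + p^†); rewrite adjD cmpDl !cmpDr.
have -> : x^† ∘ p^† = id_ B by rewrite -adjM px adj1.
rewrite adjK px in n2 *.
have i2 := two_iso (sr B).
have : isiso ((x^† ∘ x + p ∘ p^†) + (id_ B + id_ B) - (x^† ∘ x + p ∘ p^†)) by rewrite addrC addKr.
case/(isiso_add iB) => [|/isisoN]; first by rewrite addrACA [p ∘ _ + _]addrC.
by rewrite opprK => /(isiso_add iB) [].
Qed.

Lemma quasi_reflection_mul S T (z : Hom T S) (w u v : Hom T T) :
  z^† ∘ z = w -> u ∘ w ∘ v = u + v ->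
  (id_ S - z ∘ u ∘ z^†) ∘ (id_ S - z ∘ v ∘ z^†) = id_ S.
Proof.
move=> zw uv; have zuvz : z ∘ u ∘ z^† ∘ (z ∘ v ∘ z^†) = z ∘ u ∘ z^† + z ∘ v ∘ z^†.
  by rewrite !cmpA (cmpK zw) -cmpDl -cmpDr -uv !cmpA.
rewrite cmpBl cmp1m cmpBr cmpm1 zuvz opprB.
by rewrite [X in _ + (X - _)]addrC addrK subrK.
Qed.

(** The classical reflection in z = x - y has the coefficient 2 (z^† z)^-1, which requires z^† z to
    be invertible. The coefficient c = b^-1 with b = 1 - y^† x requires less: z^† z = b + b^† makes
    1 - z c z^† isometric, and z^† x = b makes it send x to x - z = y. *)
Lemma quasi_reflection S T (x y : Hom T S) : isom x -> isom y -> isiso (id_ T - y^† ∘ x) ->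
  exists sg : Hom S S, [/\ sg^† ∘ sg = id_ S, sg ∘ sg^† = id_ S & sg ∘ x = y].
Proof.
rewrite /isom => hx hy [c [cb bc]]; set b := _ - _ in cb bc.
pose z := x - y; pose sg := id_ S - z ∘ c ∘ z^†.
have zx : z^† ∘ x = b by rewrite /z adjB cmpBl hx.
have zz : z^† ∘ z = b + b^†.
  by rewrite -[X in _ ∘ X = _]/(x - y) cmpBr zx /z adjB cmpBl hy /b adjB adj1 adjM adjK opprB.
have asg : sg^† = id_ S - z ∘ c^† ∘ z^† by rewrite /sg adjB adj1 !adjM adjK !cmpA.
have acb : c^† ∘ b^† = id_ T by rewrite -adjM bc adj1.
have abc : b^† ∘ c^† = id_ T by rewrite -adjM cb adj1.
exists sg; split.
- by rewrite asg; apply: (quasi_reflection_mul zz); rewrite cmpDr cmpDl acb cmp1m -cmpA bc cmpm1.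
- by rewrite asg; apply: (quasi_reflection_mul zz); rewrite cmpDr cmpDl cb cmp1m -cmpA abc cmpm1 addrC.
by rewrite /sg cmpBl cmp1m -!cmpA zx cb cmpm1 /z opprB addrC subrK.
Qed.

(** The sum of 1 - y^† x and 1 + y^† x is 2, so one of them is a unit; in the second case the
    reflection takes x to -y and is followed by -1. *)
Lemma witt (T S : sob H) (iT : indec T) (x y : Hom T S) : isom x -> isom y ->
  exists sg : Hom S S, [/\ sg^† ∘ sg = id_ S, sg ∘ sg^† = id_ S & sg ∘ x = y].
Proof.
move=> hx hy; have : isiso ((id_ T - y^† ∘ x) + (id_ T + y^† ∘ x)).
  by rewrite addrACA addNr addr0; exact: two_iso.
case/(isiso_add iT) => i; first exact: quasi_reflection.
have hy' : isom (- y) by rewrite /isom adjN cmpNl cmpNr opprK.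
have [|sg [a b e]] := quasi_reflection hx hy'; first by rewrite adjN cmpNl opprK.
by exists (- sg); rewrite !adjN !cmpNl !cmpNr !opprK e opprK.
Qed.

Lemma isSum_cancel (S T U V : sob H) : indec T -> isSum S T U -> isSum S T V -> congr_ U V.
Proof.
move=> iT [x [j [hx hj xj e]]] [y [k [hy hk yk e']]].
have [sg [s1 s2 sx]] := witt iT hx hy.
have sy : sg^† ∘ y = x by rewrite -sx cmpA s1 cmp1m.
have jx := orthC xj; have ky := orthC yk.
exists (k^† ∘ sg ∘ j); rewrite !adjM adjK; split.
  rewrite !cmpA -(cmpA _ k); have -> : k ∘ k^† = id_ S - y ∘ y^† by rewrite -e' addrAC subrr add0r.
  rewrite cmpBr cmpm1 !cmpBl -!cmpA (cmpA sg^† sg) s1 cmp1m (hj : _ ∘ j = _).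
  by rewrite (cmpA sg^† y) sy (cmpA j^† x) jx cmp0m subr0.
rewrite !cmpA -(cmpA _ j); have -> : j ∘ j^† = id_ S - x ∘ x^† by rewrite -e addrAC subrr add0r.
rewrite cmpBr cmpm1 !cmpBl -!cmpA (cmpA sg sg^†) s2 cmp1m (hk : _ ∘ k = _).
by rewrite (cmpA sg x) sx (cmpA k^† y) ky cmp0m subr0.
Qed.

Lemma cmp_conj2 A B D D' E F (f : Hom B E) (x : Hom D B) (x' : Hom A D) (j : Hom D' B)
    (j' : Hom A D') (g : Hom F A) :
  f ∘ x ∘ x' ∘ g + f ∘ j ∘ j' ∘ g = f ∘ (x ∘ x' + j ∘ j') ∘ g.
Proof. by rewrite cmpDr cmpDl !cmpA. Qed.

Lemma isSum_congr (S S' T U : sob H) : congr_ S S' -> isSum S T U -> isSum S' T U.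
Proof.
case=> f [f1 f2] [x [j [hx hj xj e]]]; exists (f ∘ x), (f ∘ j); split.
- exact: isom_comp.
- exact: isom_comp.
- by rewrite adjM !cmpA (cmpK f1) cmpm1.
by rewrite !adjM !cmpA cmp_conj2 e cmpm1.
Qed.

Lemma isSum_unique (S S' T T' U U' : sob H) :
  isSum S T U -> isSum S' T' U' -> congr_ T T' -> congr_ U U' -> congr_ S S'.
Proof.
case=> [x [j [hx hj xj e]]] [y [k [hy hk yk e']]] [f [f1 f2]] [g [g1 g2]].
have jx := orthC xj; have ky := orthC yk; rewrite /isom in hx hj hy hk.
exists (y ∘ f ∘ x^† + k ∘ g ∘ j^†); rewrite adjD !adjM !adjK !cmpDl !cmpDr !cmpA.
rewrite (cmpK hy) (cmpK yk) (cmpK ky) (cmpK hk) (cmpK hx) (cmpK xj) (cmpK jx) (cmpK hj).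
rewrite !cmpm1 !cmpm0 !cmp0m !addr0 !add0r.
by rewrite (cmpK f1) (cmpK f2) (cmpK g1) (cmpK g2) !cmpm1.
Qed.

(** Associativity of orthogonal sums, in the form needed to interchange two neighbouring
    summands. *)
Lemma resplit (S U V T : sob H) (x : Hom U S) (y : Hom V S) (z : Hom T S) :
  isom x -> isom y -> isom z -> x^† ∘ y = 0 -> x^† ∘ z = 0 -> y^† ∘ z = 0 ->
  x ∘ x^† + (y ∘ y^† + z ∘ z^†) = id_ S ->
  exists S', isSum S U S' /\ isSum S' V T.
Proof.
move=> hx hy hz xy xz yz e; have [S' [j [hj xj e' _]]] := complement hx.
have jj : j ∘ j^† = y ∘ y^† + z ∘ z^† by apply: (addrI (x ∘ x^†)); rewrite e e'.
have zy := orthC yz; rewrite /isom in hx hy hz hj.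
exists S'; split; first by exists x, j.
exists (j^† ∘ y), (j^† ∘ z); rewrite /isom !adjM !adjK; split.
- by rewrite !cmpA -(cmpA _ j) jj cmpDr cmpDl !cmpA hy cmp1m hy yz !cmp0m addr0.
- by rewrite !cmpA -(cmpA _ j) jj cmpDr cmpDl !cmpA zy hz cmp1m hz !cmp0m add0r.
- by rewrite !cmpA -(cmpA _ j) jj cmpDr cmpDl !cmpA hy cmp1m yz !cmp0m addr0.
by rewrite !cmpA cmp_conj2 -jj !cmpA hj cmp1m hj.
Qed.

(** The abstract category has no sum operation, so an orthogonal sum is described by peeling off one
    summand at a time. *)
Fixpoint decomp S (l : seq (sob H)) : Prop :=
  match l with
  | [::] => id_ S = 0
  | T :: l' => exists S', isSum S T S' /\ decomp S' l'
  end.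

Lemma decomp_congr S S' l : congr_ S S' -> decomp S l -> decomp S' l.
Proof.
case: l => [|T l] c /=; last by case=> U [sU dU]; exists U; split=> //; exact: isSum_congr sU.
by case: c => f [_ <-] h; rewrite -[f]cmpm1 h cmpm0 cmp0m.
Qed.

Lemma decomp_unique S S' l : decomp S l -> decomp S' l -> congr_ S S'.
Proof.
elim: l S S' => [|T l IH] S S' /=.
  by move=> h h'; exists 0; rewrite cmpm0 cmp0m h h'.
move=> [U [sU dU]] [U' [sU' dU']].
exact: isSum_unique sU sU' (congr_refl T) (IH _ _ dU dU').
Qed.

Lemma decomp_perm S l l' : Permutation l l' -> decomp S l -> decomp S l'.
Proof.
move=> p; elim: p S => {l l'} [|T l l' _ IH|U T l|l l' l'' _ IH1 _ IH2] S //=.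
- by case=> U [sU dU]; exists U; split=> //; apply: IH.
- case=> S1 [[x [j [hx hj xj e]]] [S2 [[y [k [hy hk yk e']]] d]]].
  have [|||||||S' [s1 s2]] := @resplit S U T S2 (j ∘ y) x (j ∘ k).
  - exact: isom_comp.
  - exact: hx.
  - exact: isom_comp.
  - by rewrite adjM -cmpA (orthC xj) cmpm0.
  - by rewrite adjM !cmpA (cmpK hj) cmpm1.
  - by rewrite cmpA xj cmp0m.
  - by rewrite addrCA !adjM !cmpA cmp_conj2 e' cmpm1.
  by exists S'; split=> //; exists S2.
by move/IH1/IH2.
Qed.

End Forms.

(** * Krull-Schmidt cancellation *)

Section DirectSums.
Variable H : hcat.
Implicit Types (A B D M N X Y : rep H) (S T U Q : sob H).

Definition rsum A M X := exists (i : Hom M A) (p : Hom A M) (j : Hom X A) (q : Hom A X),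
  [/\ p ∘ i = id_ M, q ∘ j = id_ X, p ∘ j = 0, q ∘ i = 0 & i ∘ p + j ∘ q = id_ A].

(** Once p i2 is invertible, the image of i2 is complementary to X as well as to Y, and the
    projection k along i2 identifies the two complements. *)
Lemma rsum_cancel A M X Y : indec M -> rsum A M X -> rsum A M Y -> isoc X Y.
Proof.
move=> iM [i [p [j [q [pi qj pj qi e]]]]] [i2 [p2 [j2 [q2 [pi2 qj2 pj2 qi2 e2]]]]].
wlog [v [vu uv]] : p j pi qj pj qi e / isiso (p ∘ i2).
  move=> wl; have [|n] := pselect (isiso (p ∘ i2)); first exact: (wl p j).
  have iv : isiso (p2 ∘ j ∘ q ∘ i2).
    have : isiso (p2 ∘ (i ∘ p + j ∘ q) ∘ i2) by rewrite e cmpm1 pi2; exact: isiso_id.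
    rewrite cmpDr cmpDl !cmpA => /(isiso_add iM) [|//].
    by rewrite -cmpA => /(isiso_compr iM) /n.
  (* Shear the first decomposition. Since 1 = p2 i p i2 + p2 j q i2, the second term is a unit when
     p i2 is not; adding it to p i2 makes the new projection invertible on i2. The correction of j
     keeps it in the kernel of the projection. *)
  apply: (wl (p + p2 ∘ j ∘ q) (j - i ∘ p2 ∘ j)).
  - by rewrite cmpDl pi (cmpK qi) cmpm0 addr0.
  - by rewrite cmpBr qj !cmpA qi !cmp0m subr0.
  - rewrite cmpDl !cmpBr pj !cmpA pi cmp1m (cmpK qj) (cmpK qi) cmpm1 cmpm0 !cmp0m subr0.
    by rewrite sub0r addNr.
  - exact: qi.
  - by rewrite cmpDr cmpBl !cmpA addrACA subrr addr0 e.
  by rewrite cmpDl; case: (isiso_add iM (f := - (p ∘ i2)) (g := p ∘ i2 + p2 ∘ j ∘ q ∘ i2)) => //; rewrite ?addKr // => /isisoN; rewrite opprK.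
pose k := id_ A - i2 ∘ v ∘ p.
have pk : p ∘ k = 0 by rewrite /k cmpBr cmpm1 !cmpA uv cmp1m subrr.
have ki : k ∘ i2 = 0 by rewrite /k cmpBl cmp1m -!cmpA vu cmpm1 subrr.
have kj : k ∘ j = j by rewrite /k cmpBl cmp1m -!cmpA pj !cmpm0 subr0.
have qk : q2 ∘ k = q2 by rewrite /k cmpBr cmpm1 !cmpA qi2 !cmp0m subr0.
exists (q2 ∘ j), (q ∘ k ∘ j2); split.
  rewrite !cmpA -(cmpA _ j2); have -> : j2 ∘ q2 = id_ A - i2 ∘ p2 by rewrite -e2 addrAC subrr add0r.
  by rewrite cmpBr cmpm1 !cmpA -(cmpA q k i2) ki cmpm0 !cmp0m subr0 -cmpA kj.
rewrite !cmpA -(cmpA _ j); have -> : j ∘ q = id_ A - i ∘ p by rewrite -e addrAC subrr add0r.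
by rewrite cmpBr cmpm1 !cmpBl qk !cmpA -(cmpA _ p k) pk cmpm0 cmp0m subr0 qj2.
Qed.

Lemma rcomplement A M (i : Hom M A) (p : Hom A M) : p ∘ i = id_ M ->
  exists X (j : Hom X A) (q : Hom A X),
    [/\ q ∘ j = id_ X, p ∘ j = 0, q ∘ i = 0 & i ∘ p + j ∘ q = id_ A].
Proof.
move=> pi; pose e := id_ A - i ∘ p.
have ei : e ∘ i = 0 by rewrite /e cmpBl cmp1m -cmpA pi cmpm1 subrr.
have pe : p ∘ e = 0 by rewrite /e cmpBr cmpm1 cmpA pi cmp1m subrr.
have ee : e ∘ e = e by rewrite {2}/e cmpBr cmpm1 cmpA ei cmp0m subr0.
have [e1|[X [j [q [_ qj jq]]]]] := idem_split ee.
  rewrite e1 cmp1m in ei; rewrite e1 cmpm1 in pe.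
  by exists A, (id_ A), (id_ A); rewrite !cmp1m cmpm1 ei pe cmp0m add0r.
exists X, j, q; split=> //.
- by rewrite -[j]cmpm1 -qj cmpA cmpA -(cmpA p) jq pe cmp0m.
- by rewrite -[q]cmp1m -qj -!cmpA (cmpA j) jq ei cmpm0.
by rewrite jq /e addrC subrK.
Qed.

Lemma rsum_iso A A' M X : isoc A A' -> rsum A M X -> rsum A' M X.
Proof.
case=> f [g [gf fg]] [i [p [j [q [pi qj pj qi e]]]]].
exists (f ∘ i), (p ∘ g), (f ∘ j), (q ∘ g); rewrite !cmpA !(cmpK gf) !cmpm1; split=> //.
by rewrite cmp_conj2 e cmpm1.
Qed.

Lemma rsum_isol A M M' X : isoc M M' -> rsum A M X -> rsum A M' X.
Proof.
case=> f [g [gf fg]] [i [p [j [q [pi qj pj qi e]]]]].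
exists (i ∘ g), (f ∘ p), j, q; rewrite !cmpA (cmpK pi) (cmpK gf) !cmpm1 -cmpA pj cmpm0 qi cmp0m.
by split.
Qed.

Lemma dual_isoc A M M' : dual A M -> dual A M' -> isoc M M'.
Proof.
move=> d d'; exists (ad d' d (id_ A)), (ad d d' (id_ A)).
by rewrite -(adM d d') -(adM d' d) cmpm1 !ad1.
Qed.

Lemma isSum_rsum S T U : isSum S T U -> rsum S T U.
Proof.
by case=> i [j [hi hj ij e]]; exists i, i^†, j, j^†; split=> //; apply: orthC.
Qed.

(** A hyperbolic object is decomposable; splitting it into M and its dual M' makes cancellation of
    indecomposables applicable twice. *)
Lemma plus_rsum M Q X S : isPlus M Q -> rsum S Q X ->
  exists M' Y, [/\ dual M M', rsum S M Y & rsum Y M' X].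
Proof.
case=> M' [d [i1 [i2 []]]]; set d' := dualC d.
set a1 := ad d _ i1; set a2 := ad d' _ i2 => e11 e22 e21 e1.
have e12 : a1 ∘ i2 = id_ M'.
  have <- : ad d d (id_ M) = id_ M' by exact: ad1.
  by rewrite -e21 (adM d (sd Q) d) adK.
case=> x [p [j [q [px qj pj qx e]]]].
have pi : a2 ∘ p ∘ (x ∘ i1) = id_ M by rewrite cmpA (cmpK px) cmpm1.
have [Y [k [l [lk pk li f]]]] := rcomplement pi.
exists M', Y; split=> //; first by exists (x ∘ i1), (a2 ∘ p), k, l.
exists (l ∘ (x ∘ i2)), (a1 ∘ p ∘ k), (l ∘ j), (q ∘ k).
have kl : k ∘ l = id_ S - x ∘ i1 ∘ (a2 ∘ p) by rewrite -f addrAC subrr add0r.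
have mid A0 B0 (u : Hom S A0) (w : Hom B0 S) : u ∘ k ∘ (l ∘ w) = u ∘ w - u ∘ x ∘ i1 ∘ a2 ∘ p ∘ w.
  by rewrite cmpA -(cmpA u) kl cmpBr cmpm1 cmpBl !cmpA.
split; rewrite ?mid.
- by rewrite !cmpA !(cmpK px) !cmpm1 e11 !cmp0m subr0 e12.
- by rewrite qj qx !cmp0m subr0.
- by rewrite -!cmpA pj !cmpm0 subr0.
- by rewrite !cmpA qx !cmp0m subr0.
have <- : l ∘ (x ∘ (i1 ∘ a2 + i2 ∘ a1) ∘ p + j ∘ q) ∘ k = id_ Y by rewrite e1 cmpm1 e cmpm1.
have lx : l ∘ x ∘ i1 = 0 by rewrite -cmpA.
by rewrite !cmpDr !cmpDl !cmpDr !cmpDl !cmpA lx !cmp0m add0r.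
Qed.

End DirectSums.

(** * Uniqueness of the decomposition *)

Section Uniqueness.
Variable H : hcat.
Implicit Types (A B D M N X Y : rep H) (S T U Q : sob H).
Variables (L : Type) (F : L -> sob H).

(** For indecomposable M this says that M is a direct summand of X, in a form that locality passes
    on to some term of a sum. *)
Definition through M X := exists (a : Hom M X) (b : Hom X M), isiso (b ∘ a).

Lemma summand_of M S ls : indec M -> through M S -> decomp S (map F ls) ->
  exists l, List.In l ls /\ through M (F l).
Proof.
move=> iM; elim: ls S => [|l ls IH] S /= [a [b i]].
  by move=> S0; case: (nonunit0 iM); rewrite -[b]cmpm1 S0 cmpm0 cmp0m in i.
case=> S' [[x [j [hx hj xj e]]] d].
have : isiso (b ∘ (x ∘ x^† + j ∘ j^†) ∘ a) by rewrite e cmpm1.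
rewrite cmpDr cmpDl => /(isiso_add iM) [] h.
  by exists l; split; [left|exists (x^† ∘ a), (b ∘ x); rewrite !cmpA; rewrite !cmpA in h].
have [|l' [inl t]] := IH S' _ d; first by exists (j^† ∘ a), (b ∘ j); rewrite !cmpA; rewrite !cmpA in h.
by exists l'; split=> //; right.
Qed.

Lemma decomp_isom S ls l : decomp S (map F ls) -> List.In l ls ->
  exists x : Hom (F l) S, isom x.
Proof.
elim: ls S => //= l' ls IH S [S' [[x [j [hx hj xj e]]] d]] [<-|inl]; first by exists x.
by have [y hy] := IH _ d inl; exists (j ∘ y); apply: isom_comp.
Qed.

(** [ys] lists the components of x in the summands labelled l0; the components elsewhere contribute
    nonunits, since B is no summand there. The last two clauses bound the number of terms by the
    multiplicity of l0. *)
Lemma gram (B : sob H) (iB : indec B) (l0 : L) S ls (x : Hom B S) :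
  decomp S (map F ls) ->
  (forall l, List.In l ls -> l <> l0 -> ~ through B (F l)) ->
  exists ys : seq (Hom B (F l0)),
    [/\ ~ isiso (x^† ∘ x - \sum_(y <- ys) y^† ∘ y),
     (0 < size ys)%N -> exists l1 l2, ls = l1 ++ l0 :: l2
     & (1 < size ys)%N -> exists l1 l2 l3, ls = l1 ++ l0 :: l2 ++ l0 :: l3].
Proof.
elim: ls S x => [|l ls IH] S x /=.
  move=> S0 _; exists [::]; split=> //; rewrite big_nil subr0 -[x]cmp1m S0 cmp0m cmpm0.
  exact: nonunit0.
case=> S' [[i [j [hi hj ij e]]] d] irr.
have split : x^† ∘ x = (i^† ∘ x)^† ∘ (i^† ∘ x) + (j^† ∘ x)^† ∘ (j^† ∘ x).
  by rewrite !adjM !adjK !cmpA cmp_conj2 e cmpm1.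
have [|ys [nys s0 s1]] := IH S' (j^† ∘ x) d; first by move=> l' inl; apply: irr; right.
have [el|nl] := pselect (l = l0).
  subst l; exists (i^† ∘ x :: ys); split.
  - by rewrite big_cons split opprD addrACA subrr add0r.
  - by move=> _; exists [::], ls.
  by rewrite ltnS => /s0 [l1 [l2 ->]]; exists [::], l1, l2.
exists ys; split.
- rewrite split -addrA; apply: (nonunit_add iB) => //.
  move=> h; apply: (irr l (or_introl erefl) nl).
  by exists (i^† ∘ x), (i^† ∘ x)^†.
- by move/s0 => [l1 [l2 ->]]; exists (l :: l1), l2.
by move/s1 => [l1 [l2 [l3 ->]]]; exists (l :: l1), l2, l3.
Qed.
End Uniqueness.

Section Labels.
Variable H : hcat.
Implicit Types (A B D M X Y : rep H) (S T U Q : sob H).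
Variables (I : Type) (N : I -> rep H).
Hypothesis iN : forall i, indec (N i).
Hypothesis N_inj : forall i j, isoc (N i) (N j) -> i = j.
Notation L := (I + I * bool)%type.
Variables (F : L -> sob H) (okl : L -> Prop) (amo : seq L -> Prop).
Hypothesis F_plus : forall i, okl (inl i) -> isPlus (N i) (F (inl i)).
Hypothesis F_form : forall i k, okl (inr (i, k)) -> isoc (N i) (F (inr (i, k))).
Hypothesis okl_false : forall i k, okl (inr (i, k)) -> okl (inr (i, false)).
Hypothesis plus_noform : forall i, okl (inl i) -> forall S, ~ isoc (N i) S.
Hypothesis plus_dual : forall i j M', okl (inl i) -> okl (inl j) ->
  dual (N j) M' -> isoc (N i) M' -> i = j.
Hypothesis amo_perm : forall ls ls', Permutation ls ls' -> amo ls -> amo ls'.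
Hypothesis amo_tail : forall l ls, amo (l :: ls) -> amo ls.
Hypothesis sep : forall i ls S, okl (inr (i, false)) -> List.Forall okl ls -> amo ls ->
  ~ List.In (inr (i, false)) ls -> decomp S (map F ls) ->
  forall x : Hom (F (inr (i, false))) S, ~ isom x.

Lemma isPlus_through M Q X : indec M -> isPlus M Q -> indec X -> through X Q ->
  isoc X M \/ exists M', dual M M' /\ isoc X M'.
Proof.
move=> iM [M' [d [i1 [i2 [_ _ _ e]]]]] iX [a [b]].
rewrite -[b]cmpm1 -e cmpDr cmpDl => /(isiso_add iX) [] i.
  left; exists (ad (dualC d) (sd Q) i2 ∘ a).
  by apply: (isiso_factor iX iM (g := b ∘ i1)); rewrite !cmpA; rewrite !cmpA in i.
right; exists M'; split=> //; exists (ad d (sd Q) i1 ∘ a).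
by apply: (isiso_factor iX (indec_dual d iM) (g := b ∘ i2)); rewrite !cmpA; rewrite !cmpA in i.
Qed.

Lemma through_ok i l : okl l -> through (N i) (F l) ->
  match l with
  | inl j => i = j \/ exists M', dual (N j) M' /\ isoc (N i) M'
  | inr (j, _) => i = j
  end.
Proof.
case: l => [j|[j k]] ok t.
  case: (isPlus_through (iN j) (F_plus ok) (iN i) t) => h; last by right.
  by left; apply: N_inj.
apply: N_inj; apply: isoc_trans (isoc_sym (F_form ok)).
have iF := indec_iso (F_form ok) (iN j).
by case: t => a [b /(isiso_factor (iN i) iF) ia]; exists a.
Qed.

Lemma dual_sob M M' T : dual M M' -> isoc M' T -> isoc M T.
Proof.
move=> d [f [g [gf fg]]]; have d' := dualC d.
apply: isoc_sym; exists (ad d' (sd T) f), (ad (sd T) d' g).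
by rewrite -(adM d' (sd T)) -(adM (sd T) d') gf fg !ad1.
Qed.

Lemma through_form i k : okl (inr (i, k)) -> forall S ls, decomp S (map F ls) ->
  List.In (inr (i, k)) ls -> through (N i) S.
Proof.
move=> ok S ls d inl; have [x hx] := decomp_isom d inl.
have [f [g [gf fg]]] := F_form ok; exists (x ∘ f), (g ∘ x^†).
by rewrite !cmpA (cmpK hx) cmpm1 gf; exact: isiso_id.
Qed.

Lemma through_plus i : okl (inl i) -> forall S ls, decomp S (map F ls) ->
  List.In (inl i) ls -> through (N i) S.
Proof.
move=> ok S ls d inl; have [x hx] := decomp_isom d inl.
have [M' [d' [i1 [i2 [_ _ e _]]]]] := F_plus ok.
exists (x ∘ i1), (ad (dualC d') (sd _) i2 ∘ x^†).
by rewrite !cmpA (cmpK hx) cmpm1 e; exact: isiso_id.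
Qed.

Lemma through_iso M A B : isoc A B -> through M A -> through M B.
Proof.
case=> f [g [gf fg]] [a [b i]]; exists (f ∘ a), (b ∘ g).
by rewrite !cmpA (cmpK gf) cmpm1.
Qed.

Lemma in_permutation (l : L) ls : List.In l ls ->
  exists ls', Permutation ls (l :: ls').
Proof.
move=> h; have [l1 [l2 ->]] := List.in_split _ _ h; exists (l1 ++ l2).
exact/Permutation_sym/Permutation_middle.
Qed.

Lemma decomp_perm_map S (ls ls' : seq L) : Permutation ls ls' ->
  decomp S (map F ls) -> decomp S (map F ls').
Proof. by move=> p; apply: decomp_perm; exact: Permutation_map. Qed.

Definition is_plus_label (l : L) := exists i, l = inl i.

(** Only an isomorphism of S and S' is assumed, because cancelling M and its dual as plain objects
    leaves remainders that are known to be isomorphic, not congruent. *)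
Lemma plus_unique ls ls' S S' :
  List.Forall okl ls -> List.Forall okl ls' ->
  List.Forall is_plus_label ls -> List.Forall is_plus_label ls' ->
  decomp S (map F ls) -> decomp S' (map F ls') -> isoc S S' -> Permutation ls ls'.
Proof.
elim: ls ls' S S' => [|l ls IH] ls' S S' ok ok' pl pl' d d' ss.
  case: ls' ok' pl' d' => // l' ls' ok' pl' d'.
  have [i el] := List.Forall_inv pl'; subst l'.
  have oki := List.Forall_inv ok'.
  have [a [b [c [h _]]]] := through_iso (isoc_sym ss) (through_plus oki d' (or_introl erefl)).
  by case: (indec_nz (iN i)); rewrite -h -[b]cmpm1 (d : id_ S = 0) cmpm0 cmp0m cmpm0.
have [i el] := List.Forall_inv pl; subst l.
have oki := List.Forall_inv ok.
have t := through_iso ss (through_plus oki d (or_introl erefl)).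
have [l [inl tl]] := summand_of (iN i) t d'.
have okl0 := (List.Forall_forall okl ls').1 ok' _ inl.
have el : l = Datatypes.inl i.
  have [j el] := (List.Forall_forall is_plus_label ls').1 pl' _ inl; subst l.
  have [->//|[M' [dM iM]]] := through_ok okl0 tl.
  by rewrite (plus_dual oki okl0 dM iM).
subst l; have [ls2 p2] := in_permutation inl.
have := decomp_perm_map p2 d'; case=> X' [sX' dX']; case: d => X [sX dX].
have [M1 [Y [dM1 r1 r2]]] := plus_rsum (F_plus oki) (isSum_rsum sX).
have [M2 [Y' [dM2 r1' r2']]] := plus_rsum (F_plus oki) (isSum_rsum sX').
have iY : isoc Y Y' by apply: rsum_cancel (iN i) _ r1'; exact: rsum_iso r1.
have r3 := rsum_isol (dual_isoc dM2 dM1) (rsum_iso (isoc_sym iY) r2').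
have iX := rsum_cancel (indec_dual dM1 (iN i)) r2 r3.
have ok2 := Permutation_Forall p2 ok'.
have pl2 := Permutation_Forall p2 pl'.
apply: perm_trans (Permutation_sym p2).
apply: perm_skip; apply: (IH _ X X') => //.
- exact: List.Forall_inv_tail ok.
- exact: List.Forall_inv_tail ok2.
- exact: List.Forall_inv_tail pl.
exact: List.Forall_inv_tail pl2.
Qed.

(** If [k] is false, [sep] applies at once. Otherwise locality finds N i among the summands of ls'.
    It carries a form, so the label found is not hyperbolic; (i, true) is excluded, and for (i,
    false) [sep] applies with the two lists interchanged. *)
Lemma decomp_no_form S ls ls' i k :
  List.Forall okl ls -> List.Forall okl ls' -> amo ls -> amo ls' ->
  decomp S (map F ls) -> decomp S (map F ls') ->
  List.In (inr (i, k)) ls ->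
  (forall k', List.In (inr (i, k')) ls -> ~ List.In (inr (i, k')) ls') -> False.
Proof.
move=> ok ok' am am' d d' inl dis.
have oki := (List.Forall_forall okl ls).1 ok _ inl; have okf := okl_false oki.
have nosep ls1 ls2 : List.Forall okl ls2 -> amo ls2 -> decomp S (map F ls1) ->
    decomp S (map F ls2) -> List.In (inr (i, false)) ls1 -> ~ List.In (inr (i, false)) ls2 -> False.
  move=> ok2 am2 d1 d2 in1 nin2; have [x hx] := decomp_isom d1 in1.
  exact: (sep okf ok2 am2 nin2 d2 hx).
case: k inl oki => inl oki; last by apply: (nosep ls ls') => //; exact: dis.
have [l [inl' tl]] := summand_of (iN i) (through_form oki d inl) d'.
have okl0 := (List.Forall_forall okl ls').1 ok' _ inl'.
case: l inl' tl okl0 => [j|[j k]] inl' tl okl0.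
  have := through_ok okl0 tl => - [eij|[M' [dM iM]]].
    by subst j; apply: (plus_noform okl0 (F_form oki)).
  apply: (plus_noform okl0 (dual_sob dM (isoc_trans (isoc_sym iM) (F_form oki)))).
have eij : i = j := through_ok okl0 tl; subst j.
case: k inl' tl okl0 => inl' tl okl0; first by case: (dis true).
apply: (nosep ls' ls) => // inl''; exact: (dis false).
Qed.

(** Common form labels are cancelled by the reflection. When none is common, no form label occurs at
    all, and the hyperbolic ones are compared up to isomorphism. *)
Theorem decomp_inj S ls ls' :
  List.Forall okl ls -> List.Forall okl ls' -> amo ls -> amo ls' ->
  decomp S (map F ls) -> decomp S (map F ls') -> Permutation ls ls'.
Proof.
have [n] : exists n, n = size ls by exists (size ls).
elim: n ls ls' S => [|n IH] ls ls' S en ok ok' am am' d d'.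
all: have [[i [k [inl inl']]]|nocommon] := pselect (exists i k,
  List.In (inr (i, k)) ls /\ List.In (inr (i, k)) ls').
1: by case: ls en inl {ok am d}.
2: {
have [r p] := in_permutation inl; have [r' p'] := in_permutation inl'.
have okr := Permutation_Forall p ok; have okr' := Permutation_Forall p' ok'.
have := decomp_perm_map p d => - [X [sX dX]]; have := decomp_perm_map p' d' => - [X' [sX' dX']].
have oki := List.Forall_inv okr.
have cX := isSum_cancel (indec_iso (F_form oki) (iN i)) sX sX'.
apply: (perm_trans p); apply: (perm_trans _ (Permutation_sym p')).
apply: perm_skip; apply: (IH _ _ X').
- by have := Permutation_length p; rewrite -[List.length _]/(size _) -en => - [].
- exact: List.Forall_inv_tail okr.
- exact: List.Forall_inv_tail okr'.
- exact: amo_tail (amo_perm p am).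
- exact: amo_tail (amo_perm p' am').
- exact: decomp_congr cX dX.
- exact: dX'. }
all: apply: (plus_unique ok ok' _ _ d d' (isoc_refl S)).
all: apply/List.Forall_forall => - [i|[i k]] inl;
  first by exists i.
all: exfalso.
all: try by apply: (decomp_no_form ok ok' am am' d d' inl) => k' in1 in2; apply: nocommon; exists i, k'.
all: try by apply: (decomp_no_form ok' ok am' am d' d inl) => k' in1 in2; apply: nocommon; exists i, k'.
Qed.

End Labels.

(** * Existence of the decomposition *)

Section Existence.
Variable H : hcat.
Implicit Types (A B D M X Y : rep H) (S T U Q : sob H).

Lemma form_lift S (iS : indec S) (f t g : Hom S S) : f^† = f -> t^† = t -> isiso t ->
  ~ isiso (g^† ∘ f ∘ g - t) -> exists g', g'^† ∘ f ∘ g' = t.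
Proof.
move=> af at_ [ti [tit tti]] n.
have [||s [[s' [s's ss']] e]] := @sqrt_form _ S t ti (g^† ∘ f ∘ g) at_ _ tit tti.
- by rewrite !adjM adjK af cmpA.
- apply: (nonunit_nilp iS) => i; apply: n.
  have -> : g^† ∘ f ∘ g - t = t ∘ (ti ∘ (g^† ∘ f ∘ g) - id_ S).
    by rewrite cmpBr cmpm1 !cmpA tti cmp1m.
  by apply: isiso_comp => //; exists ti.
exists (g ∘ s'); rewrite adjM.
have -> : s'^† ∘ g^† ∘ f ∘ (g ∘ s') = s'^† ∘ (g^† ∘ f ∘ g) ∘ s' by rewrite !cmpA.
by rewrite -e !cmpA -adjM ss' adj1 cmp1m (cmpK ss') cmpm1.
Qed.

Variables (I : Type) (N : I -> rep H).
Hypothesis iN : forall i, indec (N i).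
Notation L := (I + I * bool)%type.
Variables (F : L -> sob H) (okl : L -> Prop).
Hypothesis N_complete : forall M, indec M -> exists i, isoc M (N i).
Hypothesis F_plus : forall i, okl (inl i) -> isPlus (N i) (F (inl i)).
Hypothesis okl_plus : forall i, (forall T, ~ isoc (N i) T) ->
  okl (inl i) \/ exists j M', [/\ dual (N i) M', isoc (N j) M' & okl (inl j)].
Hypothesis F_form : forall i k, okl (inr (i, k)) -> isoc (N i) (F (inr (i, k))).
Hypothesis okl_form : forall i T, isoc (N i) T -> okl (inr (i, false)).
Hypothesis reduce : forall i, let B := F (inr (i, false)) in okl (inr (i, false)) ->
  forall f : Hom B B, f^† = f -> isiso f ->
  exists k (g t : Hom B B), [/\ okl (inr (i, k)), isTwist t (F (inr (i, k))) & g^† ∘ f ∘ g = t].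

Lemma exists_piece S : id_ S <> 0 ->
  exists l (x : Hom (F l) S), [/\ okl l, id_ (F l) <> 0 & isom x].
Proof.
move=> S0; have [M [a [b [iM ba]]]] := indec_summand S0.
have [i [u [v [vu uv]]]] := N_complete iM.
have [[T iT]|nT] := pselect (exists T, isoc (N i) T).
  have ok := okl_form iT; have [w [z [zw wz]]] := F_form ok.
  have iB := indec_iso (F_form ok) (iN i).
  have [|y iy] := @unit_norm _ (F (inr (i, false))) S iB (a ∘ v ∘ z) (w ∘ u ∘ b).
    by rewrite !cmpA (cmpK ba) cmpm1 (cmpK uv) cmpm1 wz.
  have [|k [g [t [okk tw e]]]] := reduce ok _ iy; first by rewrite adjM adjK.
  have [x hx] := twist_embed tw e.
  by exists (inr (i, k)), x; split=> //; case: (indec_iso (F_form okk) (iN i)).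
have nT' T : ~ isoc (N i) T by move=> h; apply: nT; exists T.
have nz M1 Q : indec M1 -> isPlus M1 Q -> id_ Q <> 0.
  move=> [M10 _] [M1' [d [i1 [i2 [_ _ e _]]]]] Q0; apply: M10.
  by rewrite -e -[i1]cmp1m Q0 cmp0m cmpm0.
case: (okl_plus nT') => [ok|[j [M' [d [u' [v' [vu' uv']]] ok]]]].
  have [|x hx] := plus_embed (iN i) nT' (S := S) (x := a ∘ v) (p := u ∘ b) _ (F_plus ok).
    by rewrite !cmpA (cmpK ba) cmpm1 uv.
  by exists (inl i), x; split=> //; apply: nz (F_plus ok).
have nTj T : ~ isoc (N j) T.
  move=> h; apply: (nT' T); apply: dual_sob d (isoc_trans _ h); apply: isoc_sym.
  by exists u', v'.
(* The summand found is N i, but the chosen member of its dual pair is N j. As S is selfadjoint, the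
   adjoints of projection and inclusion exhibit N j as a summand too. *)
have [|x hx] := plus_embed (iN j) nTj (S := S) (x := ad (sd S) d (u ∘ b) ∘ u')
    (p := v' ∘ ad d (sd S) (a ∘ v)) _ (F_plus ok).
  rewrite !cmpA -(cmpA v') -(adM d (sd S) d) -!cmpA (cmpA b) ba cmp1m uv ad1 cmp1m.
  exact: vu'.
by exists (inl j), x; split=> //; apply: nz (F_plus ok).
Qed.

Variable once : bool.
Hypothesis pair : once -> forall i S (y1 y2 : Hom (F (inr (i, true))) S), okl (inr (i, true)) ->
  isom y1 -> isom y2 -> y1^† ∘ y2 = 0 -> exists x : Hom (F (inr (i, false))) S, isom x.

(* Split off a summand F (i, false) whenever one embeds: then F (i, true) is
   split off only when no F (i, false) embeds, which by [pair] happens at most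
   once for each i. *)
Lemma exists_decomp S : exists ls, [/\ List.Forall okl ls, decomp S (map F ls) &
  once -> ~ exists l1 l2 l3 i, ls = l1 ++ inr (i, true) :: l2 ++ inr (i, true) :: l3].
Proof.
have greedy U : id_ U <> 0 -> exists l (x : Hom (F l) U), [/\ okl l, id_ (F l) <> 0, isom x &
    forall i, l = inr (i, true) -> forall y : Hom (F (inr (i, false))) U, ~ isom y].
  move=> /exists_piece [l [x [okx nz hx]]].
  have [[i [el [y hy]]]|h] := pselect (exists i, l = inr (i, true) /\
      exists y : Hom (F (inr (i, false))) U, isom y).
    have okf : okl (inr (i, false)).
      by apply: (okl_form (T := F l)); rewrite el in okx *; exact: F_form.
    exists (inr (i, false)), y; split=> //.
    by case: (indec_iso (F_form okf) (iN i)).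
  exists l, x; split=> // i el y hy; apply: h; exists i; split=> //.
  by exists y.
have [n] : exists A, A = sr S by exists (sr S).
elim/(well_founded_ind (@rlt_wf H)): n S => A IH S eA.
have [S0|S0] := pselect (id_ S = 0).
  by exists [::]; split=> // _ [[|? ?]] [? [? [? ]]].
have [l [x [okx nz hx no]]] := greedy S S0.
have [U [j [hj xj e lt]]] := complement hx.
have [ls [okls d nU]] := IH U (eq_ind_r (fun A => rlt U A) (lt nz) eA) U erefl.
exists (l :: ls); split; first by constructor.
  by exists U; split=> //; exists x, j.
move=> o [[|l' l1] [l2 [l3 [i /= [el els]]]]]; last by apply: (nU o); exists l1, l2, l3, i.
have [y hy] : exists y : Hom (F (inr (i, true))) U, isom y.
  by apply: (decomp_isom d); rewrite els; apply/List.in_or_app; right; left.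
subst l; have [|z] := pair o okx hx (isom_comp hj hy); first by rewrite cmpA xj cmp0m.
exact: no.
Qed.

End Existence.

(** * The residue skew field *)

Local Open Scope quotient_scope.
Section Residue.
Variables (H : hcat) (M : rep H) (iM : indec M).

Definition res_eq (x y : Hom M M) : bool := `[< ~ isiso (x - y) >].

Lemma res_eq_equiv : equiv_class_of res_eq.
Proof.
split=> [x|x y|y x z]; rewrite /res_eq.
- by apply/asboolP; rewrite subrr; apply: nonunit0.
- by apply/idP/idP=> /asboolP h; apply/asboolP; rewrite -opprB; apply: nonunitN.
by move=> /asboolP h /asboolP h'; apply/asboolP; rewrite -(subrKA y); apply: nonunit_add.
Qed.

Canonical res_equiv := EquivRelPack res_eq_equiv.

(** The T(B) of the theorem, for any indecomposable M: by locality the noninvertible endomorphisms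
    form the ideal R. *)
Definition residue := {eq_quot res_equiv}.
HB.instance Definition _ := Choice.on residue.

Definition res (x : Hom M M) : residue := \pi_residue x.

Lemma res_eqP x y : res x = res y <-> ~ isiso (x - y).
Proof.
split=> [/eqmodP|h]; first by move/asboolP.
by apply/eqmodP/asboolP.
Qed.

Lemma res_surj (t : residue) : exists x, t = res x.
Proof. by exists (repr t); rewrite /res reprK. Qed.

Lemma res_repr x : res (repr (res x)) = res x.
Proof. exact: reprK. Qed.

Definition radd (s t : residue) := locked res (repr s + repr t).
Definition ropp (s : residue) := locked res (- repr s).
Definition rmul (s t : residue) := locked res (repr s ∘ repr t).

Lemma raddE x y : radd (res x) (res y) = res (x + y).
Proof.
rewrite /radd -lock; apply/res_eqP; rewrite opprD addrACA.
by apply: nonunit_add => //; apply/res_eqP; rewrite res_repr.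
Qed.
Lemma roppE x : ropp (res x) = res (- x).
Proof.
by rewrite /ropp -lock; apply/res_eqP; rewrite -opprD; apply: nonunitN => //; apply/res_eqP; rewrite res_repr.
Qed.
Lemma rmulE x y : rmul (res x) (res y) = res (x ∘ y).
Proof.
rewrite /rmul -lock; apply/res_eqP; set x' := repr _; set y' := repr _.
have -> : x' ∘ y' - x ∘ y = (x' - x) ∘ y' + x ∘ (y' - y) by rewrite cmpBl cmpBr addrA subrK.
have h z : ~ isiso (repr (res z) - z) by apply/res_eqP; rewrite res_repr.
by apply: nonunit_add => //; [move/(isiso_compl iM)/h|move/(isiso_compr iM)/h].
Qed.

Lemma raddA : associative radd.
Proof.
move=> s t u; have [x ->] := res_surj s; have [y ->] := res_surj t; have [z ->] := res_surj u.
by rewrite !raddE addrA.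
Qed.
Lemma raddC : commutative radd.
Proof. by move=> s t; rewrite /radd addrC. Qed.
Lemma radd0 : left_id (res 0) radd.
Proof. by move=> s; have [x ->] := res_surj s; rewrite raddE add0r. Qed.
Lemma raddN : left_inverse (res 0) ropp radd.
Proof. by move=> s; have [x ->] := res_surj s; rewrite roppE raddE addNr. Qed.
HB.instance Definition _ := GRing.isZmodule.Build residue raddA raddC radd0 raddN.

Lemma rmulA : associative rmul.
Proof.
move=> s t u; have [x ->] := res_surj s; have [y ->] := res_surj t; have [z ->] := res_surj u.
by rewrite !rmulE cmpA.
Qed.
Lemma rmul1 : left_id (res (id_ M)) rmul.
Proof. by move=> s; have [x ->] := res_surj s; rewrite rmulE cmp1m. Qed.
Lemma rmulr1 : right_id (res (id_ M)) rmul.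
Proof. by move=> s; have [x ->] := res_surj s; rewrite rmulE cmpm1. Qed.
Lemma rmulDl : left_distributive rmul +%R.
Proof.
move=> s t u; have [x ->] := res_surj s; have [y ->] := res_surj t; have [z ->] := res_surj u.
by rewrite -[+%R]/radd !(raddE, rmulE) cmpDl.
Qed.
Lemma rmulDr : right_distributive rmul +%R.
Proof.
move=> s t u; have [x ->] := res_surj s; have [y ->] := res_surj t; have [z ->] := res_surj u.
by rewrite -[+%R]/radd !(raddE, rmulE) cmpDr.
Qed.
Lemma rone_nz : res (id_ M) != 0.
Proof. by apply/eqP => /res_eqP; rewrite subr0; apply; exact: isiso_id. Qed.
HB.instance Definition _ :=
  GRing.Zmodule_isNzRing.Build residue rmulA rmul1 rmulr1 rmulDl rmulDr rone_nz.

Lemma resD x y : res (x + y) = res x + res y. Proof. exact/esym/raddE. Qed.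
Lemma resN x : res (- x) = - res x. Proof. exact/esym/roppE. Qed.
Lemma resM x y : res (x ∘ y) = res x * res y. Proof. exact/esym/rmulE. Qed.
Lemma res1 : res (id_ M) = 1. Proof. by []. Qed.
Lemma res0 : res 0 = 0. Proof. by []. Qed.
Lemma res_eq0 x : res x = 0 <-> ~ isiso x.
Proof. by rewrite -res0 res_eqP subr0. Qed.

(** The clause for 0 fixes the default value: the inverse must be the identity on nonunits. *)
Lemma res_inv_ex (t : residue) :
  exists u, (t != 0 -> u * t = 1 /\ t * u = 1) /\ (t = 0 -> u = 0).
Proof.
have [->|t0] := eqVneq t 0; first by exists 0.
have [x tx] := res_surj t; rewrite tx in t0 *.
have [y [yx xy]] : isiso x by apply: contrapT => /res_eq0/eqP; apply/negP.
exists (res y); rewrite -!resM yx xy; split=> // /eqP; rewrite (negPf t0) //.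
Qed.

Definition rinv (t : residue) := projT1 (cid (res_inv_ex t)).
Lemma rmulV : {in [pred t : residue | t != 0], left_inverse 1 rinv *%R}.
Proof. by move=> t t0; rewrite /rinv; case: cid => u /= [] /(_ t0) []. Qed.
Lemma rdivr : {in [pred t : residue | t != 0], right_inverse 1 rinv *%R}.
Proof. by move=> t t0; rewrite /rinv; case: cid => u /= [] /(_ t0) []. Qed.
Lemma runitP (s t : residue) : t * s = 1 /\ s * t = 1 -> s \in [pred t : residue | t != 0].
Proof.
by case=> + _; rewrite inE; apply: contra_eqN => /eqP ->; rewrite mulr0 eq_sym oner_neq0.
Qed.
Lemma rinv_out : {in [predC [pred t : residue | t != 0]], rinv =1 id}.
Proof. by move=> t; rewrite !inE negbK /rinv => /eqP ->; case: cid => u /= [_ ->]. Qed.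
HB.instance Definition _ :=
  GRing.NzRing_hasMulInverse.Build residue rmulV rdivr runitP rinv_out.

Lemma residue_unit (t : residue) : t != 0 -> t \is a GRing.unit.
Proof. by []. Qed.

End Residue.

Section ResidueInvolution.
Variables (H : hcat) (S : sob H) (iS : indec S).
Notation T := (residue iS).

Definition rstar (t : T) : T := res iS (sadj (S := S) (T := S) (repr t)).

Lemma isiso_adjE (f : Hom S S) : isiso f^† <-> isiso f.
Proof. by split=> /isiso_adj; rewrite ?adjK. Qed.

Lemma rstarE (x : Hom S S) : rstar (res iS x) = res iS x^†.
Proof.
apply/res_eqP; rewrite -adjB isiso_adjE; apply/(res_eqP iS); exact: res_repr.
Qed.

Lemma rstarP : [/\ involutive rstar, forall s t, rstar (s + t) = rstar s + rstar t &
  forall s t, rstar (s * t) = rstar t * rstar s].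
Proof.
split=> [s|s t|s t]; have [x ->] := res_surj s.
- by rewrite !rstarE adjK.
- by have [y ->] := res_surj t; rewrite -resD !rstarE adjD resD.
by have [y ->] := res_surj t; rewrite -resM !rstarE adjM resM.
Qed.
End ResidueInvolution.

(** * Division algebras over real closed fields *)

Lemma rcf_poly_square (P : rcfType) (p : {poly P}) : p != 0 ->
  exists (c : P) (s : seq (P * P)), c != 0 /\
    p * p = c *: \prod_(z <- s) (('X - z.1%:P) ^+ 2 + (z.2 ^+ 2)%:P).
Proof.
move=> p0; pose f := real_complex P; pose q := map_poly f p.
have [r qr] := closed_field_poly_normal q.
have lq : lead_coef q = f (lead_coef p) by rewrite lead_coef_map.
have cq : map_poly (@conjc P) q = q.
  by rewrite -map_poly_comp; apply: eq_map_poly => x /=; rewrite /f /= oppr0.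
have cqr : q = lead_coef q *: \prod_(z <- r) ('X - (conjc z)%:P).
  rewrite -{1}cq {1}qr map_polyZ rmorph_prod lq /= oppr0; congr (_ *: _).
  by apply: eq_bigr => z _; rewrite rmorphB /= map_polyX map_polyC.
exists (lead_coef p ^+ 2), [seq (complex.Re z, complex.Im z) | z <- r]; split.
  by rewrite expf_neq0 // lead_coef_eq0.
apply: (map_poly_inj f); rewrite rmorphM /= -/q map_polyZ rmorph_prod /= big_map.
rewrite [X in X * _]qr [X in _ * X]cqr lq.
rewrite -scalerAl -scalerAr scalerA.
have -> : (lead_coef p ^+ 2)%:C%C = f (lead_coef p) * f (lead_coef p) by rewrite rmorphXn.
congr (_ *: _).
rewrite -big_split; apply: eq_bigr => -[a b] _ /=.
rewrite rmorphD rmorphXn rmorphB /= map_polyX !map_polyC /=.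
have -> : (a +i* b)%C = f a + 'i%C * f b by rewrite /f /=; simpc.
have -> : (a -i* b)%C = f a - 'i%C * f b by rewrite /f /=; simpc.
have i2 : ('i%C : P[i]%C) * 'i%C = -1 by rewrite -expr2 sqr_i.
rewrite polyCD polyCB polyCM.
have i2' : ('i%C : P[i]%C)%:P * 'i%C%:P = -1 by rewrite -polyCM i2 polyCN.
rewrite rmorphXn /= polyC_exp.
move: i2'; move: ('i%C%:P) (f a)%:P (f b)%:P => j x y j2.
have -> : ('X - (x + j * y)) * ('X - (x - j * y)) = ('X - x) ^+ 2 - (j * j) * y ^+ 2 by ring.
by rewrite j2; ring.
Qed.

Section Division.
Variable T : unitRingType.
Hypothesis divT : forall x : T, x != 0 -> x \is a GRing.unit.

Lemma div_mul_eq0 (x y : T) : x * y = 0 -> x = 0 \/ y = 0.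
Proof.
move=> xy; have [->|/divT ux] := eqVneq x 0; [by left|right].
by rewrite -(mulKr ux y) xy mulr0.
Qed.

Lemma comm_sqr_eq (x y : T) : GRing.comm x y -> x * x = y * y -> x = y \/ x = - y.
Proof.
move=> c e; have : (x - y) * (x + y) = 0.
  by rewrite mulrBl !mulrDr e c [y * x + _]addrC subrr.
case/div_mul_eq0 => h; [left|right]; first by apply/eqP; rewrite -subr_eq0 h.
by apply/eqP; rewrite -addr_eq0 h.
Qed.
End Division.

Section RealDivision.
Variables (P : rcfType) (T : unitRingType) (io : {rmorphism P -> T}).
Hypothesis divT : forall x : T, x != 0 -> x \is a GRing.unit.
Hypothesis cen : forall a t, io a * t = t * io a.
Hypothesis alg : forall t, exists p : {poly P}, p != 0 /\ (map_poly io p).[t] = 0.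

Lemma io_inj a : io a = 0 -> a = 0.
Proof.
move=> h; apply/eqP; apply: contraT => a0.
by have := rmorph1 io; rewrite -(mulfV a0) rmorphM h mul0r => /esym/eqP; rewrite oner_eq0.
Qed.

(** Evaluate the factorization of p * p at t, for p vanishing at t: there are no zero divisors, so
    one of the quadratic factors vanishes. *)
Lemma div_quadratic t : exists a b, (t - io a) * (t - io a) = - io (b ^+ 2).
Proof.
have [p [p0 pt]] := alg t; have [c [s [c0 ps]]] := rcf_poly_square p0.
have ct : commr_rmorph io t by move=> a; rewrite /GRing.comm cen.
pose ev : {rmorphism {poly P} -> T} := horner_morph ct.
have : ev (\prod_(z <- s) (('X - z.1%:P) ^+ 2 + (z.2 ^+ 2)%:P)) = 0.
  have : ev (p * p) = 0 by rewrite rmorphM /= /ev /= /horner_morph pt mul0r.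
  rewrite ps -mul_polyC rmorphM /= horner_morphC => /(div_mul_eq0 divT) [/io_inj|//].
  by move/eqP: c0.
rewrite rmorph_prod; elim: s {ps} => [|[a b] s IH].
  by rewrite big_nil => /eqP; rewrite oner_eq0.
rewrite big_cons => /(div_mul_eq0 divT) [|//] /=.
rewrite rmorphD rmorphXn rmorphB /= horner_morphX !horner_morphC => h.
by exists a, b; rewrite -expr2; apply/eqP; rewrite -addr_eq0 h.
Qed.

Lemma cplx_mul j a b c d : j * j = -1 ->
  (io a + io b * j) * (io c + io d * j) = io (a * c - b * d) + io (a * d + b * c) * j.
Proof.
move=> jj; rewrite mulrDl !mulrDr rmorphB rmorphD mulrDl !rmorphM.
have -> : io b * j * io c = io b * io c * j by rewrite -mulrA -cen mulrA.
have -> : io b * j * (io d * j) = - (io b * io d).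
  by rewrite mulrA -(mulrA (io b)) -cen mulrA -mulrA jj mulrN1.
by rewrite !mulrA [X in _ + X = _]addrC addrACA.
Qed.

Definition scalar t := exists a, t = io a.

Lemma sqr_scalar t c : t * t = io (c ^+ 2) -> t = io c \/ t = - io c.
Proof. by rewrite rmorphXn; apply: comm_sqr_eq => //; rewrite /GRing.comm cen. Qed.

Lemma sqr_nonneg t c : 0 <= c -> t * t = io c -> scalar t.
Proof.
move=> c0 tc; have [] := @sqr_scalar t (Num.sqrt c); first by rewrite sqr_sqrtr.
  by move=> ->; eexists.
by move=> ->; exists (- Num.sqrt c); rewrite rmorphN.
Qed.

Lemma scalar_sqrN1 t : t * t = -1 -> ~ scalar t.
Proof.
move=> h [a ta]; have : io (a * a + 1) = 0 by rewrite rmorphD rmorphM rmorph1 -ta h addNr.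
by move/io_inj/eqP; rewrite -expr2 gt_eqF // ltr_wpDl // sqr_ge0.
Qed.

Variable st : T -> T.
Hypothesis stK : involutive st.
Hypothesis stD : forall x y, st (x + y) = st x + st y.
Hypothesis stM : forall x y, st (x * y) = st y * st x.
Hypothesis st_io : forall a, st (io a) = io a.

Lemma stN x : st (- x) = - st x.
Proof.
have s0 : st 0 = 0 by apply: (addrI (st 0)); rewrite -stD !addr0.
by apply: (addrI (st x)); rewrite -stD !subrr.
Qed.
Lemma st1 : st 1 = 1. Proof. by rewrite -(rmorph1 io) st_io. Qed.

Section Positive.
Hypothesis sym_scalar : forall t, st t = t -> scalar t.

(** If c < 0, rescale x to y with st y * y = -1. The trace r = y + st y is scalar, so y^2 = r y + 1,
    which has positive discriminant; hence y is scalar, st y = y, and y^2 = -1 contradicts the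
    ordering of P. *)
Lemma norm_nonneg x : exists2 c, 0 <= c & st x * x = io c.
Proof.
have [c xc] : scalar (st x * x) by apply: sym_scalar; rewrite stM stK.
exists c => //; rewrite leNgt; apply/negP => c0.
pose d := Num.sqrt (- c).
have d0 : d != 0 by rewrite sqrtr_eq0 -ltNge oppr_gt0.
pose y := x * io d^-1.
have yy : st y * y = -1.
  rewrite /y stM st_io mulrA -(mulrA (io _)) xc -rmorphM -rmorphM -(rmorphN1 io); congr (io _).
  have dd : d * d = - c by rewrite -expr2 sqr_sqrtr // oppr_ge0 ltW.
  have -> : c = - (d * d) by rewrite dd opprK.
  by field.
have [r yr] : scalar (y + st y) by apply: sym_scalar; rewrite stD stK addrC.
have sy : st y = io r - y by rewrite -yr addrC addKr.
have [a] : scalar (y - io (r / 2)).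
  apply: (@sqr_nonneg _ ((r / 2) ^+ 2 + 1)); first by rewrite addr_ge0 // sqr_ge0.
  have y2 : y * y = io r * y + 1.
    by move: yy; rewrite sy mulrBl => /eqP; rewrite subr_eq addrC -subr_eq opprK => /eqP <-.
  have -> : io ((r / 2) ^+ 2 + 1) = io (r / 2) * io (r / 2) + 1.
    by rewrite rmorphD rmorph1 rmorphXn expr2.
  rewrite mulrBl !mulrBr y2 -(cen (r / 2) y).
  have -> : io r * y = io (r / 2) * y + io (r / 2) * y.
    by rewrite -mulrDl -rmorphD; congr (io _ * y); field.
  by rewrite [X in X - _]addrAC addrK opprB [LHS]addrC subrKA.
move=> ya; have [e ye] : scalar y by exists (a + r / 2); rewrite rmorphD -ya subrK.
have := yy; rewrite {1}ye st_io -{1}ye => h; apply: (scalar_sqrN1 h).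
by exists e.
Qed.

Lemma no_neg_norm_sum (zs : seq T) : 1 + \sum_(z <- zs) st z * z <> 0.
Proof.
suff [c c0 ->] : exists2 c, 0 <= c & \sum_(z <- zs) st z * z = io c.
  by rewrite -(rmorph1 io) -rmorphD => /io_inj/eqP; rewrite gt_eqF // ltr_pwDl.
elim: zs => [|z zs [c c0 IH]]; first by exists 0; rewrite ?big_nil ?rmorph0.
have [d d0 zd] := norm_nonneg z.
by exists (d + c); rewrite ?addr_ge0 // big_cons zd IH rmorphD.
Qed.

Lemma sym_pm_one a : st a = a -> a != 0 -> exists x, st x * a * x = 1 \/ st x * a * x = -1.
Proof.
move=> /sym_scalar [c ->] c0; have {}c0 : c != 0 by apply: contraNneq c0 => ->; rewrite rmorph0.
exists (io (Num.sqrt `|c|)^-1); rewrite st_io -!rmorphM.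
have s0 : Num.sqrt `|c| != 0 by rewrite sqrtr_eq0 -ltNge normr_gt0.
have ss : Num.sqrt `|c| * Num.sqrt `|c| = `|c| by rewrite -expr2 sqr_sqrtr.
have [c1|c1] := lerP 0 c; [left|right].
  rewrite ger0_norm // in s0 ss *; rewrite -(rmorph1 io); congr (io _).
  by rewrite -{2}ss; field.
rewrite ltr0_norm // in s0 ss *; rewrite -(rmorphN1 io); congr (io _).
have {2}-> : c = - (Num.sqrt (- c) * Num.sqrt (- c)) by rewrite ss opprK.
by field.
Qed.
End Positive.

Lemma sym_imaginary t : st t = t -> ~ scalar t ->
  exists a b j, [/\ b != 0, t = io a + io b * j, st j = j & j * j = -1].
Proof.
move=> s n; have [a [b e]] := div_quadratic t.
have b0 : b != 0.
  apply/eqP => b0; apply: n; exists a; move: e; rewrite b0 expr0n /= rmorph0 oppr0.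
  by case/(div_mul_eq0 divT) => /eqP; rewrite subr_eq0 => /eqP.
exists a, b, (io b^-1 * (t - io a)); split=> //.
- by rewrite mulrA -rmorphM mulfV // rmorph1 mul1r addrC subrK.
- by rewrite stM st_io stD stN st_io s cen.
rewrite mulrA -(mulrA (io _)) -cen mulrA -rmorphM -mulrA e mulrN -rmorphM -(rmorphN1 io) -rmorphN.
by congr (io _); field.
Qed.

Section Imaginary.
Variable i : T.
Hypothesis si : st i = i.
Hypothesis ii : i * i = -1.

Lemma complex_sqrt (a b : P) : b != 0 -> exists x y, x ^+ 2 - y ^+ 2 = a /\ 2 * x * y = b.
Proof.
(* With m the modulus of a + b i, the real part of the root squares to (m + a) / 2, which is
   positive because b is nonzero. *)
move=> b0; pose m := Num.sqrt (a ^+ 2 + b ^+ 2); pose w := (m + a) / 2.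
have mm : m ^+ 2 = a ^+ 2 + b ^+ 2 by rewrite sqr_sqrtr // addr_ge0 ?sqr_ge0.
have b2 : 0 < b ^+ 2 by rewrite exprn_even_gt0.
have m0 : 0 <= m by exact: sqrtr_ge0.
have w0 : 0 < w.
  rewrite /w; apply: divr_gt0 => //; rewrite ltNge; apply/negP => le; nra.
pose x := Num.sqrt w; have xx : x ^+ 2 = w by rewrite sqr_sqrtr // ltW.
have x0 : x != 0 by rewrite sqrtr_eq0 -ltNge.
exists x, (b / (2 * x)); split; last by field.
have -> : (b / (2 * x)) ^+ 2 = b ^+ 2 / (4 * w) by rewrite -xx; field.
have -> : b ^+ 2 = m ^+ 2 - a ^+ 2 by rewrite mm addrC addKr.
have -> : m ^+ 2 - a ^+ 2 = (m - a) * (2 * w) by rewrite /w; field.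
rewrite xx; have w1 : w != 0 by rewrite gt_eqF.
have -> : (m - a) * (2 * w) / (4 * w) = (m - a) / 2 by field.
by rewrite /w; field.
Qed.

(** A negative scalar c is the square of sqrt (-c) i. A nonscalar symmetric element lies in a copy
    P(j) of the complex numbers, with j symmetric, where square roots exist. *)
Lemma sym_square a : st a = a -> exists y, st y = y /\ y * y = a.
Proof.
move=> sa; have [[c ->]|n] := pselect (scalar a).
  have [c0|c0] := lerP 0 c.
    by exists (io (Num.sqrt c)); rewrite st_io -rmorphM -expr2 sqr_sqrtr.
  exists (io (Num.sqrt (- c)) * i); split; first by rewrite stM st_io si cen.
  rewrite mulrA -(mulrA (io _)) -cen mulrA -rmorphM -mulrA ii mulrN1 -rmorphN -expr2 sqr_sqrtr ?opprK //.
  by rewrite oppr_ge0 ltW.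
have [r [b [j [b0 -> sj jj]]]] := sym_imaginary sa n.
have [x [y [<- <-]]] := complex_sqrt r b0.
exists (io x + io y * j); split; first by rewrite stD stM !st_io sj cen.
by rewrite cplx_mul // -!expr2; congr (io _ + io _ * _); ring.
Qed.

Lemma sym_one a : st a = a -> a != 0 -> exists x, st x * a * x = 1.
Proof.
move=> sa a0; have [y [sy ya]] := sym_square sa.
have y0 : y != 0 by apply: contraNneq a0 => y0; rewrite -ya y0 mul0r.
have uy := divT y0; exists y^-1.
have -> : st y^-1 = y^-1.
  by apply: (mulIr uy); rewrite mulVr // -{2}sy -stM mulrV // st1.
by rewrite -ya mulKr // mulrV.
Qed.

End Imaginary.

Section Frobenius.
Variable i : T.
Hypothesis ii : i * i = -1.

(** For suitable scalars a and b, t - a and b i have the same square -b^2 and commute; in a skew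
    field they agree up to sign. *)
Lemma comm_imaginary t : GRing.comm t i -> exists a b, t = io a + io b * i.
Proof.
move=> c; have [a [b e]] := div_quadratic t.
have cb : GRing.comm (t - io a) (io b * i).
  by apply: commrM; [rewrite /GRing.comm cen|apply/commr_sym/commrB; [exact/commr_sym|rewrite /GRing.comm cen]].
have [] := comm_sqr_eq divT cb.
- by rewrite e mulrA -(mulrA (io b)) -cen mulrA -mulrA ii mulrN1 -rmorphM -expr2.
- by move=> h; exists a, b; rewrite -h addrC subrK.
by move=> h; exists a, (- b); rewrite rmorphN mulNr -h addrC subrK.
Qed.

Lemma add_self_eq0 (t : T) : t + t = 0 -> t = 0.
Proof.
have e : t + t = io 2 * t by rewrite -[2]/(1 + 1) rmorphD rmorph1 mulrDl mul1r.
by rewrite e => /(div_mul_eq0 divT) [/io_inj/eqP|//]; rewrite pnatr_eq0.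
Qed.

(** The square of u commutes with i, so u^2 = a + b i; as u commutes with u^2 but anticommutes with
    i, b = 0. Then a < 0, for otherwise u would be scalar and commute with i. Dividing u by sqrt
    (-a) gives j. *)
Lemma anticomm_unit (u : T) : u != 0 -> u * i = - (i * u) ->
  exists j, [/\ j * j = -1, i * j = - (j * i) & j != 0].
Proof.
move=> u0 ui; have cu2 : GRing.comm (u * u) i.
  by rewrite /GRing.comm -mulrA ui mulrN [u * (i * u)]mulrA ui mulNr opprK -mulrA.
have [a [b u2]] := comm_imaginary cu2.
have i0 : i != 0 by apply/eqP => i0; move/eqP: ii; rewrite i0 mul0r eq_sym oppr_eq0 oner_eq0.
have ui0 : u * i <> 0 by case/(div_mul_eq0 divT) => /eqP; apply/negP.
have b0 : b = 0.
  have : io b * (u * i) + io b * (u * i) = 0.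
    have : u * (u * u) = u * u * u by rewrite mulrA.
    rewrite u2 mulrDr mulrDl -cen => /addrI.
    by rewrite mulrA -cen -mulrA => h; rewrite {1}h -mulrA ui mulrN addrN.
  by move/add_self_eq0/(div_mul_eq0 divT) => [/io_inj|].
move: u2; rewrite b0 rmorph0 mul0r addr0 => u2.
have a0 : a < 0.
  rewrite ltNge; apply/negP => /sqr_nonneg/(_ u2) [c uc]; apply: ui0.
  by apply: add_self_eq0; rewrite {2}ui uc cen subrr.
pose d := Num.sqrt (- a).
have d0 : d != 0 by rewrite sqrtr_eq0 -ltNge oppr_gt0.
have dd : d ^+ 2 = - a by rewrite sqr_sqrtr // oppr_ge0 ltW.
exists (io d^-1 * u); split.
- rewrite mulrA -(mulrA (io _)) -cen mulrA -rmorphM -mulrA u2 -rmorphM -(rmorphN1 io).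
  have -> : a = - d ^+ 2 by rewrite dd opprK.
  by congr (io _); field.
- by rewrite mulrA -cen -!mulrA ui mulrN opprK.
apply/eqP => /(div_mul_eq0 divT) [/io_inj/eqP|/eqP]; last exact/negP.
by rewrite invr_eq0 (negPf d0).
Qed.

Lemma frobenius : (forall t, exists a b, t = io a + io b * i) \/
  exists j, [/\ j * j = -1, i * j = - (j * i),
    forall t, exists a b c d, t = io a + io b * i + io c * j + io d * (i * j)
    & forall a b c d, io a + io b * i + io c * j + io d * (i * j) = 0 ->
        [/\ a = 0, b = 0, c = 0 & d = 0]].
Proof.
have [h|/existsNP [t nt]] := pselect (forall t, GRing.comm t i).
  by left=> t; apply: comm_imaginary.
(* A commutator with i anticommutes with i, because i^2 is central. *)
right; pose u := t * i - i * t.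
have u0 : u != 0 by rewrite subr_eq0; apply/eqP.
have ui : u * i = - (i * u).
  rewrite /u mulrBl mulrBr -!mulrA ii mulrN1 [i * (i * t)]mulrA ii mulN1r opprK opprD.
  by rewrite addrC.
have [j [jj ij j0]] := anticomm_unit u0 ui.
exists j; split=> // [x|a b c d].
  (* The parts of 2 x that anticommute and commute with i. Since v j commutes with i, both parts are
     governed by the centralizer P(i). *)
  pose v := x + i * x * i; pose w := x - i * x * i.
  have cw : GRing.comm w i.
    rewrite /GRing.comm /w mulrBl -(mulrA (i * x)) ii mulrN1 opprK addrC.
    by rewrite mulrBr !mulrA ii mulN1r mulNr opprK.
  have vi : v * i = - (i * v).
    rewrite /v mulrDl -(mulrA (i * x)) ii mulrN1.
    by rewrite mulrDr !mulrA ii mulN1r mulNr opprB.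
  have [a [b wab]] := comm_imaginary cw.
  have [c [d vj]] : exists c d, v * j = io c + io d * i.
    apply: comm_imaginary; have ji : j * i = - (i * j) by rewrite ij opprK.
    by rewrite /GRing.comm -mulrA ji mulrN [v * (i * j)]mulrA vi mulNr opprK -mulrA.
  have vE : v = io (- c) * j + io (- d) * (i * j).
    have : v * j * j = - v by rewrite -mulrA jj mulrN1.
    rewrite vj mulrDl => e; rewrite -[LHS]opprK -e !rmorphN !mulNr opprD mulrA //.
  have xx : x + x = w + v by rewrite /w /v addrACA addNr addr0.
  have [h half] : exists h : P, forall y, io h * (y + y) = y.
    exists (1 / 2) => y.
    rewrite mulrDr -mulrDl -rmorphD -[RHS]mul1r -(rmorph1 io); congr (io _ * _).
    by field.
  exists (h * a), (h * b), (h * - c), (h * - d).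
  by rewrite !rmorphM -[LHS]half xx wab vE !mulrDr !mulrA !addrA.
set x := _ + _ * i => e0.
pose y := io c * j + io d * (i * j).
have xy : x + y = 0 by rewrite /y addrA.
have cx : x * i = i * x by rewrite /x mulrDl mulrDr -(cen a) [i * (_ * _)]mulrA -(cen b).
have ay : y * i = - (i * y).
  have ji : j * i = - (i * j) by rewrite ij opprK.
  rewrite /y mulrDl mulrDr -!mulrA ji [i * (io c * _)]mulrA -cen -mulrA mulrN.
  by rewrite [i * (io d * _)]mulrA -(cen d) -mulrA !mulrN opprD.
have xN : x = - y by apply/eqP; rewrite -addr_eq0 xy.
have iy0 : i * y + i * y = 0.
  by apply/eqP; move: cx; rewrite xN mulNr ay opprK mulrN => /eqP; rewrite -addr_eq0.
have i0 : i != 0 by apply/eqP => i0; move/eqP: ii; rewrite i0 mul0r eq_sym oppr_eq0 oner_eq0.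
have y0 : y = 0.
  by case: (div_mul_eq0 divT (add_self_eq0 iy0)) => // /eqP; rewrite (negPf i0).
have indep p q : io p + io q * i = 0 -> p = 0 /\ q = 0.
  move=> h; have q0 : q = 0.
    apply/eqP; apply: contraT => q0; case: (scalar_sqrN1 ii).
    exists (- p / q); rewrite mulrC rmorphM rmorphN.
    have -> : - io p = io q * i by apply/eqP; rewrite eq_sym -addr_eq0 addrC h.
    by rewrite mulrA -rmorphM mulVf // rmorph1 mul1r.
  by move: h; rewrite q0 rmorph0 mul0r addr0 => /io_inj.
have [-> ->] : a = 0 /\ b = 0 by apply: indep; rewrite -/x xN y0 oppr0.
have [-> ->] // : c = 0 /\ d = 0.
apply: indep; have : (io c + io d * i) * j = 0 by rewrite mulrDl -mulrA.
by case/(div_mul_eq0 divT) => // /eqP; rewrite (negPf j0).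
Qed.

Lemma complex_closed : (forall t, exists a b, t = io a + io b * i) ->
  forall n (c : nat -> T), exists x, x ^+ n.+1 + \sum_(k < n.+1) c k * x ^+ k = 0.
Proof.
move=> gen n c.
pose ph (z : P[i]%C) : T := io (complex.Re z) + io (complex.Im z) * i.
have phD z w : ph (z + w) = ph z + ph w.
  by case: z w => [a b] [a' b']; rewrite /ph /= !rmorphD mulrDl addrACA.
have phM z w : ph (z * w) = ph z * ph w.
  by case: z w => [a b] [a' b']; rewrite /ph /= cplx_mul.
have ph1 : ph 1 = 1 by rewrite /ph /= rmorph0 mul0r addr0 rmorph1.
have phX z k : ph (z ^+ k) = ph z ^+ k.
  by elim: k => [|k IH]; rewrite ?expr0 // !exprS phM IH.
have ph0 : ph 0 = 0 by rewrite /ph /= rmorph0 mul0r addr0.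
have phsurj t : exists z, t = ph z.
  by have [a [b ->]] := gen t; exists (a +i* b)%C.
have [d cd] := choice (fun k => phsurj (- c k)).
have [z ze] := @solve_monicpoly P[i]%C n.+1 d isT.
exists (ph z); rewrite -phX ze.
have -> : ph (\sum_(k < n.+1) d k * z ^+ k) = \sum_(k < n.+1) ph (d k * z ^+ k).
  by apply: (big_morph ph).
by rewrite -big_split big1 // => k _; rewrite phM phX -cd mulNr /= addNr.
Qed.
End Frobenius.

(** A nonscalar symmetric element yields a symmetric i with i^2 = -1. By Frobenius, T is P(i),
    algebraically closed with identity involution, or a quaternion algebra whose involution fixes i
    and so is not standard. Conversely, if symmetric elements are scalar, the involution sends each
    root of -1 to its negative. *)
Lemma sym_scalarP : (forall t, st t = t -> scalar t) <->
  ~ ([/\ forall t, st t = t, forall s t : T, s * t = t * s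
      & forall n (c : nat -> T), exists x, x ^+ n.+1 + \sum_(k < n.+1) c k * x ^+ k = 0] \/
    exists i j : T,
      [/\ i * i = -1, j * j = -1, i * j = - (j * i),
        forall t, exists a b c d, t = io a + io b * i + io c * j + io d * (i * j) &
        (forall a b c d, io a + io b * i + io c * j + io d * (i * j) = 0 ->
          [/\ a = 0, b = 0, c = 0 & d = 0]) /\
        ~ (st i = - i /\ st j = - j)]).
Proof.
(* These coefficients give the polynomial x^2 + 1, whose root is symmetric but not scalar. *)
split=> [sc [[sid _ /(_ 1 (fun k => (k == 0)%:R)) [x]]|[i [j [ii jj _ _ [_ ns]]]]]|nq t s].
- rewrite !big_ord_recl big_ord0 /= mul1r mul0r !addr0 expr0 expr2 => /eqP; rewrite addr_eq0.
  by move/eqP => xx; apply: (scalar_sqrN1 xx); apply: sc; exact: sid.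
- have skew x : x * x = -1 -> st x = - x.
    move=> xx; have [r xr] : scalar (x + st x) by apply: sc; rewrite stD stK addrC.
    have cx : GRing.comm (st x) x.
      by rewrite /GRing.comm -[st x](addKr x) xr mulrDl mulrDr cen mulNr mulrN.
    have [||//] := comm_sqr_eq divT cx; first by rewrite -stM xx stN st1.
    by move=> sx; case: (scalar_sqrN1 xx); apply: sc.
  by apply: ns; split; apply: skew.
apply: contrapT => nsc; apply: nq.
have [_ [_ [i [_ _ si ii]]]] := sym_imaginary s nsc.
have [gen|[j [jj ij gen ind]]] := frobenius ii; last first.
  right; exists i, j; split=> //; split=> // -[].
  rewrite si => /eqP; rewrite -addr_eq0 => /eqP /add_self_eq0 i0.
  by move/eqP: ii; rewrite i0 mul0r eq_sym oppr_eq0 oner_eq0.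
left; split; last exact: (complex_closed ii gen).
  by move=> x; have [a [b ->]] := gen x; rewrite stD stM !st_io si cen.
move=> x y; have [a [b ->]] := gen x; have [c [d ->]] := gen y.
by rewrite !cplx_mul //; congr (io _ + io _ * _); ring.
Qed.
End RealDivision.

(** * Finite division rings *)

Section FiniteDivision.
Variable T : finUnitRingType.
Hypothesis divT : forall x : T, x != 0 -> x \is a GRing.unit.

Lemma fin_div_comm (x y : T) : x * y = y * x.
Proof.
apply: finDomain_mulrC => {}x {}y xy.
by case: (div_mul_eq0 divT xy) => ->; rewrite eqxx ?orbT.
Qed.

Variable A : {set T}.
Hypothesis A0 : 0 \in A.

(* Squaring is at most two to one on A, and one to one over 0. *)
Lemma card_squares : (#|A| < (#|[set (x * x)%R | x in A]|).*2)%N.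
Proof.
set Q := [set x * x | x in A].
have Q0 : 0 \in Q by apply/imsetP; exists 0; rewrite ?mulr0.
have -> : #|A| = (\sum_(s in Q) #|[set x in A | (x * x == s)%R]|)%N.
  rewrite -sum1_card (partition_big (fun x => x * x) (mem Q)) /=.
    by apply: eq_bigr => s _; rewrite -sum1_card; apply: eq_bigl => x; rewrite inE.
  by move=> x xA; apply/imsetP; exists x.
rewrite (bigD1 0) //=.
have -> : [set x in A | x * x == 0] = [set 0].
  apply/setP => x; rewrite !inE; apply/andP/eqP => [[_ /eqP /(div_mul_eq0 divT) []]|->] //.
  by rewrite mulr0 eqxx.
rewrite cards1 [X in (_ < X.*2)%N](cardsD1 0 Q) Q0 /= !add1n doubleS !ltnS -muln2.
apply: leq_trans (_ : \sum_(s in Q :\ 0%R) 2 <= _)%N; last by rewrite sum_nat_const.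
rewrite [X in (X <= _)%N](eq_bigl (fun s => s \in Q :\ 0%R)); last by move=> s; rewrite !inE andbC.
apply: leq_sum => s; rewrite !inE => /andP [_ /imsetP [y yA ->]].
apply: leq_trans (_ : #|[set y; - y]| <= 2)%N; last by rewrite cards2; case: (_ != _).
apply: subset_leq_card; apply/subsetP => x; rewrite !inE => /andP [_ /eqP e].
by case: (comm_sqr_eq divT (fin_div_comm x y) e) => ->; rewrite eqxx ?orbT.
Qed.

Hypothesis AB : forall x y, x \in A -> y \in A -> x - y \in A.
Hypothesis AM : forall x y, x \in A -> y \in A -> x * y \in A.

(** The squares Q and the set a - d Q each fill more than half of A, so they meet. A serves both as
    T and as the set of fixed elements of an involution. *)
Lemma sum_two_squares a d : a \in A -> d \in A -> d != 0 ->
  exists x y, [/\ x \in A, y \in A & a = x * x + d * (y * y)].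
Proof.
move=> aA dA d0; set Q := [set x * x | x in A]; set Q' := [set a - d * s | s in Q].
have QA : Q \subset A by apply/subsetP => _ /imsetP [x xA ->]; apply: AM.
have QA' : Q' \subset A.
  by apply/subsetP => _ /imsetP [s /(subsetP QA) sA ->]; apply: AB => //; apply: AM.
have cQ' : #|Q'| = #|Q|.
  apply: card_imset => s s' /addrI /oppr_inj e.
  by rewrite -(mulKr (divT d0) s) e mulKr // divT.
have [|/card_gt0P [z]] := posnP #|Q :&: Q'|.
  move/eqP; rewrite cards_eq0 setI_eq0 => dis.
  have := card_squares; rewrite -/Q -addnn -{2}cQ'.
  have /eqP <- : #|Q :|: Q'| == (#|Q| + #|Q'|)%N by rewrite (leq_card_setU Q Q').2.
  by rewrite ltnNge subset_leq_card // subUset QA.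
rewrite inE => /andP [/imsetP [x xA ->] /imsetP [_ /imsetP [y yA ->] e]].
by exists x, y; rewrite e subrK.
Qed.

(** The products of a with nonzero squares are not squares, as a is none; counting shows that they
    and the squares exhaust A, so the nonsquare t is among them. *)
Lemma nonsquare_class a t : a \in A -> t \in A -> a != 0 -> t != 0 ->
  (forall x, x \in A -> x \is a GRing.unit -> x^-1 \in A) ->
  (forall s, s \in A -> s * s <> a) -> (forall s, s \in A -> s * s <> t) ->
  exists x, x \in A /\ x * a * x = t.
Proof.
move=> aA tA a0 t0 AV na nt; set Q := [set x * x | x in A].
have QA : Q \subset A by apply/subsetP => _ /imsetP [x xA ->]; apply: AM.
have Q0 : 0 \in Q by apply/imsetP; exists 0; rewrite ?mulr0.
set Q' := [set a * s | s in Q :\ 0].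
have cQ' : #|Q'| = #|Q :\ 0|.
  by apply: card_imset => s s' e; rewrite -(mulKr (divT a0) s) e mulKr // divT.
have dis : [disjoint Q & Q'].
  apply/pred0P => z /=; apply/andP => -[/imsetP [x xA ->] /imsetP [s /setD1P [y0 /imsetP [y yA es]] e]].
  rewrite es in y0 e; have {}y0 : y != 0 by apply: contraNneq y0 => ->; rewrite mulr0.
  apply: (na (x * y^-1)); first by apply: AM => //; apply: AV => //; apply: divT.
  rewrite -mulrA (fin_div_comm y^-1) -mulrA -invrM ?divT // mulrA e mulrK //.
  by rewrite unitrMl ?divT.
have cov : Q :|: Q' = A.
  apply/eqP; rewrite eqEcard subUset QA /=; apply/andP; split.
    apply/subsetP => _ /imsetP [s /setD1P [_ /(subsetP QA) sA] ->]; exact: AM.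
  have /eqP -> : #|Q :|: Q'| == (#|Q| + #|Q'|)%N by rewrite (leq_card_setU Q Q').2.
  have := card_squares; rewrite -/Q cQ' (cardsD1 0 Q) Q0 /= add1n doubleS -addnn; move: #|A| #|Q :\ 0| => m k; lia.
have : t \in Q :|: Q' by rewrite cov.
rewrite inE => /orP [/imsetP [s sA e]|]; first by case: (nt s sA).
case/imsetP => s /setD1P [_ /imsetP [y yA ->]] ->; exists y; split=> //.
by rewrite [y * a]fin_div_comm mulrA.
Qed.

End FiniteDivision.

Section FiniteInvolution.
Variable T : finUnitRingType.
Hypothesis divT : forall x : T, x != 0 -> x \is a GRing.unit.
Let mulC := fin_div_comm divT.

(** The element dl = z - st z is skew, so for fixed x and y the norm of x + dl y is x^2 - dl^2 y^2.
    This is the form of [sum_two_squares] with d = -dl^2, and it represents a^-1 over the fixed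
    elements. *)
Lemma fin_norm_one (st : T -> T) (a : T) : involutive st ->
  (forall x y, st (x + y) = st x + st y) -> (forall x y, st (x * y) = st y * st x) ->
  (exists z, st z <> z) -> st a = a -> a != 0 -> exists x, st x * a * x = 1.
Proof.
move=> stK stD stM [z nz] sa a0.
have st0 : st 0 = 0 by apply: (addrI (st 0)); rewrite -stD !addr0.
have stN x : st (- x) = - st x by apply: (addrI (st x)); rewrite -stD !subrr.
pose A := [set x | st x == x]; pose dl := z - st z.
have dl0 : dl != 0 by rewrite subr_eq0 eq_sym; apply/eqP.
have sdl : st dl = - dl by rewrite /dl stD stN stK opprB addrC.
clearbody dl.
have st1 : st 1 = 1 by have := stM (st 1) 1; rewrite mulr1 stK mulr1.
have [||||||x [y [xA yA e]]] := @sum_two_squares T divT A _ _ _ a^-1 (- (dl * dl)).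
- by rewrite inE st0.
- by move=> x y; rewrite !inE stD stN => /eqP -> /eqP ->.
- by move=> x y; rewrite !inE stM => /eqP -> /eqP ->; rewrite mulC.
- have ua := divT a0; rewrite inE; apply/eqP/(mulIr ua).
  by rewrite mulVr // -{2}sa -stM mulrV.
- by rewrite inE stN stM sdl mulrNN.
- by rewrite oppr_eq0; apply/eqP => /(div_mul_eq0 divT) [] /eqP; apply/negP.
move: xA yA; rewrite !inE => /eqP sx /eqP sy.
pose w := x + dl * y; exists w.
have sw : st w = x - dl * y by rewrite /w stD stM sx sy sdl mulrN mulC.
have ww : st w * w = a^-1.
  rewrite e sw /w mulrBl !mulrDr (mulC (dl * y) x) opprD addrA addrK mulNr; congr (_ - _).
  by rewrite -!mulrA (mulrA y dl y) (mulC y dl) -mulrA.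
by rewrite -mulrA (mulC a) mulrA ww mulVr ?divT.
Qed.

Lemma fin_two_squares (t : T) : t != 0 -> exists p q, p * t * p + q * t * q = 1.
Proof.
move=> t0; have inT (x : T) : x \in [set: T] by rewrite inE.
have [p [q [_ _ e]]] := sum_two_squares divT (inT 0) (fun x y _ _ => inT (x - y))
  (fun x y _ _ => inT (x * y)) (inT t^-1) (inT 1) (oner_neq0 T).
exists p, q; rewrite !(mulC _ t) -!mulrA -mulrDr.
by move: e; rewrite mul1r => <-; rewrite mulrV ?divT.
Qed.

Lemma fin_square_class (a t : T) : a != 0 -> t != 0 -> (forall s, s * s <> t) ->
  exists x, x * a * x = 1 \/ x * a * x = t.
Proof.
move=> a0 t0 nt; have [[s sa]|na] := pselect (exists s, s * s = a).
  have s0 : s != 0 by apply: contraNneq a0 => s0; rewrite -sa s0 mulr0.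
  by exists s^-1; left; rewrite -sa mulKr ?divT // mulrV ?divT.
have inT (x : T) : x \in [set: T] by rewrite inE.
have [x [_ e]] := nonsquare_class divT (inT 0)
  (fun x y _ _ => inT (x * y)) (inT a) (inT t) a0 t0 (fun x _ _ => inT x^-1)
  (fun s _ e => na (ex_intro _ s e)) (fun s _ => nt s).
by exists x; right.
Qed.
End FiniteInvolution.

(** The finite structure is laid over the given ring, so that results on finite rings transfer to T
    by substitution. *)
Lemma finUnitRing_of_inj (T : unitRingType) (fT : finType) (f : T -> fT) : injective f ->
  exists T' : finUnitRingType, T = T' :> unitRingType.
Proof.
case: T f => s c f fI; set T0 := GRing.UnitRing.Pack c in f fI *.
pose h (y : fT) : option T0 := if pselect (exists x, f x = y) is left e then Some (projT1 (cid e)) else None.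
have fK : pcancel f h.
  move=> x; rewrite /h; case: pselect => [e|[]]; last by exists x.
  by case: cid => x' /= /fI ->.
pose cm := @PCanIsCountable fT (GRing.UnitRing.sort T0) f h fK.
pose U0 : countType := HB.pack (GRing.UnitRing.sort T0) cm.
pose fm := @PCanIsFinite U0 fT f h fK.
pose U : finUnitRingType := HB.pack (GRing.UnitRing.sort T0) (GRing.UnitRing.class T0) cm fm.
by exists U.
Qed.

(** * Rank over a division ring *)

Section RankNormalForm.
Variable K : unitRingType.
Hypothesis divK : forall x : K, x != 0 -> x \is a GRing.unit.

Definition mxinv n (U : 'M[K]_n) := exists U', U *m U' = 1%:M /\ U' *m U = 1%:M.
Definition mxequiv m n (M N : 'M[K]_(m, n)) := exists U V, [/\ mxinv U, mxinv V & M = U *m N *m V].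

Lemma mxinv1 n : mxinv (1%:M : 'M[K]_n). Proof. by exists 1%:M; rewrite mulmx1. Qed.
Lemma mxinvM n (U V : 'M[K]_n) : mxinv U -> mxinv V -> mxinv (U *m V).
Proof.
move=> [U' [u1 u2]] [V' [v1 v2]]; exists (V' *m U'); split.
  by rewrite mulmxA -(mulmxA U) v1 mulmx1.
by rewrite mulmxA -(mulmxA V') u2 mulmx1.
Qed.
Lemma mxequiv_trans m n (M N Q : 'M[K]_(m, n)) : mxequiv M N -> mxequiv N Q -> mxequiv M Q.
Proof.
move=> [U [V [iU iV ->]]] [U2 [V2 [iU2 iV2 ->]]]; exists (U *m U2), (V2 *m V).
by split; [exact: mxinvM|exact: mxinvM|rewrite !mulmxA].
Qed.

Lemma mxinv_tperm n (i j : 'I_n) : mxinv (tperm_mx i j : 'M[K]_n).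
Proof.
by exists (tperm_mx i j); rewrite /tperm_mx -perm_mxM tperm2 perm_mx1.
Qed.

Lemma mxequiv_block1 m n (S T : 'M[K]_(m, n)) : mxequiv S T ->
  mxequiv (block_mx (1%:M : 'M_1) 0 0 S) (block_mx (1%:M : 'M_1) 0 0 T).
Proof.
move=> [U [V [[U' [u1 u2]] [V' [v1 v2]] ->]]].
exists (block_mx (1%:M : 'M_1) 0 0 U), (block_mx (1%:M : 'M_1) 0 0 V); split.
- exists (block_mx (1%:M : 'M_1) 0 0 U').
  by rewrite !mulmx_block !mulmx0 !mul0mx !mulmx1 !addr0 !add0r u1 u2 -scalar_mx_block.
- exists (block_mx (1%:M : 'M_1) 0 0 V').
  by rewrite !mulmx_block !mulmx0 !mul0mx !mulmx1 !addr0 !add0r v1 v2 -scalar_mx_block.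
by rewrite !mulmx_block !mulmx0 !mul0mx !mulmx1 !addr0 !add0r mul0mx.
Qed.

(** One step of Gaussian elimination over a possibly noncommutative K; S is the Schur complement of
    the pivot. *)
Lemma mxequiv_pivot m n (M : 'M[K]_(1 + m, 1 + n)) : M 0 0 != 0 ->
  exists S, mxequiv M (block_mx (1%:M : 'M_1) 0 0 S).
Proof.
move=> M00; pose a := ulsubmx M; pose b := ursubmx M; pose c := dlsubmx M; pose d := drsubmx M.
have aE : a = (M 0 0)%:M.
  by rewrite [a]mx11_scalar /a !mxE; congr (M _ _)%:M; apply: val_inj.
pose ai : 'M[K]_1 := (M 0 0)^-1%:M.
have u := divK M00.
have a1 : a *m ai = 1%:M by rewrite aE -scalar_mxM mulrV.
have a2 : ai *m a = 1%:M by rewrite aE -scalar_mxM mulVr.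
exists (d - c *m ai *m b), (block_mx 1%:M 0 (c *m ai) 1%:M), (block_mx a b 0 1%:M); split.
- exists (block_mx 1%:M 0 (- (c *m ai)) 1%:M).
  by rewrite !mulmx_block !mulmx0 !mul0mx !mulmx1 ?mul1mx !addr0 !add0r addrN addNr -scalar_mx_block.
- exists (block_mx ai (- (ai *m b)) 0 1%:M).
  rewrite !mulmx_block !mulmx0 !mul0mx !mulmx1 ?mul1mx !addr0 !add0r mulmxN mulmxA a1 a2 mul1mx.
  by rewrite addrN addNr -scalar_mx_block.
rewrite !mulmx_block !mulmx0 !mul0mx !mulmx1 ?mul1mx !addr0 !add0r.
rewrite -mulmxA a2 mulmx1 addrC subrK !mul1mx; exact/esym/submxK.
Qed.

Lemma pid_mx_block1 m n r : block_mx (1%:M : 'M[K]_1) 0 0 (pid_mx r : 'M_(m, n)) = pid_mx r.+1.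
Proof.
apply/matrixP => i j; rewrite !mxE.
case: (split_ordP i) => i' ->; rewrite !mxE; case: (split_ordP j) => j' ->; rewrite !mxE ?ord1 //=.
Qed.

Lemma rank_normal m n (M : 'M[K]_(m, n)) :
  exists r, [/\ (r <= m)%N, (r <= n)%N & mxequiv M (pid_mx r)].
Proof.
elim: m n M => [|m IH] n M.
  by exists 0%N; split=> //; exists 1%:M, 1%:M; split; rewrite ?[M]flatmx0 ?[_ *m _]flatmx0 //; apply: mxinv1.
case: n M => [|n] M.
  by exists 0%N; split=> //; exists 1%:M, 1%:M; split; rewrite ?[M]thinmx0 ?[_ *m _]thinmx0 //; apply: mxinv1.
have [M0|] := eqVneq M 0.
  by exists 0%N; split=> //; exists 1%:M, 1%:M; rewrite pid_mx_0 mulmx0 mul0mx; split=> //; exact: mxinv1.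
case/matrix0Pn => i [j Mij].
pose M' := xrow i 0 (xcol j 0 M) : 'M_(1 + m, 1 + n).
have M'00 : M' 0 0 != 0 by rewrite !mxE !tpermR.
have MM' : mxequiv M M'.
  exists (tperm_mx i 0), (tperm_mx j 0); split; [exact: mxinv_tperm|exact: mxinv_tperm|].
  by rewrite /M' xrowE xcolE !mulmxA /tperm_mx -perm_mxM tperm2 perm_mx1 mul1mx -mulmxA -perm_mxM tperm2 perm_mx1 mulmx1.
have [S MS] := mxequiv_pivot M'00; have [r [rm rn Sr]] := IH n S.
exists r.+1; split=> //; apply: mxequiv_trans MM' (mxequiv_trans MS _).
by rewrite -pid_mx_block1; apply: mxequiv_block1.
Qed.

(** The one-sided inverses [P] and [Q] split L and R, and serve to restrict other maps to the image
    of M. *)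
Lemma rank_factor m n (M : 'M[K]_(m, n)) :
  exists r (L : 'M_(m, r)) (R : 'M_(r, n)) (P : 'M_(r, m)) (Q : 'M_(n, r)),
   [/\ (r <= m)%N, (r <= n)%N, P *m L = 1%:M, R *m Q = 1%:M & M = L *m R] /\
   (r = m -> r = n -> exists N : 'M_(n, m), N *m M = 1%:M /\ M *m N = 1%:M).
Proof.
have [r [rm rn [U [V [[U' [u1 u2]] [V' [v1 v2]] ->]]]]] := rank_normal M.
exists r, (U *m pid_mx r), (pid_mx r *m V), (pid_mx r *m U'), (V' *m pid_mx r); split; last first.
  move=> em en; subst m; subst n; exists (V' *m U'); rewrite pid_mx_1 mulmx1; split.
    by rewrite mulmxA -(mulmxA V') u2 mulmx1.
  by rewrite mulmxA -(mulmxA U) v1 mulmx1.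
split=> //.
- by rewrite mulmxA -(mulmxA _ U') u2 mulmx1 mul_pid_mx minnn (minn_idPr rm) pid_mx_1.
- by rewrite mulmxA -(mulmxA _ V) v1 mulmx1 mul_pid_mx minnn (minn_idPr rn) pid_mx_1.
by rewrite [RHS]mulmxA -(mulmxA U (pid_mx r) (pid_mx r)) mul_pid_mx minnn (minn_idPr (leqnn r)).
Qed.

Lemma mxiso_dim m n (M : 'M[K]_(m, n)) (N : 'M_(n, m)) : N *m M = 1%:M -> M *m N = 1%:M -> m = n.
Proof.
suff le p q (A : 'M[K]_(p, q)) (B : 'M_(q, p)) : B *m A = 1%:M -> (q <= p)%N.
  by move=> h1 h2; apply/eqP; rewrite eqn_leq (le _ _ _ _ h1) (le _ _ _ _ h2).
have [r [rp rq [U [V [_ [V' [v1 v2]] ->]]]]] := rank_normal A.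
move=> h; rewrite leqNgt; apply/negP => pq.
have h' : V *m B *m U *m pid_mx r = 1%:M :> 'M_q.
  have -> : V *m B *m U *m pid_mx r = V *m (B *m (U *m pid_mx r *m V)) *m V'.
    by rewrite !mulmxA -(mulmxA _ V V') v1 mulmx1.
  by rewrite h mulmx1.
(* The column of index p, which exists because p < q, vanishes in [pid_mx r] because r <= p. *)
have := congr1 (fun X : 'M[K]_q => X (Ordinal pq) (Ordinal pq)) h'.
rewrite mxE big1 => [|k _]; first by rewrite mxE eqxx => /esym/eqP; rewrite oner_eq0.
rewrite !mxE; case: eqP => [/= e|_]; last by rewrite mulr0.
by rewrite e ltnNge rp /= mulr0.
Qed.

End RankNormalForm.

(** * The category of representations *)

Section Casts.
Variable K : pzRingType.

Lemma castmx_pi m n m' n' (e e' : (m = m') * (n = n')) (M : 'M[K]_(m, n)) : castmx e M = castmx e' M.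
Proof. by congr (castmx _ M); case: e e' => [a b] [a' b']; congr (_, _); exact: Prop_irrelevance. Qed.
Lemma castmx_mulmx m n p m' n' p' (em : m = m') (en : n = n') (ep : p = p')
  (M : 'M[K]_(m, n)) (N : 'M[K]_(n, p)) :
  castmx (em, ep) (M *m N) = castmx (em, en) M *m castmx (en, ep) N.
Proof. by case: m' / em; case: n' / en; case: p' / ep. Qed.
Lemma castmxD m n m' n' (e : (m = m') * (n = n')) (M N : 'M[K]_(m, n)) :
  castmx e (M + N) = castmx e M + castmx e N.
Proof. by case: e => a b; case: m' / a; case: n' / b. Qed.
Lemma castmxZ m n m' n' (e : (m = m') * (n = n')) a (M : 'M[K]_(m, n)) :
  castmx e (a *: M) = a *: castmx e M.
Proof. by case: e => x y; case: m' / x; case: n' / y. Qed.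
Lemma castmx1 m m' (e e' : m = m') : castmx (e, e') (1%:M : 'M[K]_m) = 1%:M.
Proof. by rewrite (castmx_pi _ (e, e)); case: m' / e {e'}. Qed.
End Casts.

Lemma dep_choice I (T : I -> Type) (R : forall i, T i -> Prop) :
  (forall i, exists x, R i x) -> exists f, forall i, R i (f i).
Proof. by move=> h; exists (fun i => projT1 (cid (h i))) => i; case: cid. Qed.

Section Blocks.
Variable K : pzRingType.

(** Inclusion of a summand when [b] fixes the order of the two, as in [rplus]. Passing to the dual
    vertex flips [b] and exchanges the summands, so the adjoint of one inclusion is the projection
    onto the other summand. *)
Definition pin1 (b : bool) m1 m2 : 'M[K]_(if b then m1 + m2 else m2 + m1, m1)%N :=
  match b as b return 'M_(if b then m1 + m2 else m2 + m1, m1)%N with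
  | true => col_mx 1%:M 0 | false => col_mx 0 1%:M end.
Definition pin2 (b : bool) m1 m2 : 'M[K]_(if b then m1 + m2 else m2 + m1, m2)%N :=
  match b as b return 'M_(if b then m1 + m2 else m2 + m1, m2)%N with
  | true => col_mx 0 1%:M | false => col_mx 1%:M 0 end.
Definition ppr1 b m1 m2 := (pin1 b m1 m2)^T.
Definition ppr2 b m1 m2 := (pin2 b m1 m2)^T.

Lemma pprE m1 m2 : (ppr1 true m1 m2 = row_mx 1%:M 0) * (ppr1 false m1 m2 = row_mx 0 1%:M) *
  (ppr2 true m1 m2 = row_mx 0 1%:M) * (ppr2 false m1 m2 = row_mx 1%:M 0).
Proof. by rewrite /ppr1 /ppr2 /= !tr_col_mx !trmx0 !tr_scalar_mx. Qed.
Lemma ppr1_pin1 b m1 m2 : ppr1 b m1 m2 *m pin1 b m1 m2 = 1%:M.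
Proof. by case: b; rewrite pprE /= mul_row_col !mul0mx mulmx1 ?addr0 ?add0r. Qed.
Lemma ppr2_pin2 b m1 m2 : ppr2 b m1 m2 *m pin2 b m1 m2 = 1%:M.
Proof. by case: b; rewrite pprE /= mul_row_col !mul0mx mulmx1 ?addr0 ?add0r. Qed.
Lemma ppr1_pin2 b m1 m2 : ppr1 b m1 m2 *m pin2 b m1 m2 = 0.
Proof. by case: b; rewrite pprE /= mul_row_col mul0mx mulmx0 addr0. Qed.
Lemma ppr2_pin1 b m1 m2 : ppr2 b m1 m2 *m pin1 b m1 m2 = 0.
Proof. by case: b; rewrite pprE /= mul_row_col mul0mx mulmx0 addr0. Qed.
Lemma pin_ppr b m1 m2 : pin1 b m1 m2 *m ppr1 b m1 m2 + pin2 b m1 m2 *m ppr2 b m1 m2 = 1%:M.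
Proof.
by case: b; rewrite !pprE /= !mul_col_row !mulmx1 !mulmx0 ?mul0mx add_block_mx ?addr0 ?add0r -scalar_mx_block.
Qed.
Lemma castmx_pin1 b m1 m2 m1' (e : m1' = m1) e2 e3 :
  castmx (e2, e3) (pin1 (~~ b) m2 m1') = pin2 b m1 m2.
Proof. by case: m1 / e e2; case: b e3 => e3 e2; rewrite castmx_id. Qed.
Lemma castmx_pin2 b m1 m2 m1' (e : m1' = m1) e2 e3 :
  castmx (e2, e3) (pin2 (~~ b) m2 m1') = pin1 b m1 m2.
Proof. by case: m1 / e e2 e3; case: b => e2 e3; rewrite castmx_id. Qed.
Lemma castmx_ppr1 b m1 m2 m1' (e : m1' = m1) e2 e3 :
  castmx (e2, e3) (ppr1 (~~ b) m2 m1') = ppr2 b m1 m2.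
Proof. by rewrite -(trmx_cast (e3, e2)) (castmx_pin1 e). Qed.
Lemma castmx_ppr2 b m1 m2 m1' (e : m1' = m1) e2 e3 :
  castmx (e2, e3) (ppr2 (~~ b) m2 m1') = ppr1 b m1 m2.
Proof. by rewrite -(trmx_cast (e3, e2)) (castmx_pin2 e). Qed.
Lemma castmx_block0 m n m' n' p q p' q' (e1 : m = m') (e2 : n = n') (e3 : p = p') (e4 : q = q')
  e5 e6 (M : 'M[K]_(m, n)) (N : 'M[K]_(p, q)) :
  castmx (e5, e6) (block_mx M 0 0 N) = block_mx (castmx (e1, e2) M) 0 0 (castmx (e3, e4) N).
Proof. by case: m' / e1 e5; case: n' / e2 e6; case: p' / e3; case: q' / e4 => e5 e6; rewrite !castmx_id. Qed.
Lemma castmx_row10 m m' p p' (e1 : m = m') (e3 : p = p') e5 e6 :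
  castmx (e5, e6) (row_mx (1%:M : 'M[K]_m) (0 : 'M_(m, p))) = row_mx (1%:M : 'M_m') (0 : 'M_(m', p')).
Proof. by case: m' / e1 e5 e6; case: p' / e3 => e5 e6; rewrite !castmx_id. Qed.
Lemma castmx_row01 m m' p p' (e1 : m = m') (e3 : p = p') e5 e6 :
  castmx (e5, e6) (row_mx (0 : 'M_(p, m)) (1%:M : 'M[K]_p)) = row_mx (0 : 'M_(p', m')) (1%:M : 'M_p').
Proof. by case: m' / e1 e6; case: p' / e3 e5 => e5 e6; rewrite !castmx_id. Qed.
End Blocks.

(** What the four cases have in common: a skew field with involution, central scalars, and an
    invertible 2. *)
Record admissible (X : ctx) (C : lincat (cP X)) (s0 : obj C -> bool) : Prop := Admissible {
  adm_divK : forall x : cK X, x != 0 -> x \is a GRing.unit;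
  adm_barI : is_involution (cbar X);
  adm_embD : forall a b, cemb X (a + b) = cemb X a + cemb X b;
  adm_embM : forall a b, cemb X (a * b) = cemb X a * cemb X b;
  adm_emb1 : cemb X 1 = 1;
  adm_emb_central : forall a x, cemb X a * x = x * cemb X a;
  adm_emb_bar : forall a, cemb X (cbarP X a) = (cbar X) (cemb X a);
  adm_two : (1 + 1 : cP X) != 0;
  adm_hC : is_lincat_inv (cbarP X) C;
  adm_hs0 : is_partition s0 }.

Section Concrete.
Variables (X : ctx) (C : lincat (cP X)).
Local Notation K := (cK X).
Local Notation P := (cP X).
Local Notation emb := (cemb X).
Local Notation bar := (cbar X).
Variable s0 : obj C -> bool.
Hypothesis adm : admissible s0.
Let divK := adm_divK adm.
Let barI := adm_barI adm.
Let embD := adm_embD adm.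
Let embM := adm_embM adm.
Let emb1 := adm_emb1 adm.
Let emb_central := adm_emb_central adm.
Let emb_bar := adm_emb_bar adm.
Let two := adm_two adm.
Let hC := adm_hC adm.
Let hs0 := adm_hs0 adm.

Lemma barK : involutive bar. Proof. by case: barI. Qed.
Lemma barD a b : bar (a + b) = bar a + bar b. Proof. by case: barI => _ []. Qed.
Lemma barM a b : bar (a * b) = bar b * bar a. Proof. by case: barI => _ []. Qed.
Lemma bar0 : bar 0 = 0. Proof. by apply: (addrI (bar 0)); rewrite -barD !addr0. Qed.
Lemma bar1 : bar 1 = 1.
Proof. by have := barM (bar 1) 1; rewrite mulr1 barK mulr1. Qed.
Lemma bar_sum I (r : seq I) (Q : pred I) (F : I -> K) :
  bar (\sum_(i <- r | Q i) F i) = \sum_(i <- r | Q i) bar (F i).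
Proof. by apply: (big_morph bar barD bar0). Qed.

Local Notation conjT := (@conjT X).

Lemma conjTM m n p (M : 'M[K]_(m, n)) (N : 'M_(n, p)) : conjT (M *m N) = conjT N *m conjT M.
Proof.
apply/matrixP => i j; rewrite !mxE bar_sum; apply: eq_bigr => k _.
by rewrite !mxE barM.
Qed.
Lemma conjTK m n (M : 'M[K]_(m, n)) : conjT (conjT M) = M.
Proof. by apply/matrixP => i j; rewrite !mxE barK. Qed.
Lemma conjTD m n (M N : 'M[K]_(m, n)) : conjT (M + N) = conjT M + conjT N.
Proof. by apply/matrixP => i j; rewrite !mxE barD. Qed.
Lemma conjT0 m n : conjT (0 : 'M[K]_(m, n)) = 0.
Proof. by apply/matrixP => i j; rewrite !mxE bar0. Qed.
Lemma conjT1 m : conjT (1%:M : 'M[K]_m) = 1%:M.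
Proof. by apply/matrixP => i j; rewrite !mxE eq_sym; case: eqP => _; rewrite ?bar1 ?bar0. Qed.
Lemma conjTZ m n a (M : 'M[K]_(m, n)) : conjT (emb a *: M) = emb (cbarP X a) *: conjT M.
Proof. by apply/matrixP => i j; rewrite !mxE barM -emb_bar emb_central. Qed.
Lemma conjT_cast m n m' n' (e : (m = m') * (n = n')) (M : 'M[K]_(m, n)) :
  conjT (castmx e M) = castmx (e.2, e.1) (conjT M).
Proof. by case: e => a b /=; case: m' / a; case: n' / b. Qed.

Lemma mulmx_embZ m n p a (M : 'M[K]_(m, n)) (N : 'M_(n, p)) :
  M *m (emb a *: N) = emb a *: (M *m N).
Proof.
apply/matrixP => i j; rewrite !mxE mulr_sumr; apply: eq_bigr => k _.
by rewrite !mxE !mulrA emb_central.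
Qed.

Lemma ss u : ostar (ostar u) = u :> obj C.
Proof. by case: hC => _ [_ [_ [_ [_ [[s _] _]]]]]; exact: s. Qed.
Lemma hstarK u v (f : hom C u v) : hstar (hstar f) = hcast (esym (ss u)) (esym (ss v)) f.
Proof.
case: hC => _ [_ [_ [_ [_ [[s h] _]]]]]; rewrite h.
by congr (hcast _ _ f); exact: Prop_irrelevance.
Qed.
Lemma hstar_comp u v w (f : hom C v w) (g : hom C u v) :
  hstar (comp f g) = comp (hstar g) (hstar f).
Proof. by case: hC => _ [_ [_ [_ [_ [_ [h _]]]]]]. Qed.

Lemma rmat_hcast (A : rdata X C) u u' v v' (e1 : u = u') (e2 : v = v') (f : hom C u v) :
  rmat A (hcast e1 e2 f) = castmx (f_equal (rdim A) e2, f_equal (rdim A) e1) (rmat A f).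
Proof. by case: u' / e1; case: v' / e2. Qed.

Lemma fam_cast (A B : rdata X C) (f : forall u, 'M[K]_(rdim B u, rdim A u)) u u' (e : u = u') :
  f u' = castmx (f_equal (rdim B) e, f_equal (rdim A) e) (f u).
Proof. by case: u' / e. Qed.

Lemma morph_inv (A B : rdata X C) (f : forall u, 'M[K]_(rdim B u, rdim A u))
  (g : forall u, 'M[K]_(rdim A u, rdim B u)) :
  @is_morph X C A B f -> (forall u, g u *m f u = 1%:M /\ f u *m g u = 1%:M) -> @is_morph X C B A g.
Proof.
move=> fP gf u v a; rewrite -[LHS]mulmx1 -(gf u).2 mulmxA -(mulmxA (g v)) -(fP _ _ a).
by rewrite mulmxA (gf v).1 mul1mx.
Qed.

Definition crep := {A : rdata X C | is_rep A}.

Record chom (A B : crep) := CHom {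
  hf :> forall u, 'M[K]_(rdim (sval B) u, rdim (sval A) u);
  hfP : is_morph hf }.

Lemma chom_ext (A B : crep) (f g : chom A B) : (forall u, f u = g u) -> f = g.
Proof.
case: f g => [f hf] [g hg] /= e; have {}e : f = g by apply: functional_extensionality_dep.
by subst g; congr CHom; exact: Prop_irrelevance.
Qed.

Lemma chom_at (A B : crep) (x y : chom A B) u : x = y -> x u = y u.
Proof. by move=> ->. Qed.

HB.instance Definition _ A B := gen_eqMixin (chom A B).
HB.instance Definition _ A B := gen_choiceMixin (chom A B).

Section Zmod.
Variables A B : crep.
Implicit Types f g : chom A B.

Lemma cadd_proof f g : is_morph (fun u => f u + g u).
Proof. by move=> u v a; rewrite mulmxDl mulmxDr !hfP. Qed.
Lemma copp_proof f : is_morph (fun u => - f u).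
Proof. by move=> u v a; rewrite mulNmx mulmxN hfP. Qed.
Lemma czero_proof : is_morph (fun u => 0 : 'M[K]_(rdim (sval B) u, rdim (sval A) u)).
Proof. by move=> u v a; rewrite mul0mx mulmx0. Qed.
Definition cadd f g := CHom (cadd_proof f g).
Definition copp f := CHom (copp_proof f).
Definition czero := CHom czero_proof.
Lemma caddA : associative cadd. Proof. by move=> f g h; apply: chom_ext => u /=; rewrite addrA. Qed.
Lemma caddC : commutative cadd. Proof. by move=> f g; apply: chom_ext => u /=; rewrite addrC. Qed.
Lemma cadd0 : left_id czero cadd. Proof. by move=> f; apply: chom_ext => u /=; rewrite add0r. Qed.
Lemma caddN : left_inverse czero copp cadd. Proof. by move=> f; apply: chom_ext => u /=; rewrite addNr. Qed.
HB.instance Definition _ := GRing.isZmodule.Build (chom A B) caddA caddC cadd0 caddN.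
End Zmod.

Lemma ccmp_proof (A B D : crep) (f : chom B D) (g : chom A B) : is_morph (fun u => f u *m g u).
Proof. by move=> u v a; rewrite -mulmxA hfP mulmxA hfP mulmxA. Qed.
Definition ccmp (A B D : crep) (f : chom B D) (g : chom A B) := CHom (ccmp_proof f g).
Lemma cid_proof (A : crep) : is_morph (fun u => 1%:M : 'M[K]_(rdim (sval A) u)).
Proof. by move=> u v a; rewrite mulmx1 mul1mx. Qed.
Definition cidm (A : crep) : chom A A := CHom (@cid_proof A).

Definition cscal_proof (A : crep) (a : P) : is_morph (fun u => (emb a)%:M : 'M[K]_(rdim (sval A) u)).
Proof.
move=> u v x; apply/matrixP => i j; rewrite !mxE (bigD1 i) //= (bigD1 j) //= !mxE !eqxx /= !mulr1n.
rewrite big1 => [|k ki]; last by rewrite !mxE eq_sym (negPf ki) mul0r.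
rewrite big1 => [|k kj]; last by rewrite !mxE (negPf kj) mulr0.
by rewrite !addr0 emb_central.
Qed.
Definition cscal (A : crep) (a : P) : chom A A := CHom (@cscal_proof A a).

Lemma chalf (A : crep) : exists h : chom A A, h + h = cidm A.
Proof.
exists (cscal A (1 + 1)^-1); apply: chom_ext => u /=.
by rewrite -raddfD -embD -{1 2}[_^-1]mul1r -mulrDl mulfV // emb1.
Qed.

Definition clt (A B : crep) := (forall u, rdim (sval A) u <= rdim (sval B) u)%N /\
  exists u, (rdim (sval A) u < rdim (sval B) u)%N.

(** A list supporting A also supports every smaller representation, so the sum of the dimensions
    over that list is a decreasing measure; repetitions in the list do no harm. *)
Lemma clt_wf : well_founded clt.
Proof.
have size_ind s n (A : crep) : (forall u, ~ List.In u s -> rdim (sval A) u = 0%N) ->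
    (\sum_(u <- s) rdim (sval A) u < n)%N -> Acc clt A.
  elim: n A => [|n IH] A sA ltn; first by rewrite ltn0 in ltn.
  constructor => B [le [u lt]]; apply: IH.
    by move=> v /sA Av; have := le v; rewrite Av leqn0 => /eqP.
  apply: (leq_trans _ (ltn : _ <= n)%N); have us : List.In u s.
    by apply: contrapT => /sA Au; move: lt; rewrite Au ltn0.
  elim: {sA ltn} s us => //= v s IHs [->|us]; rewrite !big_cons.
    by rewrite -addSn; apply: leq_add => //; apply: leq_sum => w _; exact: le.
  by rewrite -addnS; apply: leq_add; [exact: le|exact: IHs].
case=> A rA; have [_ [_ [_ [s hs]]]] := rA.
exact: (size_ind s _ (exist _ A rA) hs (leqnn _)).
Qed.

Lemma clt_trans (A B D : crep) : clt A B -> clt B D -> clt A D.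
Proof.
move=> [l1 [u s1]] [l2 _]; split=> [v|]; first exact: leq_trans (l1 v) (l2 v).
by exists u; apply: leq_trans s1 (l2 u).
Qed.

Lemma ciso_dim (A B : crep) (f : chom A B) (g : chom B A) :
  ccmp g f = cidm A -> ccmp f g = cidm B -> forall u, rdim (sval A) u = rdim (sval B) u.
Proof.
move=> gf fg u; apply/esym; apply: (mxiso_dim divK (M := f u) (N := g u)).
  exact: (chom_at u gf).
exact: (chom_at u fg).
Qed.

Lemma clt_iso (A B D : crep) (f : chom A B) (g : chom B A) :
  ccmp g f = cidm A -> ccmp f g = cidm B -> clt B D -> clt A D.
Proof.
move=> gf fg [le [u lt]]; have e := ciso_dim gf fg.
by split=> [v|]; [rewrite e|exists u; rewrite e].
Qed.

(** Rank factorization at every vertex; the intermediate spaces form the image of f, a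
    representation of smaller dimension unless f is invertible everywhere. *)
Lemma cfactor (A : crep) (f : chom A A) :
  (exists g, ccmp g f = cidm A /\ ccmp f g = cidm A) \/
  (exists (A' : crep) (l : chom A' A) (r : chom A A'), clt A' A /\ f = ccmp l r).
Proof.
have [r hr] := dep_choice (fun u => rank_factor divK (f u)).
have [L hL] := dep_choice hr; have [R hR] := dep_choice hL.
have [Pm hP] := dep_choice hR; have [Q hQ] := dep_choice hP.
have PL u : Pm u *m L u = 1%:M by have [[]] := hQ u.
have RQ u : R u *m Q u = 1%:M by have [[]] := hQ u.
have fE u : f u = L u *m R u by have [[]] := hQ u.
have [full|nfull] := pselect (forall u, r u = rdim (sval A) u).
  left; have [g hg] := dep_choice (fun u => (hQ u).2 (full u) (full u)).
  have gP := morph_inv (@hfP _ _ f) hg.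
  by exists (@CHom A A g gP); split; apply: chom_ext => u; case: (hg u).
right; pose B := @RData X C r (fun u v (a : hom C u v) => Pm v *m rmat (sval A) a *m L u).
(* A preserves the image of f, since A L = A L R Q = A f Q = f A Q, and L P is the identity on that
   image. *)
have AL u v (a : hom C u v) : L v *m (Pm v *m rmat (sval A) a *m L u) = rmat (sval A) a *m L u.
  have E : rmat (sval A) a *m L u = L v *m (R v *m rmat (sval A) a *m Q u).
    rewrite !mulmxA -fE (hfP f a) fE -!mulmxA; congr (_ *m _).
    by rewrite RQ mulmx1.
  by rewrite -(mulmxA (Pm v)) E (mulmxA (Pm v)) PL mul1mx.
have [fc [f1 [fl [s hs]]]] := svalP A.
have rB : is_rep B.
  split; last split; last split.
  - by move=> u v w a b /=; rewrite fc -[RHS]mulmxA AL !mulmxA.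
  - by move=> u /=; rewrite f1 mulmx1 PL.
  - by move=> u v a b b' /=; rewrite fl mulmxDr mulmxDl mulmx_embZ -scalemxAl.
  exists s => u /hs Au; have [[ru _ _ _ _] _] := hQ u.
  by move: ru; rewrite Au leqn0 => /eqP.
have lP : @is_morph X C B (sval A) L by move=> u v a /=; rewrite AL.
have RP : @is_morph X C (sval A) B R.
  move=> u v a /=; rewrite -[LHS]mul1mx -(PL v) -!mulmxA (mulmxA (L v)) -fE.
  by rewrite (hfP f a) fE !mulmxA.
pose B' : crep := exist _ B rB.
exists B', (@CHom B' A L lP), (@CHom A B' R RP); split; last exact: chom_ext.
split=> [u|]; first by have [[]] := hQ u.
have [u ru] := (existsNP (fun u => r u = rdim (sval A) u)).2 nfull.
by exists u; rewrite ltn_neqAle; apply/andP; split; [exact/eqP|have [[]] := hQ u].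
Qed.

(** Equality of A' with A°, the equalities of dimensions being absorbed by casts. As a proposition
    it has at most one proof, so a selfadjoint object is determined by its representation. *)
Definition cdual (A A' : crep) := exists e : (forall u, rdim (sval A') u = rdim (sval A) (ostar u)),
  forall u v (a : hom C u v),
    rmat (sval A') a = castmx (esym (e v), esym (e u)) (conjT (rmat (sval A) (hstar a))).

Definition cdual_dim (A A' : crep) (d : cdual A A') u : rdim (sval A') u = rdim (sval A) (ostar u) :=
  match d with ex_intro e _ => e u end.

Lemma cdualE (A A' : crep) (d : cdual A A') u v (a : hom C u v) :
  rmat (sval A') a = castmx (esym (cdual_dim d v), esym (cdual_dim d u))
    (conjT (rmat (sval A) (hstar a))).
Proof. by case: d => e h. Qed.

Lemma cdualC (A A' : crep) : cdual A A' -> cdual A' A.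
Proof.
move=> d; have e u : rdim (sval A) u = rdim (sval A') (ostar u) by rewrite (cdual_dim d) ss.
exists e => u v a; rewrite (cdualE d) conjT_cast conjTK hstarK rmat_hcast /=.
by rewrite !castmx_comp /= castmx_id.
Qed.

Lemma hstar_hcast u u' v v' (e1 : u = u') (e2 : v = v') (f : hom C u v) :
  hstar (hcast e1 e2 f) = hcast (f_equal ostar e2) (f_equal ostar e1) (hstar f).
Proof. by case: u' / e1; case: v' / e2. Qed.

Lemma hcast_id u v (e1 : u = u) (e2 : v = v) (f : hom C u v) : hcast e1 e2 f = f.
Proof. by rewrite (Prop_irrelevance e1 erefl) (Prop_irrelevance e2 erefl). Qed.

Lemma hcast_hcast u u' u'' v v' v'' (e1 : u = u') (e2 : v = v') (e1' : u' = u'') (e2' : v' = v'')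
  (f : hom C u v) : hcast e1' e2' (hcast e1 e2 f) = hcast (etrans e1 e1') (etrans e2 e2') f.
Proof. by case: u'' / e1'; case: v'' / e2'. Qed.

(** The star is onto, so some y has an identity as its star; applying the star to the product of 1
    and y gives the rule, which is not among the axioms. *)
Lemma hstar_id u : hstar (idm u) = idm (ostar u) :> hom C _ _.
Proof.
have [_ [hid _]] := hC.
pose y : hom C u u := hcast (ss u) (ss u) (hstar (idm (ostar u))).
have sy : hstar y = idm (ostar u).
  by rewrite /y hstar_hcast hstarK hcast_hcast hcast_id.
have := hstar_comp (idm u) y; rewrite (hid _ _ y).1 sy => h.
by rewrite [RHS]h (hid _ _ (hstar (idm u))).1.
Qed.

Lemma is_rep_adj (A : rdata X C) : is_rep A -> is_rep (adj A).
Proof.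
case: (hC) => _ [_ [_ [_ [_ [_ [sc sl]]]]]].
case=> fc [f1 [fl [s hs]]]; split; last split; last split.
- by move=> u v w f g /=; rewrite sc fc conjTM.
- by move=> u /=; rewrite hstar_id f1 conjT1.
- move=> u v a f g /=; rewrite sl fl conjTD conjTZ; congr (_ *: _ + _).
  by rewrite !emb_bar barK.
exists (map ostar s) => u nu /=; apply: hs => us; apply: nu.
by rewrite -[u]ss; apply: List.in_map.
Qed.

Lemma cdual_ex (A : crep) : exists A', cdual A A'.
Proof.
case: A => A rA; exists (exist _ (adj A) (is_rep_adj rA)).
by exists (fun u => erefl).
Qed.

Section Adjoint.
Variables (A A' B B' : crep) (d : cdual A A') (d' : cdual B B').

Lemma cad_proof (f : chom A B) : @is_morph X C (sval B') (sval A') (fun u =>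
  castmx (esym (cdual_dim d u), esym (cdual_dim d' u)) (conjT (f (ostar u)))).
Proof.
move=> u v a; rewrite (cdualE d) (cdualE d') -!castmx_mulmx -!conjTM.
by rewrite (hfP f).
Qed.
Definition cad (f : chom A B) : chom B' A' := CHom (cad_proof f).
End Adjoint.

Lemma cadE A A' B B' (d : cdual A A') (d' : cdual B B') f u :
  cad d d' f u = castmx (esym (cdual_dim d u), esym (cdual_dim d' u)) (conjT (f (ostar u))).
Proof. by []. Qed.

Lemma cadD A A' B B' (d : cdual A A') (d' : cdual B B') (f g : chom A B) :
  cad d d' (f + g) = cad d d' f + cad d d' g.
Proof. by apply: chom_ext => u; rewrite !cadE /= conjTD castmxD. Qed.
Lemma cadM A A' B B' D D' (a : cdual A A') (b : cdual B B') (d : cdual D D')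
  (f : chom B D) (g : chom A B) : cad a d (ccmp f g) = ccmp (cad a b g) (cad b d f).
Proof. by apply: chom_ext => u; rewrite /= conjTM -castmx_mulmx. Qed.
Lemma cad1 A A' (a : cdual A A') : cad a a (cidm A) = cidm A'.
Proof. by apply: chom_ext => u; rewrite /= conjT1 castmx1. Qed.
Lemma cadK A A' B B' (a : cdual A A') (b : cdual B B') (a' : cdual A' A) (b' : cdual B' B)
  (f : chom A B) : cad b' a' (cad a b f) = f.
Proof.
apply: chom_ext => u; rewrite /= conjT_cast conjTK castmx_comp /=.
by rewrite [RHS](fam_cast f (ss u)); exact: castmx_pi.
Qed.

(* An isomorphism g : S -> N together with a form h on N that becomes the
   identity when pulled back along g makes S strictly selfadjoint. *)
Lemma cdual_pullback (S N N' : crep) (d : cdual N N') (h : chom N N') (k : chom N' N)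
  (g : chom S N) (g' : chom N S) (e : forall u, rdim (sval S) u = rdim (sval S) (ostar u)) :
  ccmp k h = cidm N -> ccmp h k = cidm N' -> ccmp g' g = cidm S -> ccmp g g' = cidm N ->
  (forall u, castmx (esym (e u), esym (cdual_dim d u)) (conjT (g (ostar u))) *m h u *m g u = 1%:M) ->
  cdual S S.
Proof.
move=> kh hk g'g gg' G; exists e => u v a.
pose Gm u := castmx (esym (e u), esym (cdual_dim d u)) (conjT (g (ostar u))).
pose Gm' u := castmx (esym (cdual_dim d u), esym (e u)) (conjT (g' (ostar u))).
have hgkg w : h w *m g w *m (g' w *m k w) = 1%:M.
  rewrite mulmxA -(mulmxA (h w)) [g w *m g' w](chom_at w gg') mulmx1; exact: (chom_at w hk).
have Gv w : Gm w = g' w *m k w.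
  by rewrite -[LHS]mulmx1 -(hgkg w) mulmxA (mulmxA (Gm w)) G mul1mx.
have GG' w : Gm w *m Gm' w = 1%:M.
  rewrite /Gm /Gm' -castmx_mulmx -conjTM [g' _ *m g _](chom_at (ostar w) g'g).
  by rewrite conjT1 castmx1.
have G'v w : Gm' w = h w *m g w.
  by rewrite -[LHS]mul1mx -(hgkg w) -Gv -!mulmxA GG' !mulmx1.
have gS w x (b : hom C w x) : rmat (sval S) b = g' x *m rmat (sval N) b *m g w.
  by rewrite -mulmxA -(hfP g) mulmxA [g' x *m g x](chom_at x g'g) mul1mx.
rewrite [in RHS]gS !conjTM.
rewrite (castmx_mulmx _ (esym (cdual_dim d v))) (castmx_mulmx _ (esym (cdual_dim d u))).
rewrite -cdualE -/(Gm v) -/(Gm' u) Gv G'v !mulmxA -(mulmxA _ _ (h u)) -(hfP h) gS.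
rewrite !mulmxA -(mulmxA _ (k v)) [k v *m h v](chom_at v kh) mulmx1 //.
Qed.

Section ConjugateRep.
Variables (A : crep) (g g' : forall u, 'M[K]_(rdim (sval A) u)).
Hypothesis gg' : forall u, g u *m g' u = 1%:M /\ g' u *m g u = 1%:M.

Definition conj_rdata : rdata X C :=
  @RData X C (rdim (sval A)) (fun u v (a : hom C u v) => g' v *m rmat (sval A) a *m g u).

Lemma conj_is_rep : is_rep conj_rdata.
Proof.
have [fc [f1 [fl fs]]] := svalP A; split; last split; last split => //.
- move=> u v w a b /=; rewrite fc !mulmxA -(mulmxA _ (g v)) (gg' v).1 mulmx1 //.
- by move=> u /=; rewrite f1 mulmx1 (gg' u).2.
- by move=> u v a b b' /=; rewrite fl mulmxDr mulmxDl mulmx_embZ -scalemxAl.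
Qed.

Definition conj_rep : crep := exist _ conj_rdata conj_is_rep.

Lemma conj_fwd_proof : @is_morph X C (sval conj_rep) (sval A) g.
Proof. by move=> u v a /=; rewrite !mulmxA (gg' v).1 mul1mx. Qed.
Lemma conj_bwd_proof : @is_morph X C (sval A) (sval conj_rep) g'.
Proof. by move=> u v a /=; rewrite -[RHS]mulmxA (gg' u).1 mulmx1. Qed.
Definition conj_fwd : chom conj_rep A := CHom conj_fwd_proof.
Definition conj_bwd : chom A conj_rep := CHom conj_bwd_proof.
Lemma conj_bf : ccmp conj_bwd conj_fwd = cidm conj_rep.
Proof. by apply: chom_ext => u; case: (gg' u). Qed.
Lemma conj_fb : ccmp conj_fwd conj_bwd = cidm A.
Proof. by apply: chom_ext => u; case: (gg' u). Qed.
End ConjugateRep.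

Lemma castmx1l m n m' m'' (e1 : m = m') (e2 : m = m'') (e : m'' = m') (M : 'M[K]_(m'', n)) :
  castmx (e1, e2) (1%:M : 'M_m) *m M = castmx (e, erefl) M.
Proof. by case: m' / e1 e; case: m'' / e2 M => M e; rewrite !castmx_id mul1mx. Qed.

(** Here the partition enters. The form h makes the dimensions at u and at its dual vertex equal,
    and the base change that is 1 on S0 and h^-1 elsewhere pulls h back to the identity, because
    exactly one of the two vertices lies in S0. *)
Lemma cstrict (N N' : crep) (d : cdual N N') (h : chom N N') (k : chom N' N) :
  ccmp k h = cidm N -> ccmp h k = cidm N' -> cad d (cdualC d) h = h ->
  exists S (s : cdual S S) (g : chom S N) (g' : chom N S),
    [/\ ccmp g' g = cidm S, ccmp g g' = cidm N & ccmp (ccmp (cad s d g) h) g = cidm S].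
Proof.
move=> kh hk ah; have dm := ciso_dim kh hk.
have khu u : k u *m h u = 1%:M := chom_at u kh.
have hku u : h u *m k u = 1%:M := chom_at u hk.
have ak : cad (cdualC d) d k = k.
  have kh' : ccmp (cad (cdualC d) d k) h = cidm N by rewrite -[X in ccmp _ X]ah -cadM hk cad1.
  apply: chom_ext => u; rewrite -[LHS]mulmx1 -hku mulmxA.
  by rewrite [_ *m h u](chom_at u kh') mul1mx.
pose g u := if s0 u then 1%:M else castmx (erefl, esym (dm u)) (k u).
pose g' u := if s0 u then 1%:M else castmx (esym (dm u), erefl) (h u).
have gg' u : g u *m g' u = 1%:M /\ g' u *m g u = 1%:M.
  rewrite /g /g'; case: (s0 u); first by rewrite mulmx1.
  by rewrite -!castmx_mulmx khu hku !castmx1.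
pose S := conj_rep gg'.
have e u : rdim (sval S) u = rdim (sval S) (ostar u).
  exact: etrans (dm u) (cdual_dim d u).
have G u : castmx (esym (e u), esym (cdual_dim d u)) (conjT (g (ostar u))) *m h u *m g u = 1%:M.
  rewrite /g hs0; case s0u : (s0 u) => /=.
    rewrite mulmx1 conjT_cast castmx_comp /= -(khu u); congr (_ *m _).
    by rewrite -{2}ak cadE; exact: castmx_pi.
  rewrite conjT1 (castmx1l _ _ (esym (dm u))) -castmx_mulmx hku castmx1 //.
have sd := cdual_pullback kh hk (conj_bf gg') (conj_fb gg') G.
exists S, sd, (conj_fwd gg'), (conj_bwd gg'); split; [exact: conj_bf|exact: conj_fb|].
apply: chom_ext => u /=; rewrite -(G u); congr (_ *m _ *m _); exact: castmx_pi.
Qed.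

Lemma ccmpA A B D E (f : chom D E) (g : chom B D) (h : chom A B) :
  ccmp f (ccmp g h) = ccmp (ccmp f g) h.
Proof. by apply: chom_ext => u; exact: mulmxA. Qed.
Lemma ccmp1m A B (f : chom A B) : ccmp (cidm B) f = f.
Proof. by apply: chom_ext => u; exact: mul1mx. Qed.
Lemma ccmpm1 A B (f : chom A B) : ccmp f (cidm A) = f.
Proof. by apply: chom_ext => u; exact: mulmx1. Qed.
Lemma ccmpDl A B D (f g : chom B D) (h : chom A B) : ccmp (f + g) h = ccmp f h + ccmp g h.
Proof. by apply: chom_ext => u; exact: mulmxDl. Qed.
Lemma ccmpDr A B D (f : chom B D) (g h : chom A B) : ccmp f (g + h) = ccmp f g + ccmp f h.
Proof. by apply: chom_ext => u; exact: mulmxDr. Qed.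

Definition rep_hcat : hcat := @HCat crep chom ccmp cidm
  ccmpA ccmp1m ccmpm1 ccmpDl ccmpDr
  chalf clt clt_wf clt_trans clt_iso cfactor cdual cdualC cdual_ex cad cadD cadM cad1 cadK cstrict.

Local Notation H := rep_hcat.

Lemma pin_conj1 b m1 m2 : conjT (pin1 K b m1 m2) = ppr1 K b m1 m2.
Proof.
by case: b; rewrite pprE /Defs.conjT /= map_col_mx tr_col_mx; congr row_mx; rewrite -[LHS]/(conjT _) ?conjT1 ?conjT0.
Qed.
Lemma pin_conj2 b m1 m2 : conjT (pin2 K b m1 m2) = ppr2 K b m1 m2.
Proof.
by case: b; rewrite pprE /Defs.conjT /= map_col_mx tr_col_mx; congr row_mx; rewrite -[LHS]/(conjT _) ?conjT1 ?conjT0.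
Qed.
Lemma ppr_conj1 b m1 m2 : conjT (ppr1 K b m1 m2) = pin1 K b m1 m2.
Proof. by rewrite -pin_conj1 conjTK. Qed.
Lemma ppr_conj2 b m1 m2 : conjT (ppr2 K b m1 m2) = pin2 K b m1 m2.
Proof. by rewrite -pin_conj2 conjTK. Qed.

Lemma plus_blkE bw bu m1 m2 n1 n2 (M : 'M[K]_(m1, n1)) (N : 'M[K]_(m2, n2)) :
  plus_blk bw bu M N = pin1 K bw m1 m2 *m M *m ppr1 K bu n1 n2 + pin2 K bw m1 m2 *m N *m ppr2 K bu n1 n2.
Proof.
by case: bw; case: bu; rewrite !pprE /= (mul_col_mx _ _ M) (mul_col_mx _ _ N) !mul_col_row !mul1mx !mul0mx !mulmx1 !mulmx0
  add_block_mx ?addr0 ?add0r.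
Qed.

Section Plus.
Variable M : crep.
Local Notation A := (sval M).
Local Notation Q := (rplus s0 A).

Lemma rplus_mat u v (a : hom C u v) : rmat Q a =
  pin1 K (s0 v) _ _ *m rmat A a *m ppr1 K (s0 u) _ _ +
  pin2 K (s0 v) _ _ *m rmat (adj A) a *m ppr2 K (s0 u) _ _.
Proof. exact: plus_blkE. Qed.

Lemma sandwich a b c d e f (x : 'M[K]_(a, b)) (p : 'M_(b, c)) (i : 'M_(c, d)) k
  (y : 'M_(d, e)) (z : 'M_(e, f)) : p *m i = k -> x *m p *m (i *m y *m z) = x *m k *m y *m z.
Proof. by move=> <-; rewrite !mulmxA. Qed.

Lemma rplus_is_rep : is_rep Q.
Proof.
have [fc [f1 [fl [s hs]]]] := svalP M.
have [gc [g1 [gl _]]] := is_rep_adj (svalP M).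
split; last split; last split.
- move=> u v w f g; rewrite !rplus_mat fc gc mulmxDl !mulmxDr.
  rewrite (sandwich _ _ _ (ppr1_pin1 _ _ _ _)) (sandwich _ _ _ (ppr1_pin2 _ _ _ _)).
  rewrite (sandwich _ _ _ (ppr2_pin1 _ _ _ _)) (sandwich _ _ _ (ppr2_pin2 _ _ _ _)).
  by rewrite !mulmx1 !mulmx0 !mul0mx addr0 add0r !mulmxA.
- by move=> u; rewrite rplus_mat f1 g1 !mulmx1 pin_ppr.
- move=> u v a f g; rewrite !rplus_mat fl gl !mulmxDr !mulmxDl !mulmx_embZ -!scalemxAl.
  by rewrite scalerDr addrACA.
exists (s ++ map ostar s) => u nu /=.
have [nu1 nu2] : ~ List.In u s /\ ~ List.In (ostar u) s.
  split=> us; apply: nu; apply/List.in_or_app; [by left|right].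
  by rewrite -[u]ss; apply: List.in_map.
by rewrite !hs //; case: (s0 u).
Qed.

Definition plus_rep : crep := exist _ Q rplus_is_rep.

Lemma rplus_dim u : rdim Q u = rdim Q (ostar u).
Proof. by rewrite /= hs0 ss; case: (s0 u). Qed.

Lemma castmx_conj_pin1 u e1 e2 : castmx (e1, e2) (conjT (pin1 K (s0 (ostar u))
  (rdim A (ostar u)) (rdim A (ostar (ostar u))))) = ppr2 K (s0 u) (rdim A u) (rdim A (ostar u)).
Proof.
rewrite pin_conj1; move: e2; rewrite hs0 => e2.
by apply: castmx_ppr1; rewrite ss.
Qed.
Lemma castmx_conj_pin2 u e1 e2 : castmx (e1, e2) (conjT (pin2 K (s0 (ostar u))
  (rdim A (ostar u)) (rdim A (ostar (ostar u))))) = ppr1 K (s0 u) (rdim A u) (rdim A (ostar u)).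
Proof.
rewrite pin_conj2; move: e2; rewrite hs0 => e2.
by apply: castmx_ppr2; rewrite ss.
Qed.
Lemma castmx_conj_ppr1 u e1 e2 : castmx (e1, e2) (conjT (ppr1 K (s0 (ostar u))
  (rdim A (ostar u)) (rdim A (ostar (ostar u))))) = pin2 K (s0 u) (rdim A u) (rdim A (ostar u)).
Proof.
rewrite ppr_conj1; move: e1; rewrite hs0 => e1.
by apply: castmx_pin1; rewrite ss.
Qed.
Lemma castmx_conj_ppr2 u e1 e2 : castmx (e1, e2) (conjT (ppr2 K (s0 (ostar u))
  (rdim A (ostar u)) (rdim A (ostar (ostar u))))) = pin1 K (s0 u) (rdim A u) (rdim A (ostar u)).
Proof.
rewrite ppr_conj2; move: e1; rewrite hs0 => e1.
by apply: castmx_pin2; rewrite ss.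
Qed.

Lemma plus_dual : cdual plus_rep plus_rep.
Proof.
exists rplus_dim => u v a; rewrite [sval plus_rep]/= !rplus_mat conjTD castmxD addrC.
rewrite [in RHS]conjTM conjTM [in RHS]conjTM conjTM.
have ds w : rdim A (ostar (ostar w)) = rdim A w by rewrite ss.
rewrite (castmx_mulmx _ erefl) (castmx_mulmx _ erefl) castmx_conj_ppr1 castmx_conj_pin1.
congr (_ + _); first by rewrite castmx_id mulmxA.
rewrite (castmx_mulmx _ (ds v)) (castmx_mulmx _ (ds u)) castmx_conj_ppr2 castmx_conj_pin2.
rewrite mulmxA; congr (_ *m _ *m _).
rewrite /= conjTK hstarK rmat_hcast castmx_comp /=.
by rewrite castmx_id.
Qed.

Definition plus_sob : sob H := @Sob H plus_rep plus_dual.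

Lemma plus_isPlus : isPlus (M : rep H) plus_sob.
Proof.
pose M' : crep := exist _ (adj A) (is_rep_adj (svalP M)).
have d : cdual M M' by exists (fun u => erefl).
have p1 : @is_morph X C A Q (fun u => pin1 K (s0 u) (rdim A u) (rdim A (ostar u))).
  move=> u v a; rewrite rplus_mat mulmxDl -!(mulmxA _ (ppr1 _ _ _ _)) -!(mulmxA _ (ppr2 _ _ _ _)).
  by rewrite ppr1_pin1 ppr2_pin1 mulmx1 !mulmx0 addr0.
have p2 : @is_morph X C (adj A) Q (fun u => pin2 K (s0 u) (rdim A u) (rdim A (ostar u))).
  move=> u v a; rewrite rplus_mat mulmxDl -!(mulmxA _ (ppr1 _ _ _ _)) -!(mulmxA _ (ppr2 _ _ _ _)).
  by rewrite ppr1_pin2 ppr2_pin2 mulmx1 !mulmx0 add0r.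
pose i1 : chom M plus_rep := @CHom M plus_rep _ p1.
pose i2 : chom M' plus_rep := @CHom M' plus_rep _ p2.
have a1 u : cad d plus_dual i1 u = ppr2 K (s0 u) (rdim A u) (rdim A (ostar u)).
  by rewrite cadE; exact: castmx_conj_pin1.
have a2 u : cad (cdualC d) plus_dual i2 u = ppr1 K (s0 u) (rdim A u) (rdim A (ostar u)).
  by rewrite cadE; exact: castmx_conj_pin2.
exists M', d, i1, i2; split; apply: chom_ext => u.
- by rewrite [LHS](congr1 (mulmx^~ _) (a1 u)); exact: ppr2_pin1.
- by rewrite [LHS](congr1 (mulmx^~ _) (a2 u)); exact: ppr1_pin2.
- by rewrite [LHS](congr1 (mulmx^~ _) (a2 u)); exact: ppr1_pin1.
by rewrite [LHS](congr2 (fun x y => i1 u *m x + i2 u *m y) (a2 u) (a1 u)); exact: pin_ppr.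
Qed.

End Plus.

Section Twist.
Variables (S : sob H) (f g : forall u, 'M[K]_(rdim (sval (sr S)) u)).
Hypothesis fP : @is_morph X C (sval (sr S)) (sval (sr S)) f.
Hypothesis fg : forall u, g u *m f u = 1%:M /\ f u *m g u = 1%:M.
Let fH : Hom S S := @CHom (sr S) (sr S) f fP.
Hypothesis af : sadj fH = fH.

Let F u := if s0 u then f u else 1%:M.
Let G u := if s0 u then g u else 1%:M.

Lemma twist_FG u : F u *m G u = 1%:M /\ G u *m F u = 1%:M.
Proof. by rewrite /F /G; case: (s0 u); [case: (fg u)|rewrite mulmx1]. Qed.

Definition twist_rep : crep := conj_rep twist_FG.

Let af_at u e1 e2 : castmx (e1, e2) (conjT (f (ostar u))) = f u.
Proof. by rewrite -[f in RHS]/(hf fH) -af; exact: castmx_pi. Qed.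

(** The twist is S transported along ftilde, and ftilde pulls the form f^-1 back to the identity: at
    each vertex, one of ftilde and its adjoint is f and the other is 1. *)
Lemma twist_dual : cdual twist_rep twist_rep.
Proof.
pose k : chom (sr S) (sr S) := @CHom (sr S) (sr S) g (morph_inv fP fg).
have hk : ccmp k fH = cidm (sr S) by apply: chom_ext => u; exact: (fg u).1.
have kh : ccmp fH k = cidm (sr S) by apply: chom_ext => u; exact: (fg u).2.
apply: (@cdual_pullback twist_rep (sr S) (sr S) (sd S) k fH (conj_fwd twist_FG)
  (conj_bwd twist_FG) (cdual_dim (sd S)) kh hk (conj_bf _) (conj_fb _)).
move=> u; rewrite /= /F hs0; case: (s0 u) => /=.
  by rewrite conjT1 castmx1 mul1mx (fg u).1.
by rewrite af_at mulmx1 (fg u).2.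
Qed.

Definition twist_sob : sob H := @Sob H twist_rep twist_dual.

Lemma twist_isTwist : isTwist (S := S) fH twist_sob.
Proof.
exists (conj_fwd twist_FG : Hom twist_sob S); split.
  exists (conj_bwd twist_FG : Hom S twist_sob); split; [exact: conj_bf|exact: conj_fb].
apply: chom_ext => u; rewrite [LHS]/= /F hs0; case: (s0 u) => /=.
  by rewrite conjT1 castmx1 mulmx1.
by rewrite mul1mx af_at.
Qed.
End Twist.

Lemma cisoE (A B : crep) : iso (sval A) (sval B) <-> isoc (A : rep H) (B : rep H).
Proof.
split=> [[f [g [fP gf]]]|[f [g [gf fg]]]].
  have gP := morph_inv fP gf.
  exists (@CHom A B f fP : Hom (A : rep H) B), (@CHom B A g gP).
  by split; apply: chom_ext => u; [exact: (gf u).1|exact: (gf u).2].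
exists (hf f), (hf g); split; first exact: hfP.
by move=> u; split; [exact: (chom_at u gf)|exact: (chom_at u fg)].
Qed.

Lemma is_zeroE (A : crep) : is_zero (sval A) <-> id_ (A : rep H) = 0.
Proof.
split=> [z|z u].
  by apply: chom_ext => u; apply/matrixP => i; have := ltn_ord i; rewrite {2}(z u).
have {}z : (1%:M : 'M[K]_(rdim (sval A) u)) = 0 := chom_at u z.
apply/eqP; case: (rdim (sval A) u) z => // n /matrixP/(_ 0 0)/eqP.
by rewrite !mxE eqxx oner_eq0.
Qed.

Lemma is_rep_dsum (A B : rdata X C) : is_rep A -> is_rep B -> is_rep (dsum A B).
Proof.
move=> [ac [a1 [al [s hs]]]] [bc [b1 [bl [t ht]]]]; split; last split; last split.
- by move=> u v w f g /=; rewrite ac bc mulmx_block !mulmx0 !mul0mx !addr0 add0r.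
- by move=> u /=; rewrite a1 b1 -scalar_mx_block.
- by move=> u v a f g /=; rewrite al bl scale_block_mx add_block_mx !scaler0 !addr0.
exists (s ++ t) => u nu /=; rewrite hs ?ht // => h; apply: nu; apply/List.in_or_app; [right|left] => //.
Qed.

(** A split idempotent and its complement give a direct sum, and a direct sum gives the idempotent
    projecting onto its first summand. *)
Lemma indecomposableE (A : crep) : indecomposable (sval A) <-> indec (A : rep H).
Proof.
split=> [[_ [nz dec]]|[nz idem]].
  split; first by move/is_zeroE.
  move=> e ee; have [->|[N [i [p [_ pi ip]]]]] := idem_split ee; first by right.
  have [Y [j [q [qj pj qi ex]]]] := rcomplement pi.
  have i1 : iso (sval A) (dsum (sval N) (sval Y)).
    exists (fun u => col_mx ((p : chom A N) u) ((q : chom A Y) u)).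
    exists (fun u => row_mx ((i : chom N A) u) ((j : chom Y A) u)).
    split; first by move=> u v a /=; rewrite mul_col_mx mul_block_col !mul0mx addr0 add0r !hfP.
    move=> u; split; first by rewrite mul_row_col; exact: (chom_at u ex).
    rewrite mul_col_row [_ *m _](chom_at u pi) [_ *m (j : chom Y A) u](chom_at u pj).
    rewrite [_ *m (i : chom N A) u](chom_at u qi) [_ *m (j : chom Y A) u](chom_at u qj).
    by rewrite -scalar_mx_block.
  have [/is_zeroE N0|/is_zeroE Y0] := dec _ _ (svalP N) (svalP Y) i1; [left|right].
    by rewrite -ip -[p]cmp1m N0 cmp0m cmpm0.
  by rewrite -ip -ex -[j]cmpm1 Y0 cmpm0 cmp0m addr0.
split; first exact: svalP; split; first by move/is_zeroE.
move=> A1 A2 r1 r2 [f [g [fP gf]]].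
pose B1 : crep := exist _ A1 r1; pose B2 : crep := exist _ A2 r2.
have gP := morph_inv fP gf.
pose D : crep := exist _ (dsum A1 A2) (is_rep_dsum r1 r2).
pose F : Hom (A : rep H) D := @CHom A D f fP; pose G : Hom (D : rep H) A := @CHom D A g gP.
have GF : G ∘ F = id_ (A : rep H) by apply: chom_ext => u; exact: (gf u).1.
have FG : F ∘ G = id_ (D : rep H) by apply: chom_ext => u; exact: (gf u).2.
have pP : @is_morph X C (dsum A1 A2) (dsum A1 A2) (fun u => block_mx 1%:M 0 0 0).
  by move=> u v a /=; rewrite !mulmx_block !mulmx0 !mul0mx !mulmx1 !mul1mx !addr0.
pose E : Hom (D : rep H) D := @CHom D D _ pP.
have EE : E ∘ E = E.
  by apply: chom_ext => u /=; rewrite mulmx_block !mulmx0 !mul0mx mulmx1 !addr0.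
have ge : G ∘ E ∘ F ∘ (G ∘ E ∘ F) = G ∘ E ∘ F.
  by rewrite !cmpA (cmpK FG) cmpm1 (cmpK EE).
have EG : F ∘ (G ∘ E ∘ F) ∘ G = E by rewrite !cmpA FG cmp1m (cmpK FG) cmpm1.
have [e0|e1] := idem _ ge; [left|right].
  change (is_zero (sval B1)); apply/is_zeroE; apply: chom_ext => u.
  have : E = 0 by rewrite -EG e0 cmpm0 cmp0m.
  move/(chom_at u) => /= h.
  by have [] := eq_block_mx (etrans h (esym (block_mx0 _ _ _ _ _))).
change (is_zero (sval B2)); apply/is_zeroE; apply: chom_ext => u.
have : E = id_ (D : rep H) by rewrite -EG e1 cmpm1 FG.
move/(chom_at u) => /= h.
by have [_ _ _ ->] := eq_block_mx (etrans h (scalar_mx_block _ _ _)).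
Qed.

Lemma is_sa_dual (A : rdata X C) (h : is_sa A) : cdual (exist _ A h.1) (exist _ A h.1).
Proof.
case: h => rA [e h] /=.
exists (fun u => esym (e u)) => u v a /=.
rewrite h conjT_cast conjTK castmx_comp /=.
by rewrite castmx_id.
Qed.

Definition sob_of (A : rdata X C) (h : is_sa A) : sob H := @Sob H (exist _ A h.1) (is_sa_dual h).

Lemma sob_is_sa (S : sob H) : is_sa (sval (sr S)).
Proof.
split; first exact: svalP.
exists (fun u => esym (cdual_dim (sd S) u)) => u v a.
rewrite [in RHS](cdualE (sd S)) conjT_cast conjTK castmx_comp /=.
by rewrite castmx_id.
Qed.

Lemma sob_eq (S T : sob H) : sval (sr S) = sval (sr T) -> S = T.
Proof.
case: S T => [[A rA] dA] [[B rB] dB] /= e; subst B.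
have er : rA = rB by exact: Prop_irrelevance.
by subst rB; congr Sob; exact: Prop_irrelevance.
Qed.

Lemma congruentE (S T : sob H) : congruent (sval (sr S)) (sval (sr T)) <-> congr_ S T.
Proof.
split=> [[eA [eB [f [g [[fP gf] adj_g]]]]]|[f [ff ff']]].
  exists (@CHom (sr S) (sr T) f fP : Hom S T).
  have E u : (sadj (@CHom (sr S) (sr T) f fP : Hom S T) : chom (sr T) (sr S)) u = g u.
    by rewrite -adj_g; exact: castmx_pi.
  split; apply: chom_ext => u.
    by rewrite [LHS](congr1 (mulmx^~ (f u)) (E u)); exact: (gf u).1.
  by rewrite [LHS](congr1 (mulmx (f u)) (E u)); exact: (gf u).2.
exists (fun u => esym (cdual_dim (sd S) u)), (fun u => esym (cdual_dim (sd T) u)).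
exists (hf f), (hf (sadj f)); split; last by move=> u; exact: castmx_pi.
split; first exact: hfP.
move=> u; split.
  exact: (chom_at u ff).
exact: (chom_at u ff').
Qed.

Section OrthogonalSum.
Variables S T : sob H.
Local Notation A := (sval (sr S)).
Local Notation B := (sval (sr T)).

Definition dsum_rep : crep := exist _ (dsum A B) (is_rep_dsum (svalP (sr S)) (svalP (sr T))).

Lemma dsum_dual : cdual dsum_rep dsum_rep.
Proof.
exists (fun u => congr2 addn (cdual_dim (sd S) u) (cdual_dim (sd T) u)) => u v a /=.
rewrite /Defs.conjT map_block_mx tr_block_mx.
have c0 m n : (map_mx bar (0 : 'M[K]_(m, n)))^T = 0 by exact: conjT0.
rewrite !c0 (castmx_block0 (esym (cdual_dim (sd S) v)) (esym (cdual_dim (sd S) u))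
  (esym (cdual_dim (sd T) v)) (esym (cdual_dim (sd T) u))).
by rewrite (cdualE (sd S) a) (cdualE (sd T) a).
Qed.

Definition dsum_sob : sob H := @Sob H dsum_rep dsum_dual.

Lemma dsum_isSum : isSum dsum_sob S T.
Proof.
have p1 : @is_morph X C A (dsum A B) (fun u => col_mx 1%:M 0).
  by move=> u v a /=; rewrite mul_col_mx mul_block_col !mulmx0 !mul0mx mulmx1 mul1mx !addr0.
have p2 : @is_morph X C B (dsum A B) (fun u => col_mx 0 1%:M).
  by move=> u v a /=; rewrite mul_col_mx mul_block_col !mulmx0 !mul0mx mulmx1 mul1mx !add0r.
pose i1 : Hom S dsum_sob := @CHom (sr S) dsum_rep _ p1.
pose i2 : Hom T dsum_sob := @CHom (sr T) dsum_rep _ p2.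
have a1 u : (sadj i1 : chom dsum_rep (sr S)) u = row_mx 1%:M 0.
  rewrite /sadj /= /Defs.conjT map_col_mx tr_col_mx -![(map_mx bar _)^T]/(conjT _) conjT1 conjT0.
  by apply: castmx_row10; [exact/esym/(cdual_dim (sd S))|exact/esym/(cdual_dim (sd T))].
have a2 u : (sadj i2 : chom dsum_rep (sr T)) u = row_mx 0 1%:M.
  rewrite /sadj /= /Defs.conjT map_col_mx tr_col_mx -![(map_mx bar _)^T]/(conjT _) conjT1 conjT0.
  by apply: castmx_row01; [exact/esym/(cdual_dim (sd S))|exact/esym/(cdual_dim (sd T))].
exists i1, i2; split; apply: chom_ext => u.
- by rewrite [LHS](congr1 (mulmx^~ _) (a1 u)) /= mul_row_col mulmx0 mulmx1 addr0.
- by rewrite [LHS](congr1 (mulmx^~ _) (a2 u)) /= mul_row_col mulmx0 mulmx1 add0r.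
- by rewrite [LHS](congr1 (mulmx^~ _) (a1 u)) /= mul_row_col mulmx0 mul0mx addr0.
rewrite [LHS](congr2 (fun x y => i1 u *m x + i2 u *m y) (a1 u) (a2 u)) /= !mul_col_row.
by rewrite !mulmx0 !mul0mx !mulmx1 add_block_mx !addr0 !add0r -scalar_mx_block.
Qed.
End OrthogonalSum.

Lemma rzero_is_rep : is_rep (@rzero X C).
Proof.
split; last split; last split => //.
- by move=> u v w f g /=; rewrite mulmx0.
- by move=> u /=; apply/matrixP => i; have := ltn_ord i.
- by move=> u v a f g /=; rewrite scaler0 addr0.
by exists [::].
Qed.

Definition zero_rep : crep := exist _ _ rzero_is_rep.
Lemma zero_dual : cdual zero_rep zero_rep.
Proof. by exists (fun u => erefl) => u v a; apply/matrixP => i; have := ltn_ord i. Qed.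
Definition zero_sob : sob H := @Sob H zero_rep zero_dual.

Fixpoint osum_sob (l : seq (sob H)) : sob H :=
  match l with [::] => zero_sob | T :: l' => dsum_sob T (osum_sob l') end.

Lemma osum_sobE l : sval (sr (osum_sob l)) = osum (map (fun S : sob H => sval (sr S)) l).
Proof. by elim: l => //= S l ->. Qed.

Lemma osum_decomp l : decomp (osum_sob l) l.
Proof.
elim: l => [|S l IH] /=.
  by apply: chom_ext => u; apply/matrixP => i; have := ltn_ord i.
by exists (osum_sob l); split=> //; exact: dsum_isSum.
Qed.

Lemma congruent_osum (S : sob H) l :
  congruent (sval (sr S)) (osum (map (fun T : sob H => sval (sr T)) l)) <-> decomp S l.
Proof.
rewrite -osum_sobE congruentE; split=> h.
  exact: decomp_congr (congr_sym h) (osum_decomp l).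
exact: decomp_unique h (osum_decomp l).
Qed.

(** Total, with the zero object as default value, so that it can be mapped over lists of labels. *)
Definition to_sob (A : rdata X C) : sob H :=
  if pselect (is_sa A) is left h then sob_of h else zero_sob.

Lemma to_sobE (A : rdata X C) : is_sa A -> sval (sr (to_sob A)) = A.
Proof. by rewrite /to_sob; case: pselect. Qed.

Lemma congruent_map (L : Type) (F : L -> rdata X C) (A : rdata X C) ls :
  is_sa A -> List.Forall (fun l => is_sa (F l)) ls ->
  congruent A (osum (map F ls)) <-> decomp (to_sob A) (map (fun l => to_sob (F l)) ls).
Proof.
move=> hA hl; rewrite -congruent_osum (to_sobE hA) -map_comp.
suff -> : map F ls = map ((fun T : sob H => sval (sr T)) \o (fun l => to_sob (F l))) ls by [].
by elim: hl => //= l ls' hF _ ->; rewrite (to_sobE hF).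
Qed.

End Concrete.

(** * Reduction of the classification to conditions on T(B) *)

Section Classification.
Variables (X : ctx) (C : lincat (cP X)) (s0 : obj C -> bool) (adm : admissible s0).
Local Notation H := (rep_hcat adm).
Local Notation to_sob := (to_sob adm).
Variables (I : Type) (ind : I -> rdata X C) (I1 : I -> Prop) (B0 : I -> rdata X C).
Hypothesis hind : ind_setup ind I1 B0.
Variables (tw : I -> rdata X C) (cond : I -> bool -> Prop).
Hypothesis cond_false : forall i, cond i false.

Let L := (I + I * bool)%type.
Let okl := lab_ok ind I1 cond.
Let real := realize s0 ind B0 tw.
Let F (l : L) : sob H := to_sob (real l).
Let B i : sob H := to_sob (B0 i).

Let ind_dec i : indecomposable (ind i). Proof. by case: hind. Qed.
Let ind_inj i j : iso (ind i) (ind j) -> i = j. Proof. by case: hind => _ [h _]; exact: h. Qed.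
Let ind_complete A : indecomposable A -> exists i, iso A (ind i).
Proof. by case: hind => _ [_ [h _]]; exact: h. Qed.
Let I1_noform i : I1 i -> ~ in_ind0 ind i. Proof. by case: hind => _ [_ [_ [h _]]]; exact: h. Qed.
Let I1_self i : ~ in_ind0 ind i -> iso (ind i) (adj (ind i)) -> I1 i.
Proof. by case: hind => _ [_ [_ [_ [h _]]]]; exact: h. Qed.
Let I1_pair i j : ~ iso (ind i) (adj (ind i)) -> iso (ind j) (adj (ind i)) -> (I1 i <-> ~ I1 j).
Proof. by case: hind => _ [_ [_ [_ [_ [h _]]]]]; exact: h. Qed.
Lemma ind0_form i : in_ind0 ind i -> is_sa (B0 i) /\ iso (ind i) (B0 i).
Proof. by case: hind => _ [_ [_ [_ [_ [_ h]]]]]; exact: h. Qed.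

Definition ind_rep i : rep H := exist _ (ind i) (ind_dec i).1.
Local Notation N := ind_rep.

Lemma ind_rep_indec i : indec (N i).
Proof. by apply/(indecomposableE adm (N i)); exact: ind_dec. Qed.

Lemma ind_rep_inj i j : isoc (N i) (N j) -> i = j.
Proof. by move/(cisoE adm); exact: ind_inj. Qed.

Lemma ind_rep_complete (M : rep H) : indec M -> exists i, isoc M (N i).
Proof.
by move/(indecomposableE adm)/ind_complete => [i h]; exists i; apply/(cisoE adm).
Qed.

Lemma in_ind0E i : in_ind0 ind i <-> exists T : sob H, isoc (N i) T.
Proof.
split=> [[A [sA iA]]|[T iT]].
  by exists (to_sob A); apply/(cisoE adm); rewrite (to_sobE adm sA).
by exists (sval (sr T)); split; [exact: sob_is_sa|apply/(cisoE adm (N i) (sr T))].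
Qed.

Lemma B_iso i : in_ind0 ind i -> isoc (N i) (B i).
Proof.
by move=> /ind0_form [sB iB]; apply/(cisoE adm); rewrite (to_sobE adm sB).
Qed.

Lemma B_indec i : in_ind0 ind i -> indec (B i).
Proof. by move=> h; exact: indec_iso (B_iso h) (ind_rep_indec i). Qed.

Lemma F_plus_eq i : F (inl i) = plus_sob adm (N i).
Proof.
have e : sval (sr (plus_sob adm (N i))) = real (inl i) by [].
by apply: sob_eq; rewrite to_sobE // -e; exact: sob_is_sa.
Qed.

Lemma F_plus i : okl (inl i) -> isPlus (N i) (F (inl i)).
Proof. by move=> _; rewrite F_plus_eq; exact: plus_isPlus. Qed.

Definition adj_rep (M : rep H) : rep H := exist _ (adj (sval M)) (is_rep_adj adm (svalP M)).
Lemma adj_rep_dual (M : rep H) : dual M (adj_rep M).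
Proof. by exists (fun u => erefl). Qed.

(** If i is not chosen, then N i is not isomorphic to its adjoint, and the adjoint is the chosen
    member of the pair. *)
Lemma okl_plus i : (forall T, ~ isoc (N i) (sr T)) ->
  okl (inl i) \/ exists j M', [/\ dual (N i) M', isoc (N j) M' & okl (inl j)].
Proof.
move=> nT; have n0 : ~ in_ind0 ind i by move/in_ind0E => [T /nT].
have [h|h] := pselect (iso (ind i) (adj (ind i))); first by left; exact: I1_self.
have iA : indec (adj_rep (N i)) by exact: indec_dual (adj_rep_dual _) (ind_rep_indec i).
have [j /isoc_sym ij] := ind_rep_complete iA.
have [h1 h2] := I1_pair h ((cisoE adm _ _).2 ij).
have [Ii|nIi] := pselect (I1 i); first by left.
right; exists j, (adj_rep (N i)); split=> //; first exact: adj_rep_dual.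
by apply: contrapT => nIj; apply: nIi; exact: h2.
Qed.

Lemma plus_noform i : okl (inl i) -> forall T, ~ isoc (N i) (sr T).
Proof. by move=> ok T h; apply: (I1_noform ok); apply/in_ind0E; exists T. Qed.

Lemma plus_dual_eq i j M' : okl (inl i) -> okl (inl j) ->
  dual (N j) M' -> isoc (N i) M' -> i = j.
Proof.
move=> Ii Ij d h; have {}h : isoc (N i) (adj_rep (N j)).
  by apply: isoc_trans h _; exact: dual_isoc d (adj_rep_dual _).
have [/(cisoE adm (N j) (adj_rep (N j))) s|ns] := pselect (iso (ind j) (adj (ind j))).
  by apply: ind_rep_inj; exact: isoc_trans h (isoc_sym s).
by have [h1 h2] := I1_pair ns ((cisoE adm _ _).2 h); case: (h1 Ij).
Qed.

(* tau i is the form by which the second summand B^t is twisted. *)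
Variable tau : forall i, Hom (B i) (B i).
Hypothesis tau_tw : forall i, in_ind0 ind i -> cond i true ->
  [/\ is_sa (tw i), isTwist (tau i) (to_sob (tw i)), sadj (tau i) = tau i & isiso (tau i)].

Lemma real_sa l : okl l -> is_sa (real l).
Proof.
case: l => [i|[i []]] /=.
- by move=> _; exact: (sob_is_sa (plus_sob adm (N i))).
- by move=> [h c]; case: (tau_tw h c).
by move=> [h _]; case: (ind0_form h).
Qed.

Lemma F_form i k : okl (inr (i, k)) -> isoc (N i) (F (inr (i, k))).
Proof.
case: k => -[h c]; last exact: B_iso.
have [_ [w [[v [vw wv]] _]] _ _] := tau_tw h c.
by apply: isoc_trans (B_iso h) _; exists v, w.
Qed.

Lemma okl_false i k : okl (inr (i, k)) -> okl (inr (i, false)).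
Proof. by case=> h _; split. Qed.

Lemma okl_form i T : isoc (N i) (sr T) -> okl (inr (i, false)).
Proof. by move=> h; split=> //; apply/in_ind0E; exists T. Qed.

Hypothesis red : forall i (h : in_ind0 ind i) (a : residue (B_indec h)),
  rstar a = a -> a != 0 -> exists x, rstar x * a * x = 1 \/
    cond i true /\ rstar x * a * x = res (B_indec h) (tau i).

Lemma reduce i : okl (inr (i, false)) -> forall f : Hom (B i) (B i), sadj f = f -> isiso f ->
  exists k (g t : Hom (B i) (B i)),
    [/\ okl (inr (i, k)), isTwist t (F (inr (i, k))) & sadj g ∘ f ∘ g = t].
Proof.
case=> h _ f af jf; pose iB := B_indec h.
have a0 : res iB f != 0 by apply/eqP => /(res_eq0 iB).
have [|x hx] := red (a := res iB f) _ a0; first by rewrite rstarE af.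
have [g eg] := res_surj x; rewrite eg rstarE -!resM in hx.
case: hx => [|[c /(res_eqP iB) nu]].
  rewrite -(res1 iB) => /(res_eqP iB) nu.
  have [g' eg'] := @form_lift H (B i) iB f (id_ (B i)) g af (adj1 _) (isiso_id _) nu.
  exists false, g', (id_ (B i)); split=> //.
  by exists (id_ (B i)); split; [exact: isiso_id|rewrite adj1 cmp1m].
have [_ tw_i at_ it] := tau_tw h c.
have [g' eg'] := @form_lift H (B i) iB f (tau i) g af at_ it nu.
by exists true, g', (tau i); split.
Qed.

Lemma real_all ls : List.Forall okl ls -> List.Forall (fun l => is_sa (real l)) ls.
Proof. by apply: List.Forall_impl => l; exact: real_sa. Qed.

Variable once : bool.
Hypothesis pair : once -> forall i (h : in_ind0 ind i), cond i true ->
  exists p q : residue (B_indec h),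
    rstar p * res (B_indec h) (tau i) * p + rstar q * res (B_indec h) (tau i) * q = 1.

Lemma classification_exists A : is_sa A ->
  exists ls, (List.Forall okl ls /\ (once -> at_most_one_twist ls)) /\ congruent A (osum (map real ls)).
Proof.
move=> hA; have [|ls [ok d am]] := exists_decomp ind_rep_indec ind_rep_complete F_plus okl_plus
  F_form okl_form reduce (once := once) _ (to_sob A); last first.
  by exists ls; split=> //; apply/(congruent_map adm hA (real_all ok)).
move=> o i S y1 y2 [h c] hy1 hy2 y12; pose iB := B_indec h.
have [_ [w [[v [vw wv]] ww]] _ _] := tau_tw h c.
have [p [q]] := pair o h c; have [g eg] := res_surj p; have [g' eg'] := res_surj q.
rewrite eg eg' !rstarE -!resM -resD -(res1 iB) => /(res_eqP iB) nu.
(* Each y w^† pulls the form of S back to w w^† = tau. The two copies are orthogonal, so x has the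
   value g^† tau g + g'^† tau g', which is 1 modulo the radical, and [form_lift] makes it exactly
   1. *)
pose x := y1 ∘ sadj w ∘ g + y2 ∘ sadj w ∘ g'.
have y21 := orthC y12.
have xx : sadj x ∘ x = sadj g ∘ tau i ∘ g + sadj g' ∘ tau i ∘ g'.
  rewrite /x adjD !adjM !adjK cmpDl !cmpDr !cmpA (cmpK hy1) (cmpK hy2) (cmpK y12) (cmpK y21).
  by rewrite !cmpm1 !cmpm0 !cmp0m addr0 add0r -ww !cmpA.
rewrite -xx in nu.
have nu' : ~ isiso (sadj (id_ (B i)) ∘ (sadj x ∘ x) ∘ id_ (B i) - id_ (B i)).
  by rewrite adj1 cmp1m cmpm1.
have ax : sadj (sadj x ∘ x) = sadj x ∘ x by rewrite adjM adjK.
have [g2 eg2] := @form_lift H (B i) iB _ _ _ ax (adj1 _) (isiso_id _) nu'.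
by exists (x ∘ g2); rewrite /isom adjM -eg2 !cmpA.
Qed.

Hypothesis sep : forall i (h : in_ind0 ind i), cond i true -> forall zs : seq (residue (B_indec h)),
  (once -> size zs <= 1)%N -> \sum_(z <- zs) rstar z * (res (B_indec h) (tau i))^-1 * z <> 1.

(** A version of [at_most_one_twist] that is visibly invariant under permutations, as the
    cancellation of labels requires. *)
Definition amo (ls : seq L) := once -> forall i rest,
  ~ Permutation ls (inr (i, true) :: inr (i, true) :: rest).

Lemma amo_perm ls ls' : Permutation ls ls' -> amo ls -> amo ls'.
Proof.
by move=> p h o i rest p'; apply: (h o i rest); exact: perm_trans p p'.
Qed.

Lemma amo_tail l ls : amo (l :: ls) -> amo ls.
Proof.
move=> h o i rest p; apply: (h o i (l :: rest)).
apply: perm_trans (perm_skip l p) _.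
apply: perm_trans (perm_swap _ _ _) _.
by apply: perm_skip; exact: perm_swap.
Qed.

Lemma once_amo ls : (once -> at_most_one_twist ls) -> amo ls.
Proof.
move=> h o i rest p; apply: (h o).
pose t : L := inr (i, true).
have inl : List.In t ls.
  by apply: (Permutation_in _ (Permutation_sym p)); left.
have [l1 [l2 els]] := List.in_split _ _ inl.
have p2 : Permutation (l1 ++ l2) (t :: rest).
  apply: (Permutation_cons_inv (a := t)).
  apply: perm_trans p.
  by rewrite els; exact: Permutation_middle.
have h12 : List.In t (l1 ++ l2).
  by apply: (Permutation_in _ (Permutation_sym p2)); left.
case: (List.in_app_or _ _ _ h12) => [h1|h2].
  have [a [b e]] := List.in_split _ _ h1; exists a, b, l2, i.
  by rewrite els e -List.app_assoc.
by have [a [b e]] := List.in_split _ _ h2; exists l1, a, b, i; rewrite els e.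
Qed.

Lemma no_isometry i ls S : okl (inr (i, false)) -> List.Forall okl ls -> amo ls ->
  ~ List.In (inr (i, false)) ls -> decomp S (map F ls) ->
  forall x : Hom (F (inr (i, false))) S, ~ isom x.
Proof.
move=> [h cf] ok am nin d x hx; pose iB := B_indec h; pose l0 : L := inr (i, true).
have irr l : List.In l ls -> l <> l0 -> ~ through (B i) (F l).
  move=> inl nl t; have okl0 := (List.Forall_forall okl ls).1 ok _ inl.
  have {}t : through (N i) (F l).
    have [u [v [vu uv]]] := B_iso h; case: t => a [b [c [c1 c2]]].
    exists (a ∘ u), (v ∘ b); rewrite -cmpA (cmpA b) cmpA; apply: isiso_comp; last by exists v.
    by apply: isiso_comp; [exists u|exists c].
  case: l inl nl okl0 t => [j|[j k]] inl nl okl0 t.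
    have := through_ok ind_rep_indec ind_rep_inj F_plus F_form okl0 t => - [e|[M' [dM iM]]].
      by subst j; apply: (plus_noform okl0 (B_iso h)).
    exact: (plus_noform okl0 (dual_sob dM (isoc_trans (isoc_sym iM) (B_iso h)))).
  have e : i = j := through_ok ind_rep_indec ind_rep_inj F_plus F_form okl0 t.
  by subst j; case: k inl nl okl0 t => inl nl _ _; [case: nl|case: nin].
have [ys [nu s0_ s1_]] := @gram H L F (B i) iB l0 S ls x d irr.
move: nu; rewrite (hx : sadj x ∘ x = id_ (B i)).
have ts : List.In l0 ls -> cond i true by move/(List.Forall_forall okl ls).1: ok => ok /ok [].
have c1 : (0 < size ys)%N -> cond i true.
  by move/s0_ => [l1 [l2 els]]; apply: ts; rewrite els; apply/List.in_or_app; right; left.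
case: ys c1 s0_ s1_ => [|y0 ys0] c1 s0_ s1_.
  by rewrite big_nil subr0; apply; exact: isiso_id.
have c := c1 isT; set ys := y0 :: ys0 in s1_ *.
have [_ [w [[v [vw wv]] ww]] at_ it] := tau_tw h c.
(* The map w identifies B^t with B carrying the form tau^-1: for v = w^-1 one has v^† v = tau^-1, so
   y^† y = z^† tau^-1 z with z = w y. *)
pose z (y : Hom (B i) (F l0)) := res iB (w ∘ y).
move=> /(res_eqP iB _ _).2; rewrite res1.
have -> : res iB (\sum_(y <- ys) sadj y ∘ y) =
    \sum_(t <- map z ys) rstar t * (res iB (tau i))^-1 * t.
  rewrite big_map (big_morph (res iB) (resD iB) (res0 iB)); apply: eq_bigr => y _.
  have ut : res iB (tau i) \is a GRing.unit.
    by apply: residue_unit; apply/eqP => /(res_eq0 iB).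
  have -> : (res iB (tau i))^-1 = res iB (sadj v ∘ v).
    apply: (mulrI ut); rewrite mulrV // -resM -ww !cmpA -(cmpA w) -adjM vw adj1 cmpm1 wv.
    by rewrite res1.
  rewrite /z rstarE -!resM; congr (res iB _).
  rewrite adjM !cmpA -(cmpA _ v w) vw cmpm1 -(cmpA _ (sadj w)) -adjM vw adj1 cmpm1 //.
move/esym; apply: (sep (h := h)) => // o; rewrite size_map leqNgt; apply/negP => /s1_ [l1 [l2 [l3 els]]].
apply: (am o i (l1 ++ l2 ++ l3)); rewrite els.
apply: perm_trans (Permutation_sym (Permutation_middle _ _ _)) _.
apply: perm_skip.
change (Permutation (l1 ++ (l2 ++ l0 :: l3)) (inr (i, true) :: l1 ++ (l2 ++ l3))).
rewrite !catA; exact: (Permutation_sym (Permutation_middle (l1 ++ l2) l3 _)).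
Qed.

Lemma classification_unique A ls ls' : is_sa A ->
  List.Forall okl ls -> List.Forall okl ls' ->
  (once -> at_most_one_twist ls) -> (once -> at_most_one_twist ls') ->
  congruent A (osum (map real ls)) -> congruent A (osum (map real ls')) ->
  Permutation ls ls'.
Proof.
move=> hA ok ok' am am' /(congruent_map adm hA (real_all ok)) d /(congruent_map adm hA (real_all ok')) d'.
exact: (decomp_inj ind_rep_indec ind_rep_inj F_plus F_form okl_false plus_noform plus_dual_eq
  amo_perm amo_tail no_isometry ok ok' (once_amo am) (once_amo am') d d').
Qed.

Lemma classifiesP (ok : seq L -> Prop) A :
  (forall ls, ok ls <-> List.Forall okl ls /\ (once -> at_most_one_twist ls)) ->
  is_sa A -> classifies s0 ind B0 tw ok A.
Proof.
move=> okE hA; split; first by have [ls [/okE h c]] := classification_exists hA; exists ls.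
by move=> ls ls' /okE [ok1 am1] /okE [ok2 am2]; exact: classification_unique.
Qed.

End Classification.

(** * The conditions on T(B) as statements on the residue skew field *)

Section ResidueTranslation.
Variables (X : ctx) (C : lincat (cP X)) (s0 : obj C -> bool) (adm : admissible s0).
Local Notation H := (rep_hcat adm).
Local Notation K := (cK X).
Local Notation P := (cP X).
Local Notation emb := (cemb X).

Variables (S : sob H) (iS : indec S).
Local Notation A := (sval (sr S)).
Local Notation T := (residue iS).
Local Notation crS := (sr S : crep C).
Local Notation rs := (res iS : chom crS crS -> T).

Lemma noninvE (f : chom crS crS) : noninv f <-> ~ isiso (f : Hom S S).
Proof.
split=> h [g]; [case=> gf fg|case=> gP gf]; apply: h.
  exists (hf g); split; first exact: hfP.
  move=> u; split; first exact: (chom_at u gf).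
  exact: (chom_at u fg).
exists (@CHom _ _ crS crS g gP).
by split; apply: chom_ext => u; [exact: (gf u).1|exact: (gf u).2].
Qed.

Lemma modRE (f h : chom crS crS) : modR f h <-> rs f = rs h.
Proof. by rewrite res_eqP -noninvE. Qed.

Lemma point_noniso (f : chom crS crS) u :
  ~ (exists N, f u *m N = 1%:M) -> ~ isiso (f : Hom S S).
Proof.
move=> h [g [_ fg]]; apply: h; exists ((g : chom crS crS) u).
exact: (chom_at u fg).
Qed.

Lemma pos_dim : exists u, (0 < rdim A u)%N.
Proof.
apply: contrapT => h; apply: (indec_nz iS); apply/(is_zeroE adm crS) => u.
by apply/eqP; rewrite -leqn0 leqNgt; apply/negP => lt; apply: h; exists u.
Qed.

(** An isomorphism is invertible at every vertex. Hence T(B) can be studied through a single matrix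
    component. *)
Lemma point_zero (f : chom crS crS) u : (0 < rdim A u)%N -> f u = 0 -> rs f = 0.
Proof.
move=> lt fu; apply/res_eq0; apply: (@point_noniso _ u) => -[N]; rewrite fu mul0mx.
move=> /matrixP/(_ (Ordinal lt) (Ordinal lt))/eqP.
by rewrite !mxE eqxx eq_sym oner_eq0.
Qed.

Definition iota (a : P) : T := rs (cscal adm crS a).

Lemma scalar_embE n a : (emb a)%:M = emb a *: (1%:M : 'M[K]_n).
Proof. by rewrite scalemx1. Qed.

Lemma iotaD a b : iota (a + b) = iota a + iota b.
Proof.
rewrite /iota -resD; congr (res _ _); apply: chom_ext => u /=.
by rewrite (adm_embD adm) raddfD.
Qed.
Lemma iotaM a b : iota (a * b) = iota a * iota b.
Proof.
rewrite /iota -resM; congr (res _ _); apply: chom_ext => u /=.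
by rewrite (adm_embM adm) scalar_mxM.
Qed.
Lemma iota1 : iota 1 = 1.
Proof.
rewrite /iota -(res1 iS); congr (res _ _); apply: chom_ext => u /=.
by rewrite (adm_emb1 adm).
Qed.
Lemma iota0 : iota 0 = 0.
Proof. by apply: (addrI (iota 0)); rewrite -iotaD !addr0. Qed.
Lemma iotaB a b : iota (a - b) = iota a - iota b.
Proof. by apply: (addIr (iota b)); rewrite -iotaD !subrK. Qed.
HB.instance Definition _ := GRing.isZmodMorphism.Build P T iota iotaB.
HB.instance Definition _ := GRing.isMonoidMorphism.Build P T iota (iota1, iotaM).
Definition iota_morph : {rmorphism P -> T} := iota.

Lemma iota_central a t : iota a * t = t * iota a.
Proof.
have [f ->] := res_surj t; rewrite /iota -!resM; congr (res _ _); apply: chom_ext => u /=.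
by rewrite mul_scalar_mx scalar_embE (mulmx_embZ adm) mulmx1.
Qed.
Lemma rstar_iota a : rstar (iota a) = iota (cbarP X a).
Proof.
rewrite /iota rstarE; congr (res _ _); apply: chom_ext => u.
rewrite [LHS]/= scalar_embE (conjTZ adm) (conjT1 adm) castmxZ castmx1.
by rewrite scalemx1.
Qed.
Lemma iota_eq0 a : iota a = 0 -> a = 0.
Proof.
move=> h; apply/eqP; apply: contraT => a0; have := iota1.
by rewrite -(mulfV a0) iotaM h mul0r => /esym/eqP; rewrite oner_eq0.
Qed.

Lemma eadjE e (f : chom crS crS) : @eadj X C A e f = hf (sadj (f : Hom S S) : chom crS crS).
Proof. by apply: functional_extensionality_dep => u; exact: castmx_pi. Qed.

Lemma TB_inv_idE : TB_inv_id A <-> forall t : T, rstar t = t.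
Proof.
split=> [[e h] t|h].
  have [f ->] := res_surj t; rewrite rstarE; apply/(modRE (sadj f : chom _ _) f).
  by rewrite -(eadjE e); apply: h; exact: hfP.
exists (fun u => esym (cdual_dim (sd S) u)) => f fP.
pose F : chom crS crS := @CHom _ _ crS crS f fP.
rewrite -[f]/(hf F) eadjE; apply/modRE; have := h (rs F); rewrite rstarE //.
Qed.

Lemma chom_expE (x : chom crS crS) n u :
  (toEnd (x : Hom S S) ^+ n : chom crS crS) u = epow x n u.
Proof.
elim: n => [|n IH]; first by rewrite expr0.
by rewrite exprS /epow /= -[iter _ _ _]/(epow x n u) -IH.
Qed.

Lemma res_exp (x : Hom S S) n : res iS (toEnd x ^+ n) = res iS x ^+ n.
Proof. by elim: n => [|n IH]; rewrite ?expr0 // !exprS -IH -resM. Qed.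

Lemma chom_sumE J (r : seq J) (F : J -> chom crS crS) u :
  (\sum_(j <- r) F j) u = \sum_(j <- r) F j u.
Proof. by elim: r => [|j r IH]; rewrite ?big_nil // !big_cons -IH. Qed.

Lemma TB_acf_idE : TB_acf_id A <->
  [/\ forall t : T, rstar t = t, forall s t : T, s * t = t * s
    & forall n (c : nat -> T), exists x, x ^+ n.+1 + \sum_(k < n.+1) c k * x ^+ k = 0].
Proof.
have polyE n (c : nat -> chom crS crS) (x : chom crS crS) :
    modR (fun u => epow x n.+1 u + \sum_(i < n.+1) c i u *m epow x i u) (fun u => 0) <->
    rs x ^+ n.+1 + \sum_(k < n.+1) rs (c k) * rs x ^+ k = 0.
  pose Y : chom crS crS := (toEnd (x : Hom S S) ^+ n.+1 : chom _ _) +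
    \sum_(i < n.+1) ccmp (c i) (toEnd (x : Hom S S) ^+ i : chom _ _).
  have -> : (fun u => epow x n.+1 u + \sum_(i < n.+1) c i u *m epow x i u) = hf Y.
    apply: functional_extensionality_dep => u; rewrite /Y /= chom_expE chom_sumE.
    by congr (_ + _); apply: eq_bigr => k _; rewrite /= chom_expE.
  rewrite (modRE Y 0) res0 /Y resD res_exp (big_morph (res iS) (resD iS) (res0 iS)).
  by under eq_bigr => k _ do rewrite resM res_exp.
split=> [[/TB_inv_idE h1 [h2 h3]]|[h1 h2 h3]]; split.
- exact: h1.
- move=> s t; have [f ->] := res_surj s; have [h ->] := res_surj t; rewrite -!resM.
  by apply/(modRE (ccmp f h) (ccmp h f)); apply: h2; exact: hfP.
- move=> n c; have [d hd] := choice (fun k => res_surj (c k)).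
  have [|x [xP hx]] := h3 n (fun k => hf (d k : chom crS crS)); first by move=> k; exact: hfP.
  pose x' : chom crS crS := @CHom _ _ crS crS x xP.
  exists (rs x'); move/(polyE n d x'): hx.
  by under eq_bigr => k _ do rewrite -hd.
- exact/TB_inv_idE.
split=> [f h fP hP|n c cP].
  pose f' : chom crS crS := @CHom _ _ crS crS f fP; pose h' : chom crS crS := @CHom _ _ crS crS h hP.
  by apply/(modRE (ccmp f' h') (ccmp h' f')); rewrite !resM.
pose c' k : chom crS crS := @CHom _ _ crS crS (c k) (cP k).
have [t ht] := h3 n (fun k => rs (c' k)); have [x ex] := res_surj t; rewrite ex in ht.
by exists (hf (x : chom crS crS)); split; [exact: hfP|apply/(polyE n c' x)].
Qed.

Lemma TB_quatE : TB_quat_nonstd A <-> exists i j : T,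
  [/\ i * i = -1, j * j = -1, i * j = - (j * i),
    forall t, exists a b c d, t = iota a + iota b * i + iota c * j + iota d * (i * j) &
    (forall a b c d, iota a + iota b * i + iota c * j + iota d * (i * j) = 0 ->
      [/\ a = 0, b = 0, c = 0 & d = 0]) /\
    ~ (rstar i = - i /\ rstar j = - j)].
Proof.
have combE (i j : chom crS crS) a b c d : quat_comb i j a b c d =
    hf (cscal adm crS a + ccmp (cscal adm crS b) i + ccmp (cscal adm crS c) j
      + ccmp (cscal adm crS d) (ccmp i j)).
  by apply: functional_extensionality_dep => u; rewrite /quat_comb /= !mul_scalar_mx scalemx1.
have one : (fun u => - 1%:M : 'M[K]_(rdim A u)) = hf (- cidm crS) by [].
split=> [[e [i [j [iP [jP [ii [jj [ij [gen [ind ns]]]]]]]]]]|[i [j [ii jj ij gen [ind ns]]]]].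
  pose i' : chom crS crS := @CHom _ _ crS crS i iP; pose j' : chom crS crS := @CHom _ _ crS crS j jP.
  exists (rs i'), (rs j'); split; last split.
  - by rewrite -resM -(res1 iS) -resN; apply/(modRE (ccmp i' i') (- cidm crS)).
  - by rewrite -resM -(res1 iS) -resN; apply/(modRE (ccmp j' j') (- cidm crS)).
  - by rewrite -!resM -resN; apply/(modRE (ccmp i' j') (- ccmp j' i')).
  - move=> t; have [f ->] := res_surj t; have [a [b [c [d h]]]] := gen _ (hfP (f : chom crS crS)).
    exists a, b, c, d; rewrite /iota -!resM -!resD; apply/modRE.
    by move: h; rewrite (combE i' j').
  - move=> a b c d; rewrite /iota -!resM -!resD => h; apply: ind; rewrite (combE i' j').
    by apply/(modRE _ 0); rewrite res0.
  case=> si sj; apply: ns; split.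
    by rewrite (eadjE e i'); apply/(modRE _ (- i')); rewrite resN -si rstarE.
  by rewrite (eadjE e j'); apply/(modRE _ (- j')); rewrite resN -sj rstarE.
have [f fi] := res_surj i; have [g gj] := res_surj j; subst i j.
pose f' : chom crS crS := f; pose g' : chom crS crS := g.
exists (fun u => esym (cdual_dim (sd S) u)), (hf f'), (hf g').
split; first exact: hfP; split; first exact: hfP.
split; first by apply/(modRE (ccmp f' f') (- cidm crS)); rewrite resM resN; exact: ii.
split; first by apply/(modRE (ccmp g' g') (- cidm crS)); rewrite resM resN; exact: jj.
split; first by apply/(modRE (ccmp f' g') (- ccmp g' f')); rewrite resN !resM; exact: ij.
split.
  move=> h hP; pose h' : chom crS crS := @CHom _ _ crS crS h hP.
  have [a [b [c [d e]]]] := gen (rs h'); exists a, b, c, d.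
  by rewrite combE; apply/(modRE h'); rewrite e !resD !resM.
split.
  move=> a b c d; rewrite combE => /(modRE _ 0); rewrite !resD !resM res0 => h.
  exact: ind h.
rewrite !eadjE => -[/(modRE _ (- f')) h1 /(modRE _ (- g')) h2]; apply: ns.
by rewrite !rstarE h1 h2 !resN.
Qed.
End ResidueTranslation.

(** * Concrete twists; algebraicity and finiteness of T(B) *)

Section Twists.
Variables (X : ctx) (C : lincat (cP X)) (s0 : obj C -> bool) (adm : admissible s0).
Local Notation H := (rep_hcat adm).
Local Notation K := (cK X).
Local Notation P := (cP X).
Local Notation emb := (cemb X).
Implicit Types (S : sob H) (A : rdata X C).

Lemma to_sob_sob S : to_sob adm (sval (sr S)) = S.
Proof. by apply: sob_eq; rewrite to_sobE //; exact: sob_is_sa. Qed.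

Lemma twist_data S A (e : sval (sr S) = A) (f g : forall u, 'M[K]_(rdim A u)) : sa_auto f g ->
  exists t : Hom S S, [/\ is_sa (rtwist s0 f g), isTwist t (to_sob adm (rtwist s0 f g)),
    sadj t = t, isiso t & TB_nonsquare f -> forall (iS : indec S) (s : residue iS), s * s <> res iS t].
Proof.
case: A / e f g => f g [fP [fg [e af]]].
pose F : chom (sr S : crep C) (sr S : crep C) := @CHom _ _ (sr S : crep C) (sr S : crep C) f fP.
have aF : sadj (F : Hom S S) = F.
  by apply: chom_ext => u; rewrite -(eadjE e F) /= af.
pose T := twist_sob fg aF.
have eT : sval (sr T) = rtwist s0 f g by [].
exists F; split=> //.
- by rewrite -eT; exact: sob_is_sa.
- by rewrite -eT to_sob_sob; exact: twist_isTwist.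
- exists (@CHom _ _ (sr S : crep C) (sr S : crep C) g (morph_inv fP fg)).
  by split; apply: chom_ext => u; [exact: (fg u).1|exact: (fg u).2].
move=> ns iS t; have [s ->] := res_surj t; rewrite -resM => h; apply: ns.
exists (hf (s : chom _ _)); split; first exact: hfP.
by apply/(modRE iS (ccmp (s : chom _ _) s) F).
Qed.

Lemma twist_neg S A (e : sval (sr S) = A) :
  let tw := @rtwist X C s0 A (fun u => - 1%:M) (fun u => - 1%:M) in
  [/\ is_sa tw, isTwist (- id_ S) (to_sob adm tw), sadj (- id_ S) = - id_ S & isiso (- id_ S)].
Proof.
case: A / e => tw.
have fP : @is_morph X C (sval (sr S)) (sval (sr S)) (fun u => - 1%:M).
  by move=> u v a; rewrite mulNmx mulmxN mul1mx mulmx1.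
have fg u : (- 1%:M : 'M[K]_(rdim (sval (sr S)) u)) *m (- 1%:M) = 1%:M /\
    (- 1%:M : 'M[K]_(rdim (sval (sr S)) u)) *m (- 1%:M) = 1%:M.
  by rewrite mulNmx mulmxN opprK mulmx1.
have aF : sadj (@CHom _ _ (sr S : crep C) (sr S : crep C) _ fP : Hom S S) =
    (@CHom _ _ (sr S : crep C) (sr S : crep C) _ fP : Hom S S).
  have -> : (@CHom _ _ (sr S : crep C) (sr S : crep C) _ fP : Hom S S) = - id_ S by exact: chom_ext.
  by rewrite adjN adj1.
have FN : (@CHom _ _ (sr S : crep C) (sr S : crep C) _ fP : Hom S S) = - id_ S by exact: chom_ext.
pose T := twist_sob fg aF.
have eT : sval (sr T) = tw by [].
split.
- by rewrite -eT; exact: sob_is_sa.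
- by rewrite -eT to_sob_sob -FN; exact: twist_isTwist.
- by rewrite adjN adj1.
by apply: isisoN; exact: isiso_id.
Qed.

Variables (S0 : sob H) (iS : indec S0).
Local Notation T := (residue iS).
Local Notation crS := (sr S0 : crep C).

(* The powers of a single nonzero matrix component already satisfy a linear
   relation over P. *)
Lemma residue_algebraic (n : nat) (gen : 'I_n -> K) :
  (forall x : K, exists c : 'I_n -> P, x = \sum_j emb (c j) * gen j) ->
  forall t : T, exists p : {poly P}, p != 0 /\ (map_poly (iota iS) p).[t] = 0.
Proof.
move=> hgen t; have [f ft] := res_surj t; have [u lt] := pos_dim iS.
have [co hco] := choice hgen.
pose m := rdim (sval (sr S0)) u; pose J := ('I_m * 'I_m * 'I_n)%type.
pose pw k : chom crS crS := toEnd (f : Hom S0 S0) ^+ k.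
pose W : 'M[P]_(#|{: J}|.+1, #|{: J}|) :=
  \matrix_(k, j) co (pw k u (enum_val j).1.1 (enum_val j).1.2) (enum_val j).2.
have [v v0 vW] : exists2 v : 'rV[P]_(#|{: J}|.+1), v != 0 & v *m W = 0.
  have : kermx W != 0.
    by rewrite -mxrank_eq0 mxrank_ker subn_eq0 -ltnNge ltnS rank_leq_col.
  by case/rowV0Pn => v /sub_kermxP vW v0; exists v.
exists (rVpoly v); split.
  by apply: contraNneq v0 => p0; rewrite -[v]rVpolyK p0 linear0.
have -> : (map_poly (iota iS) (rVpoly v)).[t] = \sum_(k < #|{: J}|.+1) iota iS (v 0 k) * t ^+ k.
  rewrite /rVpoly poly_def rmorph_sum horner_sum; apply: eq_bigr => k _.
  by rewrite valK /= map_polyZ hornerZ /= map_polyXn hornerXn.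
rewrite ft.
have -> : \sum_(k < #|{: J}|.+1) iota iS (v 0 k) * res iS f ^+ k =
    res iS (\sum_(k < #|{: J}|.+1) (ccmp (cscal adm crS (v 0 k)) (pw k) : Hom S0 S0)).
  rewrite (big_morph (res iS) (resD iS) (res0 iS)); apply: eq_bigr => k _.
  by rewrite -(res_exp iS) -resM.
have emb0 : emb 0 = 0 by apply: (addrI (emb 0)); rewrite -(adm_embD adm) !addr0.
pose g k : chom crS crS := ccmp (cscal adm crS (v 0 k)) (pw k).
apply: (@point_zero X C s0 adm S0 iS (\sum_(k < #|{: J}|.+1) g k) u lt).
rewrite chom_sumE; apply/matrixP => a b; rewrite summxE mxE.
transitivity (\sum_(k < #|{: J}|.+1) \sum_(j < n) emb (v 0 k * co (pw k u a b) j) * gen j).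
  apply: eq_bigr => k _; rewrite /= mul_scalar_mx mxE [X in _ * X]hco mulr_sumr.
  by apply: eq_bigr => j _; rewrite (adm_embM adm) mulrA.
rewrite exchange_big /= big1 // => j _; rewrite -mulr_suml.
rewrite -(big_morph emb (adm_embD adm) emb0).
have := congr1 (fun M : 'rV[P]_(#|{: J}|) => M 0 (enum_rank (a, b, j))) vW.
rewrite mxE [in RHS]mxE => e; rewrite (_ : \sum_i _ = 0) ?emb0 ?mul0r // -[RHS]e.
by apply: eq_bigr => k _; rewrite /W [in RHS]mxE enum_rankK.
Qed.

(** Endomorphisms with the same component at u differ by one that vanishes there, hence agree in
    T(B). Over a finite K this makes T(B) finite. *)
Lemma residue_injection u : (0 < rdim (sval crS) u)%N ->
  injective (fun t : T => (repr t : chom crS crS) u).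
Proof.
move=> lt s t e; rewrite -[s]reprK -[t]reprK.
pose d : chom crS crS := (repr s : chom crS crS) - (repr t : chom crS crS).
apply/(res_eqP iS)/(res_eq0 iS); apply: (@point_zero X C s0 adm S0 iS d u lt).
by rewrite /d /= e subrr.
Qed.

End Twists.

(** * Hermitian forms in one variable *)

Section ClosedInvolution.
Variables (K : closedFieldType) (bar : K -> K).
Hypothesis two : 1 + 1 != 0 :> K.
Hypothesis barK : involutive bar.
Hypothesis barD : forall a b, bar (a + b) = bar a + bar b.
Hypothesis barM : forall a b, bar (a * b) = bar b * bar a.

Lemma closed_sqrt (a : K) : exists s, s * s = a.
Proof.
have [s] := @solve_monicpoly K 2 (fun k => if k == 0 then a else 0) isT.
by rewrite !big_ord_recl big_ord0 /= mulr1 mul0r !addr0 expr2 => <-; exists s.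
Qed.

Lemma add_self_neq0 (a : K) : a != 0 -> a + a <> 0.
Proof.
move=> a0; rewrite -[a]mul1r -mulrDl => /eqP; rewrite mulf_eq0 (negPf a0) orbF.
exact/negP.
Qed.

Let b0 : bar 0 = 0.
Proof. by apply: (addrI (bar 0)); rewrite -barD !addr0. Qed.
Let bN a : bar (- a) = - bar a.
Proof.
by apply: (addrI (bar a)); rewrite -barD !subrr.
Qed.
Let b1 : bar 1 = 1.
Proof. by have := barM (bar 1) 1; rewrite mulr1 barK mulr1. Qed.

Lemma sqr_eq (a b : K) : a * a = b * b -> a = b \/ a = - b.
Proof. by move/eqP; rewrite -!expr2 eqf_sqr => /orP [] /eqP; [left|right]. Qed.

(** Take e with e^2 = a^-1. As a is symmetric, bar e has the same square, so bar e is e or -e. *)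
Lemma closed_norm_pm_one (a : K) : bar a = a -> a != 0 ->
  exists e, bar e * a * e = 1 \/ bar e * a * e = -1.
Proof.
move=> sa a0; have [e ee] := closed_sqrt a^-1; exists e.
have : bar e * bar e = e * e.
  rewrite -barM ee; apply: (mulIf a0); rewrite mulVf // -{2}sa -barM mulfV ?b1 //.
have eae : e * a * e = 1 by rewrite mulrAC ee mulVf.
by case/sqr_eq => ->; [left|right; rewrite !mulNr]; rewrite eae.
Qed.

Hypothesis bar_nonid : exists x, bar x != x.

(** Suppose bar i = i, and let e^2 = x - bar x with x not fixed. Then bar e squares to -e^2 = (i
    e)^2, so bar e is i e or -i e; applying bar once more gives e = -e. *)
Lemma bar_imaginary (i : K) : i * i = -1 -> bar i = - i.
Proof.
move=> ii; have : bar i * bar i = i * i by rewrite -barM ii bN b1.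
case/sqr_eq => // bi; have [x nx] := bar_nonid.
have [e ee] := closed_sqrt (x - bar x).
have be : bar e * bar e = (i * e) * (i * e).
  by rewrite -barM ee barD bN barK mulrACA ii ee mulN1r opprB.
have e0 : e != 0 by apply: contraNneq nx => e0; rewrite eq_sym -subr_eq0 -ee e0 mulr0.
have iei : i * e * i = - e by rewrite mulrAC ii mulN1r.
have : e = - e.
  by case: (sqr_eq be) => h; rewrite -{1}[e]barK {1}h ?bN barM bi h ?mulNr iei ?opprK.
by move/eqP; rewrite -addr_eq0 => /eqP /(add_self_neq0 e0).
Qed.

(** Every norm is the square of a symmetric element, and s^2 + t^2 is the norm of s + i t for
    symmetric s and t; so a sum of norms is again such a square. If it were -1, a symmetric root of
    -1 would exist. *)
Lemma closed_norm_sum (zs : seq K) : 1 + \sum_(z <- zs) bar z * z <> 0.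
Proof.
have [i ii] := closed_sqrt (-1); have bi := bar_imaginary ii.
have normE w : exists2 s, bar s = s & bar w * w = s * s.
  have [v <-] := closed_sqrt w; exists (bar v * v); first by rewrite barM barK.
  by rewrite barM mulrACA.
suff [s bs ->] : exists2 s, bar s = s & \sum_(z <- zs) bar z * z = s * s.
  move/eqP; rewrite addrC addr_eq0 => /eqP ss.
  have s0 : s != 0 by apply/eqP => s0; move/eqP: ss; rewrite s0 mul0r eq_sym oppr_eq0 oner_eq0.
  have /eqP := bar_imaginary ss; rewrite bs -addr_eq0 => /eqP; exact: add_self_neq0.
elim: zs => [|z zs [s bs IH]].
  by exists 0; rewrite ?big_nil ?mulr0.
have [t bt zt] := normE z.
have [r br e] := normE (s + i * t); exists r => //.
by rewrite big_cons IH zt -e barD barM bs bt bi; ring: ii.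
Qed.
End ClosedInvolution.

Section FiniteOfInjection.
Variables (T : unitRingType) (fT : finType) (f : T -> fT) (f_inj : injective f).
Hypothesis divT : forall x : T, x != 0 -> x \is a GRing.unit.

Lemma finite_square_class (t : T) : t != 0 -> (forall s, s * s <> t) ->
  forall a, a != 0 -> exists x, x * a * x = 1 \/ x * a * x = t.
Proof.
have [T' e] := finUnitRing_of_inj f_inj; subst T => t0 nt a a0.
exact: fin_square_class.
Qed.

Lemma finite_two_squares (t : T) : t != 0 -> exists p q, p * t * p + q * t * q = 1.
Proof.
have [T' e] := finUnitRing_of_inj f_inj; subst T; exact: fin_two_squares.
Qed.

Lemma finite_norm_one (st : T -> T) (a : T) : involutive st ->
  (forall x y, st (x + y) = st x + st y) -> (forall x y, st (x * y) = st y * st x) ->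
  (exists z, st z <> z) -> st a = a -> a != 0 -> exists x, st x * a * x = 1.
Proof.
have [T' e] := finUnitRing_of_inj f_inj; subst T; exact: fin_norm_one.
Qed.
End FiniteOfInjection.

(** Nonnegative elements are squares, so b preserves the order, and a monotone involution is the
    identity. *)
Lemma rcf_involution_id (P : rcfType) (b : P -> P) : involutive b ->
  (forall x y, b (x + y) = b x + b y) -> (forall x y, b (x * y) = b x * b y) ->
  forall x, b x = x.
Proof.
move=> bK bD bM.
have bB x y : b (x - y) = b x - b y by apply: (addIr (b y)); rewrite -bD !subrK.
have pos x : (0 <= x)%O -> (0 <= b x)%O.
  by move=> x0; rewrite -(Num.Theory.sqr_sqrtr x0) expr2 bM -expr2 Num.Theory.sqr_ge0.
have le x y : (x <= y)%O -> (b x <= b y)%O.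
  by rewrite -Num.Theory.subr_ge0 => /pos; rewrite bB Num.Theory.subr_ge0.
move=> x; apply/eqP; rewrite Order.POrderTheory.eq_le.
have /orP [h|h] := Order.TotalTheory.le_total x (b x).
  by have := le _ _ h; rewrite bK h andbT.
by have := le _ _ h; rewrite bK h => ->.
Qed.

Section ClosedScalars.
Variables (K : closedFieldType) (bar barP : K -> K).
Let X := Ctx K K (fun x : K => x) bar barP.
Variables (C : lincat (cP X)) (s0 : obj C -> bool) (adm : admissible s0).
Variables (S : sob (rep_hcat adm)) (iS : indec S).

(** At a vertex of positive dimension f has an eigenvalue c; there f - c is singular, so it lies in
    the radical. *)
Lemma closed_residue_scalar (t : residue iS) : exists c : K, t = iota iS c.
Proof.
have [f ->] := res_surj t; have [u lt] := pos_dim iS.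
pose crS := (sr S : crep C); pose M : 'M[K]_(rdim (sval crS) u) := (f : chom crS crS) u.
have : size (char_poly M) != 1 by rewrite size_char_poly; case: (rdim _ _) lt.
move=> /closed_rootP [c]; rewrite -eigenvalue_root_char => /eigenvalueP [v /eqP vM v0].
exists c; apply/res_eqP.
pose d : chom crS crS := (f : chom crS crS) - cscal adm crS c.
apply: (@point_noniso X C s0 adm S d u) => -[N dN].
have : v *m d u = 0 by rewrite /d /= mulmxBr (eqP vM) mul_mx_scalar subrr.
move=> vd; move: v0; rewrite -[v]mulmx1; have := congr1 (mulmx v) dN.
by rewrite mulmxA vd mul0mx => <-; rewrite eqxx.
Qed.
End ClosedScalars.

(** * The four classes of fields *)

Section NegativeTwist.
Variables (X : ctx) (C : lincat (cP X)) (s0 : obj C -> bool) (adm : admissible s0).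
Variables (I : Type) (ind : I -> rdata X C) (I1 : I -> Prop) (B0 : I -> rdata X C).
Hypothesis hind : ind_setup ind I1 B0.
Variable cond : I -> bool -> Prop.
Hypothesis cond_false : forall i, cond i false.
Local Notation iB h := (B_indec adm hind h).

Hypothesis red : forall i (h : in_ind0 ind i) (a : residue (iB h)),
  rstar a = a -> a != 0 -> exists x, rstar x * a * x = 1 \/ cond i true /\ rstar x * a * x = -1.
Hypothesis sep : forall i (h : in_ind0 ind i), cond i true ->
  forall zs : seq (residue (iB h)), 1 + \sum_(z <- zs) rstar z * z <> 0.

(** For t = -1 the separation condition becomes the absence of relations 1 + sum of z° z = 0. *)
Lemma classifies_neg A : is_sa A ->
  classifies s0 ind B0 (fun i => @rtwist X C s0 (B0 i) (fun u => - 1%:M) (fun u => - 1%:M))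
    (fun ls => List.Forall (lab_ok ind I1 cond) ls) A.
Proof.
move=> hA; pose tau i := - id_ (to_sob adm (B0 i)).
have tau_tw i : in_ind0 ind i -> cond i true ->
    [/\ is_sa (@rtwist X C s0 (B0 i) (fun u => - 1%:M) (fun u => - 1%:M)),
      isTwist (tau i) (to_sob adm (@rtwist X C s0 (B0 i) (fun u => - 1%:M) (fun u => - 1%:M))),
      sadj (tau i) = tau i & isiso (tau i)].
  move=> h _; have [sB _] := ind0_form hind h.
  exact: (@twist_neg _ _ _ adm (to_sob adm (B0 i)) (B0 i) (to_sobE adm sB)).
have resN1 i (h : in_ind0 ind i) : res (iB h) (tau i) = -1 by rewrite resN.
have red' i (h : in_ind0 ind i) (a : residue (iB h)) : rstar a = a -> a != 0 ->
    exists x, rstar x * a * x = 1 \/ cond i true /\ rstar x * a * x = res (iB h) (tau i).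
  by move=> sa a0; have [x hx] := red sa a0; exists x; rewrite resN1.
have sep' i (h : in_ind0 ind i) : cond i true -> forall zs : seq (residue (iB h)),
    (false -> size zs <= 1)%N -> \sum_(z <- zs) rstar z * (res (iB h) (tau i))^-1 * z <> 1.
  move=> c zs _; rewrite resN1 invrN1 => e; apply: (sep (h := h) c (zs := zs)).
  rewrite -e -big_split big1 // => z _; rewrite mulrN1 mulNr; exact: addNr.
apply: (classifiesP cond_false tau_tw red' (once := false) _ sep') => // ls.
by split=> [|[]].
Qed.
End NegativeTwist.

Lemma ctx_admissible_comm (K : fieldType) (bar : K -> K) : (2%:R : K) != 0 -> is_involution bar ->
  let X := Ctx K K (fun x : K => x) bar bar in
  forall (C : lincat (cP X)) (s0 : obj C -> bool),
  is_lincat_inv (cbarP X) C -> is_partition s0 -> admissible s0.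
Proof.
move=> two barI X C s0 hC hs; split=> //=; first by move=> x; rewrite unitfE.
by move=> a x; rewrite mulrC.
Qed.

Lemma classification_closed_id (K : closedFieldType) : (2%:R : K) != 0 ->
  let X := Ctx K K (fun x : K => x) (fun x : K => x) (fun x : K => x) in
  forall (C : lincat (cP X)) (s0 : obj C -> bool) (I : Type)
    (ind : I -> rdata X C) (I1 : I -> Prop) (B0 : I -> rdata X C),
  setup s0 ind I1 B0 ->
  forall A : rdata X C, is_sa A ->
  classifies s0 ind B0 B0
    (fun ls => List.Forall (lab_ok ind I1 (fun i k => k = false)) ls) A.
Proof.
move=> two X C s0 I ind I1 B0 [hC [hs hind]] A hA.
have barI : is_involution (fun x : K => x) by split=> //; split=> // a b; exact: mulrC.
have adm : admissible s0 := @ctx_admissible_comm K _ two barI C s0 hC hs.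
pose cond (i : I) k := k = false.
have cf i : cond i false by [].
(* A placeholder: [cond] excludes the twisted label. *)
pose tau i := id_ (to_sob adm (B0 i)).
have tau_tw i : in_ind0 ind i -> cond i true ->
  [/\ is_sa (B0 i), isTwist (tau i) (to_sob adm (B0 i)), sadj (tau i) = tau i & isiso (tau i)] by [].
have red i (h : in_ind0 ind i) (a : residue (B_indec adm hind h)) : rstar a = a -> a != 0 ->
    exists x, rstar x * a * x = 1 \/ cond i true /\ rstar x * a * x = res (B_indec adm hind h) (tau i).
  move=> _; have [c ->] := @closed_residue_scalar K _ _ C s0 adm _ (B_indec adm hind h) a.
  move=> c0; have {}c0 : c != 0 by apply: contraNneq c0 => ->; rewrite iota0.
  have [e ee] := closed_sqrt c^-1; exists (iota (B_indec adm hind h) e); left.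
  by rewrite rstar_iota -!iotaM /= mulrAC ee mulVf ?iota1.
apply: (classifiesP cf tau_tw red (once := false)) => // ls.
by split=> [|[]].
Qed.

Lemma classification_closed_nonid (K : closedFieldType) (bar : K -> K) : (2%:R : K) != 0 ->
  is_involution bar -> (exists x : K, bar x != x) ->
  let X := Ctx K K (fun x : K => x) bar bar in
  forall (C : lincat (cP X)) (s0 : obj C -> bool) (I : Type)
    (ind : I -> rdata X C) (I1 : I -> Prop) (B0 : I -> rdata X C),
  setup s0 ind I1 B0 ->
  forall A : rdata X C, is_sa A ->
  classifies s0 ind B0
    (fun i => @rtwist X C s0 (B0 i) (fun u => - 1%:M) (fun u => - 1%:M))
    (fun ls => List.Forall (lab_ok ind I1 (fun i k => True)) ls) A.
Proof.
move=> two barI bar_nonid X C s0 I ind I1 B0 [hC [hs hind]] A hA.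
have adm : admissible s0 := @ctx_admissible_comm K _ two barI C s0 hC hs.
have [barK [barD barM]] := barI.
apply: (@classifies_neg X C s0 adm I ind I1 B0 hind (fun _ _ => True)) => // i h.
  move=> a; have [c ->] := @closed_residue_scalar K _ _ C s0 adm _ (B_indec adm hind h) a.
  rewrite rstar_iota /= => /eqP; rewrite -subr_eq0 -iotaB => /eqP /iota_eq0 /eqP.
  rewrite subr_eq0 => /eqP bc c0.
  have {}c0 : c != 0 by apply: contraNneq c0 => ->; rewrite iota0.
  have [e he] := closed_norm_pm_one barK barM bc c0.
  exists (iota (B_indec adm hind h) e); rewrite rstar_iota -!iotaM /=.
  by case: he => ->; [left|right; split=> //]; rewrite ?raddfN /= iota1.
move=> _ zs; set iB := B_indec adm hind h.
have [d dz] := choice (@closed_residue_scalar K _ _ C s0 adm _ iB).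
have -> : 1 + \sum_(z <- zs) rstar z * z = iota iB (1 + \sum_(z <- map d zs) bar z * z).
  rewrite raddfD /= iota1 raddf_sum big_map; congr (_ + _); apply: eq_bigr => z _.
  by rewrite {1 2}[z]dz rstar_iota -iotaM.
by move/iota_eq0; exact: (closed_norm_sum two barK barD barM bar_nonid).
Qed.

Lemma classification_real (K : unitRingType) (P : rcfType) (emb : P -> K) (bar : K -> K) (barP : P -> P) :
  (forall x : K, x != 0 -> x \is a GRing.unit) ->
  (forall a b, emb (a + b) = emb a + emb b) ->
  (forall a b, emb (a * b) = emb a * emb b) -> emb 1 = 1 ->
  (forall x : K, (forall y : K, x * y = y * x) <-> exists a, x = emb a) ->
  ((forall x : K, exists a, x = emb a) \/
   (exists i j : K, i * i = -1 /\ j * j = -1 /\ i * j = - (j * i) /\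
      forall x : K, exists a b c d,
        x = emb a + emb b * i + emb c * j + emb d * (i * j))) ->
  is_involution bar -> (forall a, emb (barP a) = bar (emb a)) ->
  let X := Ctx K P emb bar barP in
  forall (C : lincat (cP X)) (s0 : obj C -> bool) (I : Type)
    (ind : I -> rdata X C) (I1 : I -> Prop) (B0 : I -> rdata X C),
  setup s0 ind I1 B0 ->
  forall A : rdata X C, is_sa A ->
  classifies s0 ind B0
    (fun i => @rtwist X C s0 (B0 i) (fun u => - 1%:M) (fun u => - 1%:M))
    (fun ls => List.Forall (lab_ok ind I1
       (fun i k => k = true -> ~ (TB_acf_id (B0 i) \/ TB_quat_nonstd (B0 i)))) ls) A.
Proof.
move=> divK embD embM emb1 cen gen barI embbar X C s0 I ind I1 B0 [hC [hs hind]] A hA.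
have emb_central a x : emb a * x = x * emb a.
  by have /(_ x) := (cen (emb a)).2 (ex_intro _ a erefl).
have adm : admissible s0.
  by split=> //=; rewrite -[1 + 1]/(2%:R) pnatr_eq0.
have [barK [barD barM]] := barI.
have emb_inj a b : emb a = emb b -> a = b.
  move=> e; apply/eqP; rewrite -subr_eq0; apply: contraT => d0.
  have e0 : emb 0 = 0 by apply: (addrI (emb 0)); rewrite -embD !addr0.
  have : emb (a - b) = 0 by apply: (addIr (emb b)); rewrite -embD subrK add0r.
  move=> h; have := emb1; rewrite -(mulVf d0) embM h mulr0 => /esym/eqP.
  by rewrite oner_eq0.
(* A real closed center admits no other involution, so the scalars of T(B) are symmetric. *)
have barP_id a : barP a = a.
  apply: rcf_involution_id => [x|x y|x y]; apply: emb_inj.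
  - by rewrite !embbar barK.
  - by rewrite embD !embbar embD barD.
  - by rewrite embM !embbar embM barM -!embbar emb_central.
have [n [g hg]] : exists n (g : 'I_n -> K), forall x, exists c : 'I_n -> P, x = \sum_j emb (c j) * g j.
  case: gen => [h|[i [j [_ [_ [_ h]]]]]].
    exists 1, (fun=> 1) => x; have [a ->] := h x.
    by exists (fun=> a); rewrite big_ord1 mulr1.
  exists 4, (fun k => [:: 1; i; j; i * j]`_k) => x; have [a [b [c [d ->]]]] := h x.
  exists (fun k => [:: a; b; c; d]`_k).
  by rewrite !big_ord_recl big_ord0 /= mulr1 addr0 !addrA.
pose cond (i : I) k := k = true -> ~ (TB_acf_id (B0 i) \/ TB_quat_nonstd (B0 i)).
pose io i (h : in_ind0 ind i) : {rmorphism P -> residue (B_indec adm hind h)} :=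
  iota_morph (B_indec adm hind h).
have st_io i (h : in_ind0 ind i) a : rstar (io i h a) = io i h a.
  by rewrite [LHS]rstar_iota /= barP_id.
have alg i (h : in_ind0 ind i) (t : residue (B_indec adm hind h)) :
    exists p : {poly P}, p != 0 /\ (map_poly (io i h) p).[t] = 0 :=
  @residue_algebraic X C s0 adm _ (B_indec adm hind h) n g hg t.
have ioC i (h : in_ind0 ind i) a t : io i h a * t = t * io i h a := @iota_central X C s0 adm _ _ a t.
have stP i (h : in_ind0 ind i) := rstarP (B_indec adm hind h).
(* The condition allowing t = -1 says exactly that the symmetric elements of T(B) are scalar. *)
have symP i (h : in_ind0 ind i) : cond i true <->
    forall t : residue (B_indec adm hind h), rstar t = t -> scalar (io i h) t.
  have [sB _] := ind0_form hind h.
  have [stK stD stM] := stP i h.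
  rewrite (sym_scalarP (@residue_unit _ _ _) (ioC i h) (alg i h) stK stD stM (st_io i h)).
  have := TB_acf_idE (B_indec adm hind h); have := TB_quatE (B_indec adm hind h).
  rewrite to_sobE // => e2 e1.
  split=> [/(_ erefl) nq q|nq _ q]; apply: nq; case: q => [/e1|/e2]; by [left|right].
apply: (@classifies_neg X C s0 adm I ind I1 B0 hind cond) => // i h.
  have [stK stD stM] := stP i h.
  move=> a sa a0.
  (* If symmetric elements are scalar, the sign decides between 1 and -1; otherwise there is a
     symmetric root of -1, and every nonzero symmetric element is congruent to 1. *)
  have [sc|/existsNP [t /not_implyP [st nt]]] :=
    pselect (forall t : residue (B_indec adm hind h), rstar t = t -> scalar (io i h) t).
    have [x [e|e]] := sym_pm_one (st_io i h) sc sa a0; exists x; [by left|right; split=> //].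
    exact/symP.
  have [_ [_ [j [_ _ sj jj]]]] :=
    sym_imaginary (@residue_unit _ _ _) (ioC i h) (alg i h) stD stM (st_io i h) st nt.
  have [x e] := sym_one (@residue_unit _ _ _) (ioC i h) (alg i h) stD stM (st_io i h) sj jj sa a0.
  by exists x; left.
move=> /(symP i h) sc zs; have [stK stD stM] := stP i h.
exact: (no_neg_norm_sum (@residue_unit _ _ _) (ioC i h) stK stD stM (st_io i h) sc).
Qed.

Lemma classification_finite (K : finFieldType) (bar : K -> K) : (2%:R : K) != 0 ->
  is_involution bar ->
  let X := Ctx K K (fun x : K => x) bar bar in
  forall (C : lincat (cP X)) (s0 : obj C -> bool) (I : Type)
    (ind : I -> rdata X C) (I1 : I -> Prop) (B0 : I -> rdata X C)
    (f0 g0 : forall i u, 'M[cK X]_(rdim (B0 i) u)),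
  setup s0 ind I1 B0 ->
  (forall i, in_ind0 ind i -> TB_inv_id (B0 i) ->
     sa_auto (f0 i) (g0 i) /\ TB_nonsquare (f0 i)) ->
  forall A : rdata X C, is_sa A ->
  classifies s0 ind B0
    (fun i => rtwist s0 (f0 i) (g0 i))
    (fun ls => List.Forall (lab_ok ind I1 (fun i k => k = true -> TB_inv_id (B0 i))) ls
               /\ at_most_one_twist ls) A.
Proof.
move=> two barI X C s0 I ind I1 B0 f0 g0 [hC [hs hind]] hf A hA.
have adm : admissible s0 := @ctx_admissible_comm K _ two barI C s0 hC hs.
pose cond (i : I) k := k = true -> TB_inv_id (B0 i).
have cf i : cond i false by [].
pose S i := to_sob adm (B0 i).
have sS i : in_ind0 ind i -> sval (sr (S i)) = B0 i.
  move=> h; have [sB _] := ind0_form hind h.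
  exact: to_sobE.
have tau_ex i : exists t : Hom (S i) (S i), in_ind0 ind i -> cond i true ->
    [/\ is_sa (rtwist s0 (f0 i) (g0 i)), isTwist t (to_sob adm (rtwist s0 (f0 i) (g0 i))),
      sadj t = t, isiso t & forall (iS : indec (S i)) (s : residue iS), s * s <> res iS t].
  have [[h c]|n] := pselect (in_ind0 ind i /\ cond i true); last first.
    (* A default value for labels at which no twist is allowed. *)
    by exists 0 => h c; case: n.
  have [sf nf] := hf i h (c erefl).
  by have [t [h1 h2 h3 h4 h5]] := twist_data (sS i h) sf; exists t => _ _; split=> //; exact: h5.
pose tau i := projT1 (cid (tau_ex i)).
have tauP i : in_ind0 ind i -> cond i true -> _ := projT2 (cid (tau_ex i)).
have tau_tw i : in_ind0 ind i -> cond i true ->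
    [/\ is_sa (rtwist s0 (f0 i) (g0 i)), isTwist (tau i) (to_sob adm (rtwist s0 (f0 i) (g0 i))),
      sadj (tau i) = tau i & isiso (tau i)].
  by move=> h c; have [] := tauP i h c.
have stP i (h : in_ind0 ind i) := rstarP (B_indec adm hind h).
have idE i (h : in_ind0 ind i) : TB_inv_id (B0 i) <->
    forall t : residue (B_indec adm hind h), rstar t = t.
  by have := TB_inv_idE (B_indec adm hind h); rewrite sS.
have fin i (h : in_ind0 ind i) : exists (fT : finType) (f : residue (B_indec adm hind h) -> fT), injective f.
  have [u lt] := pos_dim (B_indec adm hind h).
  exists ('M[K]_(rdim (sval (sr (S i))) u) : finType); eexists.
  exact: (@residue_injection X C s0 adm _ (B_indec adm hind h) u lt).
have tau0 i (h : in_ind0 ind i) : cond i true -> res (B_indec adm hind h) (tau i) != 0.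
  by move=> c; apply/eqP => /res_eq0; case: (tau_tw i h c).
have red i (h : in_ind0 ind i) (a : residue (B_indec adm hind h)) : rstar a = a -> a != 0 ->
    exists x, rstar x * a * x = 1 \/ cond i true /\ rstar x * a * x = res (B_indec adm hind h) (tau i).
  have [stK stD stM] := stP i h; have [fT [f fI]] := fin i h; move=> sa a0.
  have [c|/existsNP nid] := pselect (forall t : residue (B_indec adm hind h), rstar t = t).
    have c' : cond i true by move=> _; exact/idE.
    have [_ _ _ _ ns] := tauP i h c'.
    have [x hx] := finite_square_class fI (@residue_unit _ _ _) (tau0 i h c') (ns _) a0.
    by exists x; rewrite c; case: hx => ?; [left|right].
  have [x e] := finite_norm_one fI (@residue_unit _ _ _) stK stD stM nid sa a0.
  by exists x; left.
have pair i (h : in_ind0 ind i) : cond i true -> exists p q : residue (B_indec adm hind h),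
    rstar p * res (B_indec adm hind h) (tau i) * p + rstar q * res (B_indec adm hind h) (tau i) * q = 1.
  move=> c; have [fT [f fI]] := fin i h.
  have [p [q e]] := finite_two_squares fI (@residue_unit _ _ _) (tau0 i h c).
  by exists p, q; rewrite !((idE i h).1 (c erefl)).
have sep i (h : in_ind0 ind i) : cond i true -> forall zs : seq (residue (B_indec adm hind h)),
    (true -> size zs <= 1)%N -> \sum_(z <- zs) rstar z * (res (B_indec adm hind h) (tau i))^-1 * z <> 1.
  (* At most one term is allowed. The empty sum is 0; and with the identity involution T(B) is
     commutative, so z t^-1 z = 1 would make t the square of z. *)
  move=> c [|z [|? ?]] /(_ isT) // _; first by rewrite big_nil => /eqP; rewrite eq_sym oner_eq0.
  have [stK stD stM] := stP i h; have rid := (idE i h).1 (c erefl).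
  have mulC (s t : residue (B_indec adm hind h)) : s * t = t * s by rewrite -[LHS]rid stM !rid.
  have u0 := residue_unit (tau0 i h c); have [_ _ _ _ ns] := tauP i h c.
  rewrite big_seq1 rid => e; apply: (ns _ z).
  by rewrite -[RHS]mulr1 -e (mulC z) -mulrA mulVKr.
apply: (classifiesP cf tau_tw red (once := true) (fun _ => pair) sep) => // ls.
by split=> -[ok am]; split=> //; exact: am.
Qed.

Theorem theorem2 :
  (* (a) K algebraically closed, identity involution, char K <> 2, P = K *)
  (forall (K : closedFieldType), (2%:R : K) != 0 ->
   let X := Ctx K K (fun x : K => x) (fun x : K => x) (fun x : K => x) in
   forall (C : lincat (cP X)) (s0 : obj C -> bool) (I : Type)
     (ind : I -> rdata X C) (I1 : I -> Prop) (B0 : I -> rdata X C),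
   setup s0 ind I1 B0 ->
   forall A : rdata X C, is_sa A ->
   classifies s0 ind B0 B0
     (fun ls => List.Forall (lab_ok ind I1 (fun i k => k = false)) ls) A)
  /\
  (* (b) K algebraically closed, nonidentity involution, char K <> 2, P = K *)
  (forall (K : closedFieldType) (bar : K -> K), (2%:R : K) != 0 ->
   is_involution bar -> (exists x : K, bar x != x) ->
   let X := Ctx K K (fun x : K => x) bar bar in
   forall (C : lincat (cP X)) (s0 : obj C -> bool) (I : Type)
     (ind : I -> rdata X C) (I1 : I -> Prop) (B0 : I -> rdata X C),
   setup s0 ind I1 B0 ->
   forall A : rdata X C, is_sa A ->
   classifies s0 ind B0
     (fun i => @rtwist X C s0 (B0 i) (fun u => - 1%:M) (fun u => - 1%:M))
     (fun ls => List.Forall (lab_ok ind I1 (fun i k => True)) ls) A)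
  /\
  (* (c) K real closed, or the quaternions over a real closed field P = center *)
  (forall (K : unitRingType) (P : rcfType) (emb : P -> K) (bar : K -> K) (barP : P -> P),
   (forall x : K, x != 0 -> x \is a GRing.unit) ->
   (forall a b, emb (a + b) = emb a + emb b) ->
   (forall a b, emb (a * b) = emb a * emb b) -> emb 1 = 1 ->
   (forall x : K, (forall y : K, x * y = y * x) <-> exists a, x = emb a) ->
   ((forall x : K, exists a, x = emb a) \/
    (exists i j : K, i * i = -1 /\ j * j = -1 /\ i * j = - (j * i) /\
       forall x : K, exists a b c d,
         x = emb a + emb b * i + emb c * j + emb d * (i * j))) ->
   is_involution bar -> (forall a, emb (barP a) = bar (emb a)) ->
   let X := Ctx K P emb bar barP in
   forall (C : lincat (cP X)) (s0 : obj C -> bool) (I : Type)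
     (ind : I -> rdata X C) (I1 : I -> Prop) (B0 : I -> rdata X C),
   setup s0 ind I1 B0 ->
   forall A : rdata X C, is_sa A ->
   classifies s0 ind B0
     (fun i => @rtwist X C s0 (B0 i) (fun u => - 1%:M) (fun u => - 1%:M))
     (fun ls => List.Forall (lab_ok ind I1
        (fun i k => k = true -> ~ (TB_acf_id (B0 i) \/ TB_quat_nonstd (B0 i)))) ls) A)
  /\
  (* (d) K a finite field, char K <> 2, any involution, P = K *)
  (forall (K : finFieldType) (bar : K -> K), (2%:R : K) != 0 ->
   is_involution bar ->
   let X := Ctx K K (fun x : K => x) bar bar in
   forall (C : lincat (cP X)) (s0 : obj C -> bool) (I : Type)
     (ind : I -> rdata X C) (I1 : I -> Prop) (B0 : I -> rdata X C)
     (f0 g0 : forall i u, 'M[cK X]_(rdim (B0 i) u)),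
   setup s0 ind I1 B0 ->
   (* for B in ind_0 with identity involution on T(B): f0 = f_t0 for a fixed
      nonsquare t0 of T(B), f0 = f0°, with inverse g0 *)
   (forall i, in_ind0 ind i -> TB_inv_id (B0 i) ->
      sa_auto (f0 i) (g0 i) /\ TB_nonsquare (f0 i)) ->
   forall A : rdata X C, is_sa A ->
   classifies s0 ind B0
     (fun i => rtwist s0 (f0 i) (g0 i))
     (fun ls => List.Forall (lab_ok ind I1 (fun i k => k = true -> TB_inv_id (B0 i))) ls
                /\ at_most_one_twist ls) A).
Proof.
split; first exact: classification_closed_id.
split; first exact: classification_closed_nonid.
split; first exact: classification_real.
exact: classification_finite.
Qed.
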